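(* There is an absolute constant $C>0$ such that for every $f\in B_{\infty,1}^1(\mathbb R^2)$ and arbitrary Borel spectral measures $E_1,E_2,E_3$ on $\mathbb R$, $$\mathfrak D^{[1]}f\in L^\infty(E_1)\otimes_{\rm h}L^\infty(E_2)\otimes^{\rm h}L^\infty(E_3),\qquad \mathfrak D^{[2]}f\in L^\infty(E_1)\otimes^{\rm h}L^\infty(E_2)\otimes_{\rm h}L^\infty(E_3),$$ and moreover $$\big\|\mathfrak D^{[1]}f\big\|_{L^\infty\otimes_{\rm h}L^\infty\otimes^{\rm h}L^\infty}\le C\|f\|_{B_{\infty,1}^1}\quad\text{and}\quad \big\|\mathfrak D^{[2]}f\big\|_{L^\infty\otimes^{\rm h}L^\infty\otimes_{\rm h}L^\infty}\le C\|f\|_{B_{\infty,1}^1}.$$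
   Context: Divided differences: $\mathfrak D^{[1]}f(x_1,x_2,y)=\frac{f(x_1,y)-f(x_2,y)}{x_1-x_2}$ and $\mathfrak D^{[2]}f(x,y_1,y_2)=\frac{f(x,y_1)-f(x,y_2)}{y_1-y_2}$; when $x_1=x_2$ (resp. $y_1=y_2$) the quotient is replaced by the partial derivative of $f$ in the first (resp. second) variable. Besov class: fix an infinitely differentiable $w\ge0$ on $\mathbb R$ with $\operatorname{supp}w\subset[1/2,2]$ and $w(s)=1-w(s/2)$ for $s\in[1,2]$. Define $W_n$, $n\in\mathbb Z$, on $\mathbb R^2$ by $(\mathscr FW_n)(x)=w(\|x\|_2/2^n)$ ($\mathscr F$ the Fourier transform), and $f_n=f*W_n$. $B_{\infty,1}^1(\mathbb R^2)$ is the space of tempered distributions $f$ with $\|f\|_{B_{\infty,1}^1}:=\sum_{n\in\mathbb Z}2^n\|f_n\|_{L^\infty}<\infty$ and $\partial f/\partial x_i=\sum_n\partial f_n/\partial x_i$ in $\mathscr S'(\mathbb R^2)$ for $i=1,2$. Such $f$ are continuously differentiable functions, determined by $\{f_n\}$ up to an additive constant. $\mathcal B$ is the space of matrices inducing bounded operators on $\ell^2$, with operator norm; $L^\infty(\ell^2)=L^\infty_E(\ell^2)$, $L^\infty(\mathcal B)=L^\infty_E(\mathcal B)$ are the spaces of $E$-essentially bounded measurable $\ell^2$-valued, resp. $\mathcal B$-valued (entrywise measurable), functions with the essential supremum norm. $\sum_{j,k\ge0}$ means $\lim_{M,N\to\infty}\sum_{j=0}^N\sum_{k=0}^M$. $\Psi\in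 L^\infty(E_1)\otimes_{\rm h}L^\infty(E_2)\otimes^{\rm h}L^\infty(E_3)$ (first kind) if $\Psi(x_1,x_2,x_3)=\sum_{j,k\ge0}\alpha_j(x_1)\beta_k(x_2)\gamma_{jk}(x_3)$ with $\{\alpha_j\},\{\beta_k\}\in L^\infty(\ell^2)$, $\{\gamma_{jk}\}\in L^\infty(\mathcal B)$. $\Psi\in L^\infty(E_1)\otimes^{\rm h}L^\infty(E_2)\otimes_{\rm h}L^\infty(E_3)$ (second kind) if $\Psi(x_1,x_2,x_3)=\sum_{j,k\ge0}\alpha_{jk}(x_1)\beta_j(x_2)\gamma_k(x_3)$ with $\{\alpha_{jk}\}\in L^\infty(\mathcal B)$, $\{\beta_j\},\{\gamma_k\}\in L^\infty(\ell^2)$. In each case the norm is the infimum, over all such representations, of the product of the three $L^\infty(\ell^2)$, $L^\infty(\mathcal B)$ norms. *)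

(* Defs.v *)
From HB Require Import structures.
From mathcomp Require Import all_boot all_order all_algebra complex sesquilinear.
From mathcomp Require Import all_classical all_reals all_analysis ess_sup_inf.

Set Implicit Arguments.
Unset Strict Implicit.
Unset Printing Implicit Defensive.

Import Order.TTheory GRing.Theory Num.Theory.
Import numFieldNormedType.Exports.

Local Open Scope classical_set_scope.
Local Open Scope ring_scope.
Local Open Scope complex_scope.

Section ComplexFunctions.
Context {R : realType}.
Implicit Types (phi : R * R -> R[i]) (i : bool).

Definition Cabs (z : R[i]) : R := ComplexField.Normc.normc z.

Definition Ccvg {I : Type} (F : set_system I) (u : I -> R[i]) (l : R[i]) : Prop :=
  (fun k => Cabs (u k - l)) @ F --> (0 : R).

Definition Cmeasurable (g : R -> R[i]) : Prop :=
  measurable_fun setT (fun x => complex.Re (g x)) /\ measurable_fun setT (fun x => complex.Im (g x)).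

Definition lebesgue2 := (@lebesgue_measure R \x @lebesgue_measure R)%E.

Definition Cintegrable phi : Prop :=
  lebesgue2.-integrable setT (EFin \o (fun p => complex.Re (phi p))) /\
  lebesgue2.-integrable setT (EFin \o (fun p => complex.Im (phi p))).

Definition Cintegral phi : R[i] :=
  Rintegral lebesgue2 setT (fun p => complex.Re (phi p)) +i*
  Rintegral lebesgue2 setT (fun p => complex.Im (phi p)).

Definition Ccontinuous phi : Prop :=
  continuous (fun p => complex.Re (phi p)) /\ continuous (fun p => complex.Im (phi p)).

(* [false] is the first variable, [true] the second. *)
Definition dir i : R * R := if i then (0, 1) else (1, 0).

Definition pderivable i phi (p : R * R) : Prop :=
  derivable (fun q => complex.Re (phi q)) p (dir i) /\
  derivable (fun q => complex.Im (phi q)) p (dir i).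

Definition pderiv i phi (p : R * R) : R[i] :=
  'D_(dir i) (fun q => complex.Re (phi q)) p +i* 'D_(dir i) (fun q => complex.Im (phi q)) p.

Definition pderivs (s : seq bool) phi : R * R -> R[i] := foldr pderiv phi s.

Definition C1 phi : Prop :=
  forall i, (forall p, pderivable i phi p) /\ Ccontinuous (pderiv i phi).

Definition smooth phi : Prop :=
  forall s, Ccontinuous (pderivs s phi) /\
            forall i p, pderivable i (pderivs s phi) p.

Definition norm2 (p : R * R) : R := Num.sqrt (p.1 ^+ 2 + p.2 ^+ 2).

Definition schwartz phi : Prop :=
  smooth phi /\
  forall (a : nat) (s : seq bool), exists B : R,
    forall p, (1 + norm2 p) ^+ a * Cabs (pderivs s phi p) <= B.

(* (F phi)(t) = \int phi(x) e^{- i <x, t>} dx *)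
Definition fourier phi (t : R * R) : R[i] :=
  Cintegral (fun x => let s := x.1 * t.1 + x.2 * t.2 in
                      phi x * (cos s -i* sin s)).

End ComplexFunctions.

Section Distributions.
Context {R : realType}.
Implicit Types (phi psi g : R * R -> R[i]) (T : (R * R -> R[i]) -> R[i]).

(* T stands for its restriction to Schwartz functions; continuity is expressed
   as a bound by finitely many Schwartz seminorms. *)
Definition tempered T : Prop :=
  (forall (a : R[i]) phi psi, schwartz phi -> schwartz psi ->
     T (fun p => a * phi p + psi p) = a * T phi + T psi) /\
  (exists (N : nat) (M : R), forall phi, schwartz phi -> forall B : R,
     (forall (a : nat) (s : seq bool), (a <= N)%N -> (size s <= N)%N ->
        forall p, (1 + norm2 p) ^+ a * Cabs (pderivs s phi p) <= B) ->
     Cabs (T phi) <= M * B).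

Definition dist_of g : (R * R -> R[i]) -> R[i] :=
  fun phi => Cintegral (fun p => g p * phi p).

Definition represents g T : Prop :=
  forall phi, schwartz phi ->
    Cintegrable (fun p => g p * phi p) /\ T phi = dist_of g phi.

Definition dist_deriv (i : bool) T : (R * R -> R[i]) -> R[i] :=
  fun phi => - T (pderiv i phi).

Definition dist_conv T phi : R * R -> R[i] := fun x => T (fun y => phi (x - y)).

End Distributions.

Section Besov.
Context {R : realType}.
Implicit Types (T : (R * R -> R[i]) -> R[i]) (W : int -> R * R -> R[i]).

Definition lp_profile (w : R -> R) : Prop :=
  [/\ forall (n : nat) x, derivable (derive1n n w) x 1,
      forall s, 0 <= w s,
      closure [set s | w s != 0] `<=` `[2^-1, 2] &
      forall s, 1 <= s <= 2 -> w s = 1 - w (s / 2)].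

(* Since [W n] is Schwartz, its Fourier transform determines it. *)
Definition lp_kernels (w : R -> R) W : Prop :=
  forall n : int, schwartz (W n) /\
    forall x, fourier (W n) x = (w (norm2 x / 2 ^ n))%:C.

Definition Linfty_norm (g : R * R -> R[i]) : \bar R :=
  ess_sup lebesgue2 (fun p => (Cabs (g p))%:E).

Definition besov_norm W T : \bar R :=
  (\esum_(n in [set: int]) (((2 : R) ^ n)%R%:E * Linfty_norm (dist_conv T (W n))))%E.

(* a sum over -M <= n < N; [Negz k] is - (k + 1) *)
Definition zsum (u : int -> R[i]) (MN : nat * nat) : R[i] :=
  \sum_(k < MN.1) u (Negz k) + \sum_(k < MN.2) u (Posz k).

Definition besov W T : Prop :=
  [/\ tempered T,
      (besov_norm W T < +oo)%E &
      forall (i : bool) phi, schwartz phi ->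
        Ccvg (filter_prod \oo \oo)
          (zsum (fun n => dist_deriv i (dist_of (dist_conv T (W n))) phi))
          (dist_deriv i T phi)].

End Besov.

Section DividedDifferences.
Context {R : realType}.
Variable f : R * R -> R[i].

Definition divdiff1 (x1 x2 y : R) : R[i] :=
  if x1 == x2 then pderiv false f (x1, y)
  else (f (x1, y) - f (x2, y)) / (x1 - x2)%:C.

Definition divdiff2 (x y1 y2 : R) : R[i] :=
  if y1 == y2 then pderiv true f (x, y1)
  else (f (x, y1) - f (x, y2)) / (y1 - y2)%:C.

End DividedDifferences.

Record hilbertType (R : realType) := HilbertType {
  hilbert_sort :> completeNormedModType R[i];
  hdot : {dot hilbert_sort for Num.conj};
  hdot_norm : forall u : hilbert_sort, `|u| ^+ 2 = hdot u u }.

Section Spectral.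
Context {R : realType}.
Implicit Types H : hilbertType R.

Definition orthoproj H (P : H -> H) : Prop :=
  [/\ linear P, forall u, P (P u) = P u &
      forall u v, hdot H (P u) v = hdot H u (P v)].

(* Countable additivity is in the strong operator topology; the values of E
   outside the Borel sets are irrelevant. *)
Record spectral_measure H := SpectralMeasure {
  spm :> set R -> H -> H;
  spm_proj : forall A, measurable A -> orthoproj (spm A);
  spm_setT : forall u, spm setT u = u;
  spm_sigma_additive : forall A : nat -> set R,
    (forall n, measurable (A n)) -> trivIset setT A ->
    forall u, (\sum_(0 <= k < n) spm (A k) u) @[n --> \oo]
                --> spm (\bigcup_n A n) u }.

Definition spm_null H (E : spectral_measure H) (N : set R) : Prop :=
  exists A, [/\ measurable A, forall u, E A u = 0 & N `<=` A].

(* Used for g >= 0; without [0 <= y] the value would be -oo when H is the zero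
   space. *)
Definition spm_ess_sup H (E : spectral_measure H) (g : R -> \bar R) : \bar R :=
  ereal_inf [set y | (0 <= y)%E /\ spm_null E [set x | ~ (g x <= y)%E]].

End Spectral.

Section Haagerup.
Context {R : realType}.
Implicit Types H : hilbertType R.

Definition l2norm (a : nat -> R[i]) : \bar R :=
  ((\sum_(0 <= j <oo) ((Cabs (a j)) ^+ 2)%:E) `^ (2^-1))%E.

(* The norm of the operator on l^2 induced by a matrix, and +oo if there is no
   such bounded operator. *)
Definition opnorm (g : nat -> nat -> R[i]) : \bar R :=
  ereal_inf [set (M%:E) | M in [set M : R | 0 <= M /\
    forall a, (l2norm a < +oo)%E -> exists2 b,
      (forall j, Ccvg \oo (fun n => \sum_(0 <= k < n) g j k * a k) (b j)) &
      (l2norm b <= M%:E * l2norm a)%E]].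

Definition Linfty_l2_norm H (E : spectral_measure H) (a : R -> nat -> R[i]) :=
  spm_ess_sup E (fun x => l2norm (a x)).

Definition Linfty_l2 H (E : spectral_measure H) (a : R -> nat -> R[i]) : Prop :=
  [/\ forall j, Cmeasurable (fun x => a x j),
      forall x, (l2norm (a x) < +oo)%E & (Linfty_l2_norm E a < +oo)%E].

Definition Linfty_B_norm H (E : spectral_measure H) (g : R -> nat -> nat -> R[i]) :=
  spm_ess_sup E (fun x => opnorm (g x)).

Definition Linfty_B H (E : spectral_measure H) (g : R -> nat -> nat -> R[i]) : Prop :=
  [/\ forall j k, Cmeasurable (fun x => g x j k),
      forall x, (opnorm (g x) < +oo)%E & (Linfty_B_norm E g < +oo)%E].

Section Tensor.
Context {H1 H2 H3 : hilbertType R}.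
Variables (E1 : spectral_measure H1) (E2 : spectral_measure H2)
          (E3 : spectral_measure H3) (Psi : R -> R -> R -> R[i]).

(* The representation is required at every point, not just almost everywhere. *)
Definition tensor1_rep a b g : Prop :=
  [/\ Linfty_l2 E1 a, Linfty_l2 E2 b, Linfty_B E3 g &
      forall x1 x2 x3, Ccvg (filter_prod \oo \oo)
        (fun MN : nat * nat => \sum_(j < MN.2.+1) \sum_(k < MN.1.+1)
           a x1 j * b x2 k * g x3 j k) (Psi x1 x2 x3)].

Definition tensor1 : Prop := exists a b g, tensor1_rep a b g.

Definition tensor1_norm : \bar R :=
  ereal_inf [set r | exists a b g, tensor1_rep a b g /\
    r = (Linfty_l2_norm E1 a * Linfty_l2_norm E2 b * Linfty_B_norm E3 g)%E].

Definition tensor2_rep a b g : Prop :=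
  [/\ Linfty_B E1 a, Linfty_l2 E2 b, Linfty_l2 E3 g &
      forall x1 x2 x3, Ccvg (filter_prod \oo \oo)
        (fun MN : nat * nat => \sum_(j < MN.2.+1) \sum_(k < MN.1.+1)
           a x1 j k * b x2 j * g x3 k) (Psi x1 x2 x3)].

Definition tensor2 : Prop := exists a b g, tensor2_rep a b g.

Definition tensor2_norm : \bar R :=
  ereal_inf [set r | exists a b g, tensor2_rep a b g /\
    r = (Linfty_B_norm E1 a * Linfty_l2_norm E2 b * Linfty_l2_norm E3 g)%E].

End Tensor.
End Haagerup.

(* Main.v *)
Require Import Defs.
From HB Require Import structures.
From mathcomp Require Import all_boot all_order all_algebra complex sesquilinear finmap.
From mathcomp Require Import all_classical all_reals all_analysis ess_sup_inf measurable_realfun.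
From mathcomp Require Import zify ring lra.

Set Implicit Arguments.
Unset Strict Implicit.
Unset Printing Implicit Defensive.

Import Order.TTheory GRing.Theory Num.Theory.
Import numFieldNormedType.Exports.

Local Open Scope classical_set_scope.
Local Open Scope ring_scope.

(* Fix a dyadic block [g = f_n], whose spectrum lies in the ball of radius
   [2 * 2 ^ n], and sample with step [d = 2 ^ (- n - 1)].  For fixed [c] the function
   [t |-> (g (t) - g (c)) / (t - c)] is again band limited, so it is recovered from its
   samples by a rapidly decaying interpolation kernel [k].  Doing this in [x1] on
   [d Z] and then in [x2] on [d (Z + 1/2)] gives
     [(g (x1, y) - g (x2, y)) / (x1 - x2) = sum_(j, l) k_j (x1) k_l (x2) gamma_jl (y)],
   where [gamma_jl (y) = (g (d j, y) - g (d (l + 1/2), y)) / (d (j - l - 1/2))] is a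
   Hilbert matrix multiplied by bounded diagonal matrices on either side, hence has
   operator norm [O (2 ^ n |g|_oo)], while the [k_j (x)] are bounded in [l^2].  Since
   the sampling identity only involves finitely many values of [g = T (W_n (x - .))]
   up to small errors, it is proved for exponentials, then for [W_n] and its
   derivatives, and passes to [g] by the seminorm bound for [T].

   The blocks are put together as a block diagonal matrix, the weights
   [2 ^ n |f_n|_oo] being distributed as square roots over the two vectors.  The
   differences of [f] are the sums of the differences of the [f_n]: the function
   [f - sum_n (f_n - f_n (0))] is continuous and annihilates the derivatives of all
   Gaussians, hence is constant.  The diagonal [x1 = x2] follows by continuity. *)

(** * Unconditional sums *)

(** The order [N] of the distribution is arbitrary, and carrying a relation from exponentials to [g]
    costs [N] powers of kernel decay. The kernel therefore depends on [N], through [L = N + 2],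
    whereas the constant must not. The two are reconciled because the final norms see the kernel
    only through [|k x| <= 2 / (1 + |x|)], valid for every [L]; estimates whose constants depend on
    [N] serve convergence alone. Oversampling makes room for the decay: with step [d] the
    frequencies of a block become at most 1, while sampling on the integers tolerates frequencies up
    to [pi], and the gap pays for the extra sinc factors. The shift by 1/2 removes the singular
    entries of the Hilbert matrix and makes its columns orthogonal. Fourier inversion enters only in
    Abel-summed form: Poisson integrals transport a relation between point values from exponentials
    to the slices of [W n]. Real and imaginary parts are treated separately, which doubles the bound
    for the matrix; the constant is [1080 = 20 * 54]. *)

Section UnconditionalSums.
Context {R : realType}.

(** Convergence along the net of finite subsets, so that reindexing and regrouping need no
    enumeration of [I]. *)
Definition sums (I : choiceType) (u : I -> R) (l : R) : Prop :=
  forall e, 0 < e -> exists A : {fset I}, forall B : {fset I}, (A `<=` B)%fset ->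
    `|\sum_(i <- B) u i - l| <= e.

(** The l^1 norm is at most [M], expressed without forming the sum; such bounds pass to subfamilies
    and products directly. *)
Definition abs_bounded (I : choiceType) (u : I -> R) (M : R) : Prop :=
  forall A : {fset I}, \sum_(i <- A) `|u i| <= M.

Lemma big_fset_cat (I : choiceType) (u : I -> R) (A B : {fset I}) :
  (A `<=` B)%fset -> \sum_(i <- B) u i = \sum_(i <- A) u i + \sum_(i <- (B `\` A)%fset) u i.
Proof.
move=> AB; rewrite (big_fsetID _ (mem A)) /=; congr (_ + _).
  apply: eq_fbigl => i; rewrite !inE /= andbC.
  by case: (boolP (i \in A)) => //= /(fsubsetP AB) ->.
by apply: eq_fbigl => i; rewrite !inE /= andbC.
Qed.

Lemma sums_unique (I : choiceType) (u : I -> R) l l' : sums u l -> sums u l' -> l = l'.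
Proof.
move=> h h'; apply/eqP; rewrite -subr_eq0 -normr_le0; apply/ler_addgt0Pl => e e0.
have e2 : 0 < e / 2 by lra.
have [A hA] := h _ e2; have [B hB] := h' _ e2.
have := hA (A `|` B)%fset (fsubsetUl _ _); have := hB (A `|` B)%fset (fsubsetUr _ _).
set s := \sum_(i <- _) _ => h1 h2.
rewrite (_ : l - l' = (s - l') - (s - l)); last by ring.
rewrite (le_trans (ler_normB _ _))//; lra.
Qed.

Lemma eq_sums (I : choiceType) (u v : I -> R) l : u =1 v -> sums u l -> sums v l.
Proof.
move=> uv h e /h[A hA]; exists A => B /hA.
by rewrite (eq_bigr _ (fun i _ => uv i)).
Qed.

Lemma sumsD (I : choiceType) (u v : I -> R) l m : sums u l -> sums v m ->
  sums (fun i => u i + v i) (l + m).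
Proof.
move=> h h' e e0; have e2 : 0 < e / 2 by lra.
have [A hA] := h _ e2; have [B hB] := h' _ e2; exists (A `|` B)%fset => C /fsubUsetP[AC BC].
have := hA _ AC; have := hB _ BC; rewrite big_split /=.
set s := \sum_(i <- _) _; set t := \sum_(i <- _) _ => h1 h2.
rewrite (_ : _ - _ = (t - l) + (s - m)); last by ring.
rewrite (le_trans (ler_normD _ _))//; lra.
Qed.

Lemma sumsZ (I : choiceType) (u : I -> R) a l : sums u l -> sums (fun i => a * u i) (a * l).
Proof.
move=> h e e0; have a1 : 0 < `|a| + 1 by rewrite ltr_wpDl.
have [A hA] := h _ (divr_gt0 e0 a1); exists A => B /hA hB.
rewrite -mulr_sumr -mulrBr normrM.
rewrite (le_trans (ler_wpM2l _ hB))// mulrCA ler_piMr ?(ltW e0)//.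
by rewrite ler_pdivrMr// mul1r lerDl.
Qed.

Lemma sumsB (I : choiceType) (u v : I -> R) l m : sums u l -> sums v m ->
  sums (fun i => u i - v i) (l - m).
Proof.
move=> h /(sumsZ (-1)) h'; have := sumsD h h'; rewrite mulN1r.
by apply: eq_sums => i; rewrite mulN1r.
Qed.

Lemma sums0 (I : choiceType) : sums (fun _ : I => 0) 0.
Proof. by move=> e e0; exists fset0 => B _; rewrite big1 ?subr0 ?normr0// ltW. Qed.

Lemma abs_bounded_ge0 (I : choiceType) (u : I -> R) M : abs_bounded u M -> 0 <= M.
Proof. by move/(_ fset0); rewrite big_seq_fset0. Qed.

Lemma abs_bounded_le (I : choiceType) (u v : I -> R) M :
  (forall i, `|u i| <= `|v i|) -> abs_bounded v M -> abs_bounded u M.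
Proof. by move=> uv h A; apply: le_trans (h A); apply: ler_sum => i _. Qed.

Lemma abs_boundedZ (I : choiceType) (u : I -> R) a M :
  abs_bounded u M -> abs_bounded (fun i => a * u i) (`|a| * M).
Proof.
move=> h A; under eq_bigr do rewrite normrM.
by rewrite -mulr_sumr ler_wpM2l.
Qed.

Lemma abs_boundedD (I : choiceType) (u v : I -> R) M N :
  abs_bounded u M -> abs_bounded v N -> abs_bounded (fun i => u i + v i) (M + N).
Proof.
move=> h h' A; apply: le_trans (lerD (h A) (h' A)).
by rewrite -big_split; apply: ler_sum => i _; exact: ler_normD.
Qed.

(** The partial sums of [|u|] have a supremum; to a set [A] that comes within [e] of it, a disjoint
    set can add at most [e]. *)
Lemma abs_bounded_tail (I : choiceType) (u : I -> R) M : abs_bounded u M ->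
  forall e, 0 < e -> exists A : {fset I}, forall B : {fset I}, [disjoint A & B]%fset ->
    \sum_(i <- B) `|u i| <= e.
Proof.
move=> h e e0.
pose S : set R := [set \sum_(i <- A) `|u i| | A in [set: {fset I}]]%classic.
have hS : has_sup S.
  split; first by exists (\sum_(i <- fset0 : {fset I}) `|u i|); exists fset0.
  by exists M => _ [A _ <-].
have [_ [A _ <-] hA] := sup_adherent e0 hS.
exists A => B AB.
have : \sum_(i <- (A `|` B)%fset) `|u i| <= sup S.
  by apply: ub_le_sup; [exact: hS.2|exists (A `|` B)%fset].
rewrite (big_fset_cat _ (fsubsetUl A B)) (_ : ((A `|` B) `\` A)%fset = B); first lra.
apply/fsetP => i; rewrite !inE; case: (boolP (i \in A)) => //= iA.
by move/fdisjointP : AB => /(_ _ iA) /negbTE.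
Qed.

(** The limit is approached through supersets of [B], and what these add to [B] is disjoint from
    [A]. *)
Lemma sums_tail (I : choiceType) (u : I -> R) l A e : sums u l ->
  (forall B : {fset I}, [disjoint A & B]%fset -> \sum_(i <- B) `|u i| <= e) ->
  forall B : {fset I}, (A `<=` B)%fset -> `|\sum_(i <- B) u i - l| <= e.
Proof.
move=> h hA B AB; apply/ler_addgt0Pl => d d0.
have [C hC] := h _ d0.
have := hC _ (fsubsetUl C B); rewrite (big_fset_cat _ (fsubsetUr C B)).
set x := \sum_(i <- B) _; set y := \sum_(i <- _) _ => h1.
have : `|y| <= e.
  apply: le_trans (ler_norm_sum _ _ _) (hA _ _).
  apply/fdisjointP => i iA; rewrite !inE negb_and negbK.
  by rewrite (fsubsetP AB).
rewrite (_ : x - l = (x + y - l) - y); last by ring.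
move=> h2; rewrite (le_trans (ler_normB _ _))//; lra.
Qed.

(** A nonnegative family sums to the supremum of its partial sums; in general [u] is the difference
    of [|u| + u] and [|u|]. *)
Lemma sums_exist (I : choiceType) (u : I -> R) M : abs_bounded u M -> exists l, sums u l.
Proof.
move=> h.
have pos (v : I -> R) N : (forall i, 0 <= v i) -> abs_bounded v N -> exists l, sums v l.
  move=> v0 hv.
  pose S : set R := [set \sum_(i <- A) v i | A in [set: {fset I}]]%classic.
  have hS : has_sup S.
    split; first by exists (\sum_(i <- fset0 : {fset I}) v i); exists fset0.
    exists N => _ [A _ <-]; apply: le_trans (hv A).
    by apply: ler_sum => i _; rewrite ler_norm.
  exists (sup S) => e e0; have [_ [A _ <-] hA] := sup_adherent e0 hS.
  exists A => B AB.
  have : \sum_(i <- B) v i <= sup S by apply: ub_le_sup; [exact: hS.2|exists B].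
  have : \sum_(i <- A) v i <= \sum_(i <- B) v i.
    by rewrite (big_fset_cat _ AB) lerDl sumr_ge0.
  by rewrite ler_norml; lra.
have [] := pos (fun i => `|u i| + u i) (M + M).
- by move=> i; have := ler_norm (- u i); rewrite normrN; lra.
- by apply: abs_boundedD => //; apply: abs_bounded_le h => i; rewrite normr_id.
move=> l hl; have [|m hm] := pos (fun i => `|u i|) M (fun=> normr_ge0 _).
  by apply: abs_bounded_le h => i; rewrite normr_id.
by exists (l - m); apply: eq_sums (sumsB hl hm) => i; ring.
Qed.

Lemma sums_abs_le (I : choiceType) (u : I -> R) M l : abs_bounded u M -> sums u l -> `|l| <= M.
Proof.
move=> h hl; apply/ler_addgt0Pl => e /hl[A /(_ A (fsubset_refl _)) hA].
have := h A; have := ler_norm_sum A u (fun=> true).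
set s := \sum_(i <- A) u i in hA * => h1 h2.
rewrite (_ : l = s - (s - l)); last by ring.
rewrite (le_trans (ler_normB _ _))//; lra.
Qed.

(** Dominated convergence for series: off one finite set the tails of all [u t] are at most [e / 4],
    uniformly in [t], so only finitely many terms have to converge. *)
Lemma tannery (I : choiceType) (T : Type) (F : set_system T) (FF : Filter F)
    (u : T -> I -> R) (u0 v : I -> R) (l : T -> R) (l0 M : R) :
  (forall i, u ^~ i @ F --> u0 i) ->
  (\forall t \near F, forall i, `|u t i| <= v i) ->
  abs_bounded v M -> (\forall t \near F, sums (u t) (l t)) -> sums u0 l0 ->
  l @ F --> l0.
Proof.
move=> uu0 uv hv hl hl0; apply/cvgrPdist_le => e e0.
have e4 : 0 < e / 4 by lra.
have [A hA] := abs_bounded_tail hv e4.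
have [C hC] := hl0 _ e4.
pose D := (A `|` C)%fset.
have : (fun t => \sum_(i <- D) u t i) @ F --> \sum_(i <- D) u0 i.
  by apply: cvg_big => [|i _]; [exact: add_continuous|exact: uu0].
move/cvgrPdist_le => /(_ _ e4) h1.
near=> t.
have k1 : `|\sum_(i <- D) u0 i - \sum_(i <- D) u t i| <= e / 4 by near: t.
have k2 := hC _ (fsubsetUr A C : C `<=` D)%fset.
have k3 : `|\sum_(i <- D) u t i - l t| <= e / 4.
  apply: (@sums_tail I (u t) (l t) A) => //; last exact: fsubsetUl.
  - by near: t.
  - move=> B /hA; apply: le_trans; apply: ler_sum => i _.
    have /(_ i) : forall i, `|u t i| <= v i by near: t.
    by move/le_trans; apply; exact: ler_norm.
set x := \sum_(i <- _) _ in k1 k2; set y := \sum_(i <- _) _ in k1 k3.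
rewrite (_ : l0 - l t = (x - y) + (y - l t) - (x - l0)); last by ring.
rewrite (le_trans (ler_normB _ _))// (le_trans (lerD (ler_normD _ _) (lexx _)))//; lra.
Unshelve. all: by end_near. Qed.

End UnconditionalSums.

(** * Absolutely convergent sums over the integers *)

Section IntegerSums.
Context {R : realType}.

Lemma ler_sum_uniq (I : eqType) (s t : seq I) (v : I -> R) :
  uniq s -> {subset s <= t} -> (forall i, 0 <= v i) ->
  \sum_(i <- s) v i <= \sum_(i <- t) v i.
Proof.
move=> us st v0.
have : \sum_(i <- s) v i <= \sum_(i <- undup t) v i.
  rewrite [leRHS](bigID (mem s)) /= -[X in _ <= X + _]big_filter.
  rewrite (perm_big [seq i <- undup t | i \in s]) /=; first by rewrite lerDl sumr_ge0.
  apply: uniq_perm => //; first by rewrite filter_uniq ?undup_uniq.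
  move=> i; rewrite mem_filter mem_undup.
  by case: (boolP (i \in s)) => //= /st ->.
move/le_trans; apply.
elim: t {st} => //= i t IH; case: ifP => it; rewrite ?big_cons; last by rewrite lerD2l.
by apply: le_trans IH _; rewrite lerDr.
Qed.

(** The induction carries the sharper bound [2 - 1 / (K + 1)], since
    [(a + 1) ^- 2 <= 1 / a - 1 / (a + 1)]. *)
Lemma sum_inv_sqr (K : nat) : \sum_(m < K) ((m.+1)%:R ^- 2 : R) <= 2.
Proof.
case: K => [|K]; first by rewrite big_ord0.
suff : \sum_(m < K.+1) ((m.+1)%:R ^- 2 : R) <= 2 - (K.+1)%:R^-1.
  by move/le_trans; apply; rewrite gerBl.
elim: K => [|K IH]; first by rewrite big_ord_recr big_ord0 /= expr1n invr1; lra.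
rewrite big_ord_recr /= -exprVn.
have a0 : 0 < (K.+1)%:R :> R by [].
have -> : (K.+2)%:R = (K.+1)%:R + 1 :> R by rewrite -natr1.
move: (K.+1)%:R a0 IH => a a0 IH.
apply: le_trans (lerD IH (lexx _)) _.
have : (a + 1)^-1 ^+ 2 <= a^-1 - (a + 1)^-1.
  have -> : a^-1 - (a + 1)^-1 = a^-1 * (a + 1)^-1.
    by field; rewrite !gt_eqF //; lra.
  by rewrite expr2 ler_wpM2r ?invr_ge0 ?lef_pV2 ?posrE //; lra.
lra.
Qed.

(** [5 = 1 + 2 + 2]: with [z] the floor of [t], the term at [z] is at most 1, and the terms at
    [z + (m + 1)] and [z - (m + 1)] are at most [(m + 1) ^- 2]. *)
Lemma decay_abs_bounded (t : R) : abs_bounded (fun j : int => (1 + `|t - j%:~R|) ^- 2) 5.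
Proof.
move=> A; pose z := Num.floor t.
have [K hK] : exists K : nat, forall i, i \in A -> (absz (i - z)%R < K)%N.
  exists (\max_(i <- A) absz (i - z)%R).+1 => i iA; rewrite ltnS.
  by rewrite (big_rem i) //= leq_maxl.
pose s := z :: [seq z + (Posz m.+1) | m <- iota 0 K] ++ [seq z - (Posz m.+1) | m <- iota 0 K].
apply: (@le_trans _ _ (\sum_(i <- s) `|(1 + `|t - i%:~R|) ^- 2|)).
  apply: ler_sum_uniq => // i iA; have := hK _ iA.
  rewrite /s inE mem_cat; case E : (i - z) => [[|m]|m] h.
  - by apply/orP; left; apply/eqP; lia.
  - apply/orP; right; apply/orP; left; apply/mapP; exists m; last lia.
    by rewrite mem_iota /=; move: h; rewrite /= ; lia.
  - apply/orP; right; apply/orP; right; apply/mapP; exists m; last lia.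
    by rewrite mem_iota /=; move: h; rewrite /= ; lia.
have pos (x : R) : 0 < 1 + `|x| by rewrite ltr_pwDl.
have z1 : z%:~R <= t by exact: ge_floor.
have z2 : t < z%:~R + 1 by have := floorD1_gt t; rewrite intrD.
rewrite /s big_cons big_cat /= !big_map.
have b0 (x : R) : `|(1 + `|x|) ^- 2| <= 1.
  rewrite ger0_norm; last by rewrite invr_ge0 exprn_ge0 // ltW.
  by rewrite invf_le1 ?exprn_gt0 // expr_ge1 ?lerDl // ltW.
have b1 (x : R) (m : nat) : m.+1%:R <= 1 + `|x| -> `|(1 + `|x|) ^- 2| <= m.+1%:R ^- 2.
  move=> h; rewrite ger0_norm; last by rewrite invr_ge0 exprn_ge0 // ltW.
  by rewrite lef_pV2 ?posrE ?exprn_gt0 // lerXn2r ?nnegrE // ltW.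
have -> : 5 = 1 + (2 + 2) :> R by ring.
rewrite lerD // lerD //.
  apply: le_trans (sum_inv_sqr K); rewrite -[X in iota _ X]subn0 -/(index_iota 0 K) big_mkord.
  apply: ler_sum => m _; apply: b1.
  rewrite intrD -natr1 /= -[(Posz m.+1)%:~R]/(m.+1%:R : R) -natr1.
  have := ler_norm (- (t - (z%:~R + (m%:R + 1)))); rewrite normrN; lra.
apply: le_trans (sum_inv_sqr K); rewrite -[X in iota _ X]subn0 -/(index_iota 0 K) big_mkord.
apply: ler_sum => m _; apply: b1.
rewrite intrB -natr1 /= -[(Posz m.+1)%:~R]/(m.+1%:R : R) -natr1.
have := ler_norm ((t - (z%:~R - (m%:R + 1)))); lra.
Qed.

Lemma sums_finite (I : choiceType) (u : I -> R) (A : {fset I}) :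
  (forall i, i \notin A -> u i = 0) -> sums u (\sum_(i <- A) u i).
Proof.
move=> h e e0; exists A => B AB; rewrite (big_fset_cat _ AB) addrAC subrr add0r.
rewrite big_seq big1 ?normr0 ?ltW // => i; rewrite !inE => /andP[iA _]; exact: h.
Qed.

End IntegerSums.

(** * Finite cosine products and the sinc function *)

Section Kernel.
Context {R : realType}.
Implicit Types (x t : R).

Lemma sin_abs_le x : `|sin x| <= `|x|.
Proof.
wlog x0 : x / 0 < x.
  move=> h; have [x0|x0|->] := ltgtP x 0; [|exact: h|].
    by rewrite -normrN -sinN -(normrN x) h // oppr_gt0.
  by rewrite sin0 normr0.
have [] := @MVT R sin cos 0 x x0 (fun y _ => is_derive_sin y).
- by apply: continuous_subspaceT => y; exact: continuous_sin.
move=> c _; rewrite sin0 !subr0 => ->.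
by rewrite normrM ler_piMl // cos_max.
Qed.

Lemma cos_ge_quad x : 1 - x ^+ 2 / 2 <= cos x.
Proof.
have -> : x = (x / 2) *+ 2 by rewrite -mulr_natr; field.
rewrite cos_mulr2n cos2sin2.
have : sin (x / 2) ^+ 2 <= (x / 2) ^+ 2.
  by rewrite -[leLHS]real_normK ?num_real // -[leRHS]real_normK ?num_real // lerXn2r ?nnegrE // sin_abs_le.
lra.
Qed.

(** For [0 < x <= 2] write [sin x = 2 sin (x / 2) cos (x / 2)]; on [[0, 1]] the cosine is at least
    1/2, so [sin (x / 2)] is at least [x / 4] by the mean value theorem. *)
Lemma sin_abs_ge x : `|x| <= 2 -> `|x| / 4 <= `|sin x|.
Proof.
wlog x0 : x / 0 < x.
  move=> h; have [x0|x0|->] := ltgtP x 0; [|exact: h|].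
    by have := h (- x); rewrite sinN !normrN oppr_gt0 => /(_ x0).
  by rewrite sin0 normr0 mul0r.
rewrite gtr0_norm // => x2; apply: le_trans (ler_norm _).
have y0 : 0 < x / 2 by rewrite divr_gt0.
have cos_half (y : R) : 0 <= y <= 1 -> 1 / 2 <= cos y.
  move=> /andP[h0 h1]; apply: le_trans (cos_ge_quad y).
  have : y ^+ 2 <= 1 by rewrite expr_le1.
  lra.
have -> : sin x = 2 * (sin (x / 2) * cos (x / 2)).
  have {1}-> : x = (x / 2) *+ 2 by rewrite -mulr_natr; field.
  by rewrite sin_mulr2n -mulr_natr; ring.
have [] := @MVT R sin cos 0 (x / 2) y0 (fun y _ => is_derive_sin y).
- by apply: continuous_subspaceT => y; exact: continuous_sin.
move=> c; rewrite in_itv /= => /andP[c0 c1]; rewrite sin0 !subr0 => ->.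
have c2 : 1 / 2 <= cos c by apply: cos_half; lra.
have c3 : 1 / 2 <= cos (x / 2) by apply: cos_half; lra.
have -> : x / 4 = 2 * ((1 / 2 * (x / 2)) * (1 / 2)) by field.
rewrite ler_wpM2l // ler_pM //; try lra.
by rewrite ler_wpM2r //; lra.
Qed.

Definition sinc x : R := if x == 0 then 1 else sin x / x.

Lemma sinc_le1 x : `|sinc x| <= 1.
Proof.
rewrite /sinc; case: eqP => [_|/eqP x0]; first by rewrite normr1.
by rewrite normrM normfV ler_pdivrMr ?normr_gt0 // mul1r sin_abs_le.
Qed.

Lemma sinc_le x : `|sinc x| * `|x| <= 1.
Proof.
rewrite /sinc; case: eqP => [->|/eqP x0]; first by rewrite normr0 mulr0.
by rewrite -normrM divfK // sin_max.
Qed.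

(** Partial products of Viete's formula for [sinc]. Unlike the limit they are finite sums of
    cosines, so exact interpolation identities hold at every finite stage. *)
Definition cosprod (r : nat) x : R := \prod_(i < r) cos (x / 2 ^+ i.+1).

Lemma cosprodS r x : cosprod r.+1 x = cos (x / 2) * cosprod r (x / 2).
Proof.
rewrite /cosprod big_ord_recl expr1; congr (_ * _); apply: eq_bigr => i _.
by rewrite lift0 (exprS _ i.+1) invfM mulrA.
Qed.

Lemma cosprod_le1 r x : `|cosprod r x| <= 1.
Proof.
elim: r x => [|r IH] x; first by rewrite /cosprod big_ord0 normr1.
by rewrite cosprodS normrM mulr_ile1 // cos_max.
Qed.

Lemma cosprod_sin r x : 2 ^+ r * sin (x / 2 ^+ r) * cosprod r x = sin x.
Proof.
elim: r x => [|r IH] x; first by rewrite expr0 mul1r divr1 /cosprod big_ord0 mulr1.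
rewrite cosprodS exprS (_ : x / (2 * 2 ^+ r) = x / 2 / 2 ^+ r); last by rewrite invfM mulrA.
rewrite (_ : _ * _ = 2 * cos (x / 2) * (2 ^+ r * sin (x / 2 / 2 ^+ r) * cosprod r (x / 2))); last ring.
rewrite IH; have {3}-> : x = (x / 2) *+ 2 by rewrite -mulr_natr; field.
by rewrite sin_mulr2n -mulr_natr; ring.
Qed.

(** Each further cosine splits every frequency in two; the outcome is a Dirichlet kernel, the
    uniform mean over the frequencies [2 m + 1 - 2 ^ r]. The lower half of the new index range takes
    the minus sign, the upper half the plus sign. *)
Lemma cosprod_sum r x : cosprod r x =
  2 ^- r * \sum_(m < 2 ^ r) cos ((2 * m%:R + 1 - 2 ^+ r) * (x / 2 ^+ r)).
Proof.
elim: r x => [|r IH] x.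
  by rewrite /cosprod big_ord0 expr0 invr1 mul1r big_ord_recl big_ord0 mulr0 add0r subrr mul0r cos0 addr0.
rewrite cosprodS IH expnS mul2n -addnn big_split_ord /= -big_split /=.
rewrite (_ : 2 ^- r.+1 = 2 ^- r * 2^-1); last by rewrite exprS invfM mulrC.
rewrite mulrCA -[RHS]mulrA; congr (_ * _); rewrite !mulr_sumr; apply: eq_bigr => m _; rewrite exprS.
have e0 : 2 ^+ r != 0 :> R by rewrite expf_neq0.
rewrite natrD natrX.
set a := 2 ^+ r in e0 *; set y := x / 2.
have -> : (2 * m%:R + 1 - 2 * a) * (x * (a^-1 / 2)) = (2 * m%:R + 1 - a) * (y / a) - y.
  by rewrite /y; field.
have -> : (2 * (a + m%:R) + 1 - 2 * a) * (x * (a^-1 / 2)) = (2 * m%:R + 1 - a) * (y / a) + y.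
  by rewrite /y; field.
by rewrite cosB cosD; field.
Qed.

(** In this range the factor [2 ^ r sin (x / 2 ^ r)] of [cosprod_sin] is at least [|x| / 4] in
    absolute value. No decay can hold for all [x], as the product is periodic up to sign. *)
Lemma cosprod_le r x : `|x / 2 ^+ r| <= 2 -> `|cosprod r x| * `|x| <= 4.
Proof.
move=> h; have := sin_abs_ge h => h2.
have p0 : 0 < 2 ^+ r :> R by rewrite exprn_gt0.
have := sin_max x; rewrite -(cosprod_sin r x) !normrM (gtr0_norm p0) => h3.
have h4 : `|x| / 4 <= 2 ^+ r * `|sin (x / 2 ^+ r)|.
  have : 2 ^+ r * (`|x / 2 ^+ r| / 4) <= 2 ^+ r * `|sin (x / 2 ^+ r)| by rewrite ler_pM2l.
  rewrite normrM normfV (gtr0_norm p0).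
  by rewrite (_ : 2 ^+ r * _ = `|x| / 4) //; field; rewrite gt_eqF.
have : `|x| / 4 * `|cosprod r x| <= 1 by apply: le_trans h3; rewrite ler_wpM2r.
lra.
Qed.

Lemma cvg_cosprod x : cosprod r x @[r --> \oo] --> sinc x.
Proof.
rewrite /sinc; case: eqP => [->|/eqP x0].
  rewrite (_ : (fun r => _) = fun=> 1); first exact: cvg_cst.
  by apply/funext => r; rewrite /cosprod big1 // => i _; rewrite mul0r cos0.
have d : (sin h / h) @[h --> 0^'] --> (1 : R).
  have := (@is_derive_sin R 0); rewrite cos0 => -[dv dE].
  have := dv; rewrite /derivable => /cvg_ex[l hl].
  have := cvg_lim _ hl => /(_ (@norm_hausdorff _ _)).
  rewrite -/('D_1 sin 0) dE => lE; rewrite -lE in hl.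
  apply: cvg_trans hl; apply: near_eq_cvg; near=> h.
  by rewrite /= sin0 subr0 addr0 /GRing.scale /= mulr1 mulrC.
have e : (x / 2 ^+ r) @[r --> \oo] --> (0 : R)^'.
  move=> S [e /= e0 hS].
  have : (fun r => x * (2^-1) ^+ r) @ \oo --> x * 0.
    by apply: cvgM; [exact: cvg_cst|apply: cvg_expr; rewrite ger0_norm; lra].
  rewrite mulr0 => /cvgrPdist_lt /(_ _ e0) h.
  apply: filterS h => r hr; apply: hS => /=; first by rewrite -exprVn.
  by rewrite mulf_neq0 // invr_neq0 // expf_neq0.
have h := cvg_comp _ _ e d.
have h' : (sin x / x / (sin (x / 2 ^+ r) / (x / 2 ^+ r))) @[r --> \oo] --> sin x / x / 1.
  apply: cvgM; first exact: cvg_cst.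
  by apply: cvgV; [exact: oner_neq0|exact: h].
rewrite divr1 in h'; apply: cvg_trans h'; apply: near_eq_cvg; near=> r.
have p0 : 2 ^+ r != 0 :> R by rewrite expf_neq0.
have s0 : sin (x / 2 ^+ r) != 0.
  have : 0 < `|sin (x / 2 ^+ r) / (x / 2 ^+ r)|.
    near: r; have /cvgrPdist_lt /(_ 1 ltr01) := h; apply: filterS => r /=.
    case: (eqVneq (sin (x / 2 ^+ r)) 0) => [->|s0 _]; first by rewrite mul0r subr0 normr1 ltxx.
    by rewrite normr_gt0 mulf_neq0 // invr_neq0 // mulf_neq0 // invr_neq0.
  by rewrite normr_gt0; apply: contra_neq => ->; rewrite mul0r.
rewrite -[in LHS](cosprod_sin r x); field.
by rewrite s0 p0 x0.
Unshelve. all: by end_near. Qed.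

End Kernel.

(** * The interpolation kernel *)

Section FiniteInterpolation.
Context {R : realType}.
Implicit Types (x t a : R).

Lemma sin_sub_2pi x (d : nat) : sin (x - 2 * pi * d%:R) = sin x.
Proof.
rewrite -(periodicn (@sinD2pi R) d (x - 2 * pi * d%:R)); congr sin.
by rewrite -[pi *+ 2]mulr_natl -[_ *+ d]mulr_natr; ring.
Qed.

(** Multiplied by [2 sin h], with [h = d pi / M], the sum telescopes over a full period; [0 < d < M]
    makes [sin h] positive. *)
Lemma cos_period_sum (M d : nat) a : (0 < d < M)%N ->
  \sum_(m < M) cos (a - 2 * d%:R * pi / M%:R * m%:R) = 0.
Proof.
move=> /andP[d0 dM]; have M0 : 0 < M%:R :> R by rewrite ltr0n (ltn_trans d0).
pose h : R := d%:R * pi / M%:R.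
have s0 : sin h != 0.
  rewrite gt_eqF // sin_gt0_pi // /h divr_gt0 // ?mulr_gt0 ?ltr0n ?pi_gt0 //=.
  by rewrite ltr_pdivrMr // mulrC ltr_pM2l ?pi_gt0 // ltr_nat.
pose S (m : nat) := sin (a + h - 2 * h * m%:R).
have : \sum_(0 <= m < M) (S m.+1 - S m) = 0.
  rewrite telescope_sumr; last by rewrite ltnW // (ltn_trans d0).
  rewrite /S mulr0 subr0.
  rewrite (_ : a + h - 2 * h * M%:R = a + h - 2 * pi * d%:R) ?sin_sub_2pi ?subrr //.
  by rewrite /h; field; rewrite gt_eqF.
rewrite big_mkord => h1; apply: (mulfI s0); apply: (mulfI (_ : 2 != 0 :> R)) => //; rewrite !mulr0.
transitivity (\sum_(m < M) - (S m.+1 - S m)); last by rewrite sumrN h1 oppr0.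
rewrite !mulr_sumr.
apply: eq_bigr => m _; rewrite /S (_ : m.+1%:R = m%:R + 1 :> R); last by rewrite natr1.
have -> : a + h - 2 * h * (m%:R + 1) = (a - 2 * h * m%:R) - h by ring.
have -> : a + h - 2 * h * m%:R = (a - 2 * h * m%:R) + h by ring.
have -> : 2 * d%:R * pi / M%:R = 2 * h by rewrite /h; field; rewrite gt_eqF.
set A := a - 2 * h * m%:R; by rewrite (sinB A h) (sinD A h); ring.
Qed.

(** Orthogonality of the characters of [Z / M], in real form and with a phase. *)
Lemma cos_full_sum (M : nat) (d e : nat) t a : (d < M)%N -> (e < M)%N ->
  \sum_(m < M) cos (2 * (d%:R - e%:R) * (pi / M%:R) * (t - m%:R) + a) =
  if d == e then M%:R * cos a else 0.
Proof.
move=> dM eM; case: eqP => [->|/eqP de].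
  rewrite (eq_bigr (fun=> cos a)) => [|m _]; last by congr cos; ring.
  by rewrite sumr_const card_ord mulr_natl.
have M0 : M%:R != 0 :> R by rewrite pnatr_eq0; lia.
wlog ed : d e a t dM eM de / (e < d)%N.
  move=> h; have [|dlt|/eqP] := ltngtP e d; [exact: h| |by rewrite eq_sym (negbTE de)].
  rewrite -[RHS](h e d (- a) t eM dM) 1?eq_sym //.
  by apply: eq_bigr => m _; rewrite -cosN; congr cos; ring.
rewrite -[RHS](@cos_period_sum M (d - e) (2 * (d%:R - e%:R) * (pi / M%:R) * t + a)); last lia.
by apply: eq_bigr => m _; congr cos; rewrite natrB ?(ltnW ed) //; field.
Qed.

(* A trigonometric kernel is interpolating when it reproduces, from its M
   samples, every exponential of frequency [pi * (2 tau + c - (M - 1)) / M]. *)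
Definition interpolating (M : nat) (k : R -> R) (c : nat) :=
  forall (tau : nat) t a, (tau + c < M)%N ->
    \sum_(m < M) k (t - m%:R) * cos ((t - m%:R) * (pi * (2 * tau%:R + c%:R - (M.-1)%:R) / M%:R) + a)
      = cos a.

(** Products of cosines become sums, and each summand turns into two orthogonality sums. Exactly one
    [p] survives in each, [M - 1 - tau] and [tau], and each contributes [cos a / 2]. *)
Lemma interpolating_cosprod r : interpolating (2 ^ r) (fun x => cosprod r (pi * x)) 0.
Proof.
move=> tau t a; rewrite addn0; set M := (2 ^ r)%N => tM.
have M0 : (0 < M)%N by rewrite expn_gt0.
have M0' : M%:R != 0 :> R by rewrite pnatr_eq0; lia.
have E (m : 'I_M) : cosprod r (pi * (t - m%:R)) *
    cos ((t - m%:R) * (pi * (2 * tau%:R + 0 - (M.-1)%:R) / M%:R) + a) =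
  \sum_(p < M) (2 * M%:R)^-1 * (cos (2 * (tau%:R - (M.-1 - p)%:R) * (pi / M%:R) * (t - m%:R) + a)
     + cos (2 * (tau%:R - p%:R) * (pi / M%:R) * (t - m%:R) + a)).
  rewrite cosprod_sum mulr_sumr mulr_suml; apply: eq_bigr => p _.
  rewrite -natrX -/M.
  have pM := ltn_ord p.
  have -> : (M.-1 - p)%:R = (M.-1)%:R - p%:R :> R by rewrite natrB //; lia.
  have hM : M%:R = (M.-1)%:R + 1 :> R by rewrite natr1 prednK.
  have -> : 2 * p%:R + 1 - M%:R = 2 * p%:R - (M.-1)%:R :> R by rewrite hM; ring.
  set A := (_ * (pi * _ / M%:R)); set B := (_ * (pi * (t - _) / _)).
  have -> : 2 * (tau%:R - ((M.-1)%:R - p%:R)) * (pi / M%:R) * (t - m%:R) + a = (A + a) + B.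
    by rewrite /A /B; field.
  have -> : 2 * (tau%:R - p%:R) * (pi / M%:R) * (t - m%:R) + a = (A + a) - B.
    by rewrite /A /B; field.
  by rewrite (cosD (A + a) B) (cosB (A + a) B); field.
rewrite (eq_bigr _ (fun m _ => E m)) exchange_big /=.
rewrite (eq_bigr (fun p : 'I_M => (2 * M%:R)^-1 *
   ((if tau == (M.-1 - p)%N then M%:R * cos a else 0) + (if tau == p :> nat then M%:R * cos a else 0)))); last first.
  move=> p _; rewrite -mulr_sumr big_split /= !cos_full_sum //; first by case: p => p /=; lia.
rewrite -mulr_sumr big_split /=.
have tM' : (M.-1 - tau < M)%N by lia.
rewrite (bigD1 (Ordinal tM')) //= big1; last first.
  by move=> p; rewrite -val_eqE /=; case: p => p /= ? ?; rewrite ifF //; lia.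
rewrite [X in _ + X](bigD1 (Ordinal tM)) //= eqxx big1; last first.
  by move=> p; rewrite -val_eqE /= eq_sym => /negbTE ->.
rewrite ifT; last lia.
by field.
Qed.

(** By the product formula, the frequency with parameters [tau, c + b] is reproduced as the mean of
    those with parameters [tau + b, c] and [tau, c]. An extra cosine factor thus costs [b]
    admissible frequencies. *)
Lemma interpolatingM M k c (b : nat) : interpolating M k c ->
  interpolating M (fun x => k x * cos (b%:R * pi / M%:R * x)) (c + b).
Proof.
move=> h tau t a tM.
have [h1 h2] : (tau + b + c < M)%N /\ (tau + c < M)%N by lia.
have M0' : M%:R != 0 :> R by rewrite pnatr_eq0; lia.
rewrite -[RHS](_ : 2^-1 * (cos a + cos a) = _); last by field.
rewrite -{1}(h _ t a h1) -(h _ t a h2) -big_split mulr_sumr /=; apply: eq_bigr => m _.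
set A := (t - m%:R) * _ + a; set B := b%:R * pi / M%:R * (t - m%:R).
have -> : (t - m%:R) * (pi * (2 * (tau + b)%:R + c%:R - (M.-1)%:R) / M%:R) + a = A + B.
  by rewrite /A /B !natrD; field.
have -> : (t - m%:R) * (pi * (2 * tau%:R + c%:R - (M.-1)%:R) / M%:R) + a = A - B.
  by rewrite /A /B !natrD; field.
by rewrite (cosD A B) (cosB A B); field.
Qed.

Lemma interpolating_prod M k c (b : seq nat) : interpolating M k c ->
  interpolating M (fun x => k x * \prod_(i <- b) cos (i%:R * pi / M%:R * x)) (c + sumn b).
Proof.
elim: b k c => [|i b IH] k c h.
  rewrite addn0 => tau t a tM; rewrite -[RHS](h tau t a tM).
  by apply: eq_bigr => m _; rewrite big_nil mulr1.
rewrite /= addnA => tau t a tM; rewrite -[RHS](IH _ _ (@interpolatingM _ _ _ i h) tau t a tM).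
by apply: eq_bigr => m _; rewrite big_cons !mulrA.
Qed.

Lemma sumn_nseq_pow s : sumn [seq (2 ^ (s - i.+1))%N | i <- iota 0 s] = (2 ^ s)%N.-1.
Proof.
elim: s => // s IH.
rewrite (_ : iota 0 s.+1 = 0 :: map (addn 1) (iota 0 s))%N; last by rewrite -iotaDl.
rewrite map_cons -map_comp (eq_map (g := fun i => (2 ^ (s - i.+1))%N)) => [|i] /=.
  by rewrite IH subSS subn0 expnS; have := expn_gt0 2 s; lia.
by rewrite add1n subSS.
Qed.

(** With [M = 2 ^ (L + 2 + s)], the slow product consists of the cosines of
    [2 ^ (s - i - 1) pi x / M], so each of its [L] copies costs [2 ^ s - 1] frequencies. The scale
    [2 ^ (L + 2)] keeps the total loss below [M / 4], because [L < 2 ^ L]. *)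
Definition approx_kernel (L s : nat) (x : R) :=
  cosprod (L.+2 + s) (pi * x) * cosprod s (pi * x / 2 ^+ L.+2) ^+ L.

Lemma interpolating_approx L s :
  interpolating (2 ^ (L.+2 + s)) (approx_kernel L s) (L * (2 ^ s)%N.-1).
Proof.
set M := (2 ^ _)%N.
have M0' : M%:R != 0 :> R by rewrite pnatr_eq0 expn_eq0.
pose b := flatten (nseq L [seq (2 ^ (s - i.+1))%N | i <- iota 0 s]).
have -> : (L * (2 ^ s).-1 = 0 + sumn b)%N.
  rewrite add0n /b; elim: L {M M0' b} => //= L IH.
  by rewrite sumn_cat sumn_nseq_pow mulSn IH.
move=> tau t a tM; rewrite -[RHS](interpolating_prod (@interpolating_cosprod _) t a tM).
apply: eq_bigr => m _; rewrite /approx_kernel; congr (_ * _ * _).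
set x := t - m%:R; rewrite /b big_flatten /= big_nseq /=.
have -> : \prod_(i <- [seq (2 ^ (s - i.+1))%N | i <- iota 0 s]) cos (i%:R * pi / M%:R * x) =
    cosprod s (pi * x / 2 ^+ L.+2).
  rewrite big_map -[X in iota _ X]subn0 -/(index_iota 0 s) big_mkord; apply: eq_bigr => i _.
  congr cos; rewrite /M natrX natrX.
  have e : (L.+2 + s = L.+2 + (s - i.+1 + i.+1))%N by case: i => i /=; lia.
  rewrite e exprD exprD; field.
  by rewrite !expf_neq0.
by rewrite -Monoid.iteropE /=.
Qed.

End FiniteInterpolation.

(** * The limiting kernel and the sampling of exponentials *)

Section SamplingKernel.
Context {R : realType}.
Implicit Types (x t a xi : R).

Lemma sums_seq (I : choiceType) (u : I -> R) (s : seq I) : uniq s ->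
  (forall i, i \notin s -> u i = 0) -> sums u (\sum_(i <- s) u i).
Proof.
move=> us h.
rewrite (_ : \sum_(i <- s) u i = \sum_(i <- [fset i in s]%fset) u i).
  by apply: sums_finite => i; rewrite inE; exact: h.
apply: perm_big; apply: uniq_perm => //.
by move=> i; rewrite !inE.
Qed.

Lemma near_le_exp2 (A : R) : \forall s \near \oo, A <= (2 ^ s)%:R.
Proof.
near=> s; have h : A < s%:R by near: s; exact: nbhs_infty_gtr.
by rewrite (le_trans (ltW h)) // ler_nat ltnW // ltn_expl.
Unshelve. all: by end_near. Qed.

(* The factor [sinc (pi x)] is the usual sampling kernel; its product with a power of
   a slower sinc decays like [x ^ (- L - 1)] and it still reproduces the frequencies of size at most 1. *)
Definition skernel (L : nat) (x : R) := sinc (pi * x) * sinc (pi * x / 2 ^+ L.+2) ^+ L.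

Lemma cvg_approx_kernel L x : approx_kernel L s x @[s --> \oo] --> skernel L x.
Proof.
apply: cvgM.
  have := @cvg_cosprod R (pi * x).
  by rewrite -(cvg_shiftn L.+2); under eq_fun do rewrite addnC.
have h := @cvg_cosprod R (pi * x / 2 ^+ L.+2).
exact: (cvg_comp _ _ h (@exprn_continuous R L _)).
Qed.

Lemma le_inv1D (y x K : R) : y <= 1 -> y * `|x| <= K -> y <= (1 + K) / (1 + `|x|).
Proof.
move=> y1 yK; rewrite ler_pdivlMr ?ltr_pwDl //.
by rewrite mulrDr mulr1 lerD.
Qed.

Lemma ler_abs_pi x : `|x| <= `|pi * x|.
Proof.
rewrite normrM ler_peMl // ger0_norm ?pi_ge0 //.
by have := @pi_ge2 R; lra.
Qed.

(** The factor 2 is independent of [L]: the first sinc alone provides the decay and the others are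
    at most 1. This uniformity is what makes the final constant absolute. *)
Lemma kernel_sinc L x : `|skernel L x| <= 2 / (1 + `|x|).
Proof.
rewrite normrM normrX.
apply: (@le_trans _ _ (`|sinc (pi * x)|)).
  by rewrite ler_piMr // exprn_ile1 // sinc_le1.
rewrite (_ : 2 = 1 + 1) //; apply: le_inv1D; first exact: sinc_le1.
by apply: le_trans (sinc_le (pi * x)); rewrite ler_wpM2l // ler_abs_pi.
Qed.

Lemma kernel_decay L : exists2 C, 0 <= C & forall x, `|skernel L x| <= C / (1 + `|x|) ^+ L.+1.
Proof.
have p0 : 0 < 2 ^+ L.+2 :> R by rewrite exprn_gt0.
exists (2 * (1 + 2 ^+ L.+2) ^+ L); rewrite /skernel; move: (2 ^+ L.+2) p0 => q p0.
  by rewrite mulr_ge0 ?exprn_ge0 ?addr_ge0 // ltW.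
move=> x; rewrite normrM normrX (exprS (1 + `|x|)) invfM mulrACA.
apply: ler_pM => //.
  rewrite (_ : 2 = 1 + 1) //; apply: le_inv1D; first exact: sinc_le1.
  by apply: le_trans (sinc_le (pi * x)); rewrite ler_wpM2l // ler_abs_pi.
rewrite -expr_div_n; apply: lerXn2r; rewrite ?nnegrE //.
  by rewrite divr_ge0 ?addr_ge0 // ltW.
apply: le_inv1D; first exact: sinc_le1.
have := sinc_le (pi * x / q); rewrite (normrM (pi * x)) normfV (gtr0_norm p0).
rewrite mulrA ler_pdivrMr // mul1r; apply: le_trans.
by rewrite ler_wpM2l // ler_abs_pi.
Qed.

(** A square summable rate twice over, uniform in [s], as the majorant for Tannery's theorem: one
    power of decay comes from the fast product and one from a slow factor, whence [0 < L]. *)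
Lemma approx_kernel_decay L s x : (0 < L)%N -> `|pi * x / 2 ^+ (L.+2 + s)| <= 2 ->
  `|approx_kernel L s x| <= 5 * (1 + 4 * 2 ^+ L.+2) * (1 + `|x|) ^- 2.
Proof.
move=> L0 h0; have := h0; rewrite exprD /approx_kernel; have : 0 < 2 ^+ L.+2 :> R by rewrite exprn_gt0.
move: (2 ^+ L.+2) => q p0 h; rewrite normrM normrX (expr2 (1 + _)) invfM mulrACA.
apply: ler_pM => //.
  rewrite (_ : 5 = 1 + 4); last by ring.
  apply: le_inv1D; first exact: cosprod_le1.
  by apply: le_trans (cosprod_le h0); rewrite ler_wpM2l // ler_abs_pi.
apply: (@le_trans _ _ `|cosprod s (pi * x / q)|).
  by case: (L) L0 => // L' _; rewrite exprS ler_piMr // exprn_ile1 // cosprod_le1.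
apply: le_inv1D; first exact: cosprod_le1.
have h' : `|pi * x / q / 2 ^+ s| <= 2 by rewrite -mulrA -invfM.
have := cosprod_le h'; rewrite (normrM (pi * x)) normfV (gtr0_norm p0).
rewrite mulrA ler_pdivrMr //; apply: le_trans.
by rewrite ler_wpM2l // ler_abs_pi.
Qed.

Lemma kernel_abs_bounded L t : (0 < L)%N ->
  exists M, abs_bounded (fun j : int => skernel L (t - j%:~R)) M.
Proof.
move=> L0; have [C C0 hC] := kernel_decay L.
exists (`|C| * 5); apply: abs_bounded_le (abs_boundedZ C (decay_abs_bounded t)) => j.
apply: le_trans (hC _) _; rewrite normrM (ger0_norm C0) ler_wpM2l // normfV lef_pV2.
- by rewrite ger0_norm ?exprn_ge0 ?addr_ge0 // ler_weXn2l // lerDl.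
- by rewrite posrE exprn_gt0 // ltr_pwDl.
- by rewrite posrE normr_gt0 expf_neq0 // gt_eqF // ltr_pwDl.
Qed.

(** Limit of the finite identities with [M] samples. Those hold only for frequencies on a grid of
    mesh [2 pi / M], so [xi] is replaced by a grid frequency [f s] at distance at most [2 pi / M]
    before [s] tends to infinity. *)
Lemma sampling_cos L t xi a : (0 < L)%N -> `|xi| <= 1 ->
  sums (fun j : int => skernel L (t - j%:~R) * cos ((t - j%:~R) * xi + a)) (cos a).
Proof.
move=> L0 xi1.
have pi2 := @pi_ge2 R; have pi0 := @pi_gt0 R.
have [B hB] := kernel_abs_bounded t L0.
have [|l0 hl0] := @sums_exist R _ (fun j : int => skernel L (t - j%:~R) * cos ((t - j%:~R) * xi + a)) B.
  by apply: abs_bounded_le hB => j; rewrite normrM ler_piMr // cos_max.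
suff -> : cos a = l0 by [].
pose r s := (L.+1 + s)%N; pose N s : nat := (2 ^ r s)%N.
pose M s := (N s + N s)%N.
have ME s : M s = (2 ^ (L.+2 + s))%N by rewrite /M /N /r addnn -mul2n -expnS.
have N0 s : (0 < N s)%N by rewrite expn_gt0.
pose c s := (L * (2 ^ s)%N.-1)%N.
have cN s : ((c s).*2 + 2 <= N s)%N.
  rewrite /c /N /r addSn expnS expnD.
  have := ltn_expl L (ltnSn 1); have := expn_gt0 2 s; move: (2 ^ s)%N (2 ^ L)%N => p q.
  case: p => // p _ Lq; rewrite /= -addnn.
  have : (L * p.+1 <= q * p.+1)%N by rewrite leq_mul // ltnW.
  by nia.
(* The real solution [tau] of [f s = xi]. Its integer part is admissible since
   [|xi| M / pi <= M / 2] while the loss [c s] is at most [M / 4 - 1]. *)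
pose y s : R := (xi * (M s)%:R / pi + (M s).-1%:R - (c s)%:R) / 2.
have M0 s : 0 < (M s)%:R :> R by rewrite ltr0n ME expn_gt0.
have bnd s : - (M s)%:R / 2 <= xi * (M s)%:R / pi <= (M s)%:R / 2.
  move: xi1; rewrite ler_norml => /andP[x1 x2].
  rewrite ler_pdivlMr // ler_pdivrMr //.
  by have := M0 s; move: (M s)%:R => m m0; apply/andP; split; nra.
have pr s : (M s).-1%:R = (M s)%:R - 1 :> R.
  have /prednK {2}<- : (0 < M s)%N by rewrite ME expn_gt0.
  by rewrite -natr1 addrK.
have cM s : 4 * (c s)%:R + 4 <= (M s)%:R :> R.
  have : (4 * c s + 4 <= M s)%N by have := cN s; rewrite /M; lia.
  by rewrite -(ler_nat R) natrD natrM.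
have y0 s : 0 <= y s.
  by rewrite divr_ge0 // pr; have /andP[] := bnd s; have := cM s; have := ler0n R (c s); lra.
pose tau s := Num.truncn (y s).
have tauE s : (tau s)%:R <= y s < (tau s)%:R + 1 by rewrite natr1; exact: truncn_itv.
have tauM s : (tau s + c s < M s)%N.
  rewrite -(ltr_nat R) natrD; have /andP[h _] := tauE s.
  apply: (le_lt_trans (lerD h (lexx _))); rewrite /y pr.
  by have /andP[] := bnd s; have := cM s; have := ler0n R (c s); lra.
pose f s : R := pi * (2 * (tau s)%:R + (c s)%:R - (M s).-1%:R) / (M s)%:R.
have fxi s : `|xi - f s| <= 2 * pi / (M s)%:R.
  rewrite ler_pdivlMr // -[X in _ * X](gtr0_norm (M0 s)) -normrM.
  have -> : (xi - f s) * (M s)%:R = 2 * pi * (y s - (tau s)%:R).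
    have E (p z T A P m : R) : 0 < p -> 0 < m ->
        (z - p * (2 * T + A - P) / m) * m = 2 * p * ((z * m / p + P - A) / 2 - T).
      by move=> p0 m0; field; rewrite (gt_eqF m0) (gt_eqF p0).
    exact: E.
  rewrite normrM gtr0_norm ?mulr_gt0 // ler_piMr ?mulr_ge0 ?ltW //.
  by have /andP[h1 h2] := tauE s; rewrite ltr_norml; lra.
have cvgf : f s @[s --> \oo] --> xi.
  apply/cvgrPdist_le => e e0; near=> s.
  apply: (le_trans (fxi s)); rewrite ler_pdivrMr // -ler_pdivrMl //.
  apply: (@le_trans _ _ (2 ^ s)%:R); first by near: s; exact: near_le_exp2.
  by rewrite ler_nat ME leq_exp2l // leq_addl.
(* The [M] consecutive samples are recentred around 0, so that the window exhausts the integers. *)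
pose u s (j : int) : R := if (- Posz (N s) <= j < Posz (N s))
  then approx_kernel L s (t - j%:~R) * cos ((t - j%:~R) * f s + a) else 0.
have us s : sums (u s) (cos a).
  pose q := [seq Posz m - Posz (N s) | m <- iota 0 (M s)].
  have := @interpolating_approx R L s (tau s) (t + (N s)%:R) a.
  rewrite -ME -/(c s) => /(_ (tauM s)) <-.
  rewrite (_ : \sum_(m < M s) _ = \sum_(j <- q) u s j).
    apply: sums_seq.
      by rewrite map_inj_uniq ?iota_uniq // => m1 m2; lia.
    move=> j; apply: contraNeq; rewrite /u; case: ifP => [h _|]; last by rewrite eqxx.
    apply/mapP; exists (absz (j + Posz (N s))); last by lia.
    by rewrite mem_iota /M; lia.
  rewrite big_map -[X in iota _ X]subn0 -/(index_iota 0 (M s)) big_mkord.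
  apply: eq_bigr => m _; rewrite /u ifT; last by case: m => m /=; rewrite /M; lia.
  have -> : t + (N s)%:R - m%:R = t - (Posz m - Posz (N s))%:~R.
    by rewrite intrB /=; ring.
  by [].
pose C : R := 5 * (1 + 4 * 2 ^+ L.+2).
have C0 : 0 <= C by rewrite mulr_ge0 // addr_ge0 // mulr_ge0 // exprn_ge0.
suff h : (fun _ : nat => cos a) @ \oo --> l0.
  by rewrite -(cvg_lim _ h) //; exact/esym/lim_cst.
apply: (@tannery R int nat \oo _ u _ (fun j => C * (1 + `|t - j%:~R|) ^- 2) _ l0 (`|C| * 5)).
- move=> j; apply: cvg_trans (_ : (approx_kernel L s (t - j%:~R) * cos ((t - j%:~R) * f s + a)) @[s --> \oo] --> _).
    apply: near_eq_cvg; near=> s; rewrite /u ifT //.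
    have : (absz j < N s)%N.
      near: s; near=> s; apply: (@leq_trans (2 ^ s)%N).
        by rewrite -(ler_nat R); near: s; exact: near_le_exp2.
      by rewrite leq_exp2l // leq_addl.
    by lia.
  apply: cvgM; first exact: cvg_approx_kernel.
  have h1 : (fun s => (t - j%:~R) * f s + a) @ \oo --> (t - j%:~R) * xi + a.
    by apply: cvgD; [apply: cvgM; [exact: cvg_cst|exact: cvgf]|exact: cvg_cst].
  exact: (cvg_comp _ _ h1 (@continuous_cos R _)).
- near=> s => j; rewrite /u; case: ifP => [jN|_]; last first.
    by rewrite normr0 mulr_ge0 // invr_ge0 exprn_ge0 // addr_ge0.
  rewrite normrM; apply: (@le_trans _ _ `|approx_kernel L s (t - j%:~R)|).
    by rewrite ler_piMr // cos_max.
  apply: approx_kernel_decay => //.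
  rewrite -natrX -ME normrM normfV (gtr0_norm (M0 s)) ler_pdivrMr // normrM gtr0_norm //.
  have jn : `|j%:~R| <= (N s)%:R :> R.
    rewrite -intr_norm -[(N s)%:R]/((Posz (N s))%:~R) ler_int; lia.
  have h1 : `|t - j%:~R| <= `|t| + (N s)%:R by apply: (le_trans (ler_normB _ _)); rewrite lerD2l.
  (* The window must stay in the decay range [pi |t - j| <= 2 M]; as [|j| <= M / 2], this is
     possible for large [s] because [pi < 4]. *)
  have h2 : pi * `|t| <= (2 - pi / 2) * (M s)%:R.
    rewrite -ler_pdivrMl; last by have := @pihalf_lt2 R; lra.
    apply: (@le_trans _ _ (2 ^ s)%:R); first by near: s; exact: near_le_exp2.
    by rewrite ler_nat ME leq_exp2l // leq_addl.
  have : pi * `|t - j%:~R| <= pi * (`|t| + (N s)%:R) by rewrite ler_pM2l.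
  have -> : (M s)%:R = (N s)%:R + (N s)%:R :> R by rewrite /M natrD.
  by move: h2; rewrite /M natrD; lra.
- have /(abs_boundedZ C) := @decay_abs_bounded R t; apply: abs_bounded_le => j.
  by rewrite lexx.
- by near=> s.
- exact: hl0.
Unshelve. all: by end_near. Qed.

Lemma sampling_sin L t xi a : (0 < L)%N -> `|xi| <= 1 ->
  sums (fun j : int => skernel L (t - j%:~R) * sin ((t - j%:~R) * xi + a)) (sin a).
Proof.
move=> L0 xi1; have := sampling_cos t (a - pi / 2) L0 xi1.
rewrite cosBpihalf; apply: eq_sums => j.
by rewrite addrA cosBpihalf.
Qed.

End SamplingKernel.

(** * Sampling of divided differences of exponentials *)

Section DividedDifferenceSampling.
Context {R : realType}.
Implicit Types (x t c a xi : R).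

(** Subdividing into [n + 1] equal steps bounds [|H l - H u|] by [C (u - l) ^ 2 / (n + 1)]. It lets
    second-order Taylor estimates stand in for a vanishing derivative. *)
Lemma quadratic_const (H : R -> R) (C l u : R) : l <= u ->
  (forall x y, l <= x <= u -> l <= y <= u -> `|H x - H y| <= C * (x - y) ^+ 2) -> H l = H u.
Proof.
move=> lu h; apply/eqP; rewrite -subr_eq0 -normr_le0; apply/ler_addgt0Pl => e e0; rewrite addr0.
have bnd (n : nat) : `|H l - H u| <= C * (u - l) ^+ 2 / n.+1%:R.
  pose p (i : nat) := l + (u - l) / n.+1%:R * i%:R.
  have n0 : 0 < n.+1%:R :> R by [].
  have pin i : (i <= n.+1)%N -> l <= p i <= u.
    move=> ni; have h0 : 0 <= (u - l) / n.+1%:R by rewrite divr_ge0 ?subr_ge0.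
    rewrite /p lerDl mulr_ge0 //= -lerBrDl mulrAC ler_pdivrMr //.
    by rewrite ler_wpM2l ?subr_ge0 // ler_nat.
  have -> : H l - H u = \sum_(i < n.+1) (H (p i) - H (p i.+1)).
    have -> : \sum_(i < n.+1) (H (p i) - H (p i.+1)) = - \sum_(0 <= i < n.+1) (H (p i.+1) - H (p i)).
      by rewrite big_mkord -sumrN; apply: eq_bigr => i _; rewrite opprB.
    rewrite telescope_sumr // opprB /p mulr0 addr0; congr (_ - H _).
    by rewrite divfK ?gt_eqF // addrC subrK.
  apply: le_trans (ler_norm_sum _ _ _) _.
  apply: (@le_trans _ _ (\sum_(i < n.+1) C * ((u - l) / n.+1%:R) ^+ 2)).
    apply: ler_sum => i _; have := h _ _ (pin _ (ltnW (ltn_ord i))) (pin _ (ltn_ord i)).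
    rewrite /p; have -> : i.+1%:R = i%:R + 1 :> R by rewrite natr1.
    move: ((u - l) / n.+1%:R) => d; have -> : l + d * i%:R - (l + d * (i%:R + 1)) = - d by ring.
    by rewrite sqrrN.
  rewrite sumr_const card_ord -mulr_natr le_eqVlt; apply/orP; left; apply/eqP.
  by field; rewrite gt_eqF.
pose n := Num.truncn (e^-1 * (C * (u - l) ^+ 2)).
apply: le_trans (bnd n) _; rewrite ler_pdivrMr // -ler_pdivrMl //.
by rewrite ltW // truncnS_gt.
Qed.

Lemma cos_lip x y : `|cos x - cos y| <= `|x - y|.
Proof.
have E (A B : R) : `|cos (A + B) - cos (A - B)| <= `|A + B - (A - B)|.
  rewrite (cosD A B) (cosB A B).
  have -> : cos A * cos B - sin A * sin B - (cos A * cos B + sin A * sin B) = - (2 * (sin A * sin B)) by ring.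
  have -> : A + B - (A - B) = 2 * B by ring.
  rewrite normrN !normrM ler_pM2l ?normr_gt0 //.
  by apply: le_trans (sin_abs_le B); rewrite ler_piMl // sin_max.
have := E ((x + y) / 2) ((x - y) / 2).
have -> : (x + y) / 2 + (x - y) / 2 = x by field.
by have -> : (x + y) / 2 - (x - y) / 2 = y by field.
Qed.

Lemma abs_sub_sin x : `|x - sin x| <= 2 * x ^+ 2.
Proof.
wlog x0 : x / 0 < x.
  move=> h; have [x0|x0|->] := ltgtP x 0; [|exact: h|by rewrite sin0 subrr normr0 expr0n mulr0].
  by have := h (- x); rewrite sinN -opprD normrN sqrrN oppr_gt0; apply.
have [x1|x1] := leP 1 x.
  apply: le_trans (ler_normB _ _) _; have h := sin_abs_le x; rewrite (gtr0_norm x0) in h *.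
  have : x <= x ^+ 2 by rewrite expr2 ler_peMl // ltW.
  lra.
have [|c] := @MVT R sin cos 0 x x0 (fun y _ => is_derive_sin y).
  by apply: continuous_subspaceT => y; exact: continuous_sin.
rewrite in_itv /= => /andP[c0 c1]; rewrite sin0 !subr0 => ->.
rewrite -{1}[x]mul1r -mulrBl normrM (gtr0_norm x0) ger0_norm ?subr_ge0 ?cos_le1 //.
have := cos_ge_quad c => h.
have : c ^+ 2 <= x * 1 by rewrite expr2 ler_pM //; lra.
have -> : 2 * x ^+ 2 = 2 * x * x by ring.
by move=> h2; rewrite ler_pM2r //; lra.
Qed.

Lemma cos_taylor x h : `|cos (x + h) - cos x + h * sin x| <= 3 * h ^+ 2.
Proof.
rewrite cosD.
have -> : cos x * cos h - sin x * sin h - cos x + h * sin x = cos x * (cos h - 1) + sin x * (h - sin h) by ring.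
apply: le_trans (ler_normD _ _) _; rewrite !normrM.
have h1 : `|cos x| * `|cos h - 1| <= h ^+ 2 / 2.
  apply: (@le_trans _ _ `|cos h - 1|); first by rewrite ler_piMl // cos_max.
  by rewrite distrC ger0_norm ?subr_ge0 ?cos_le1 //; have := cos_ge_quad h; lra.
have h2 : `|sin x| * `|h - sin h| <= 2 * h ^+ 2.
  by apply: le_trans (abs_sub_sin h); rewrite ler_piMl // sin_max.
have := sqr_ge0 h; lra.
Qed.

(** Since [1 + |j - c| <= (1 + |t - c|) (1 + |t - j|)], each weight costs one power of decay;
    [m < L] leaves at least two of the [L + 1] powers. *)
Lemma kernel_moment L (m : nat) t c : (m < L)%N ->
  exists M, abs_bounded (fun j : int => skernel L (t - j%:~R) * (1 + `|j%:~R - c|) ^+ m) M.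
Proof.
move=> mL; have [C C0 hC] := @kernel_decay R L.
pose K := C * (1 + `|t - c|) ^+ m.
exists (`|K| * 5); apply: abs_bounded_le (abs_boundedZ K (decay_abs_bounded t)) => j.
have p1 (y : R) : 0 < 1 + `|y| by rewrite ltr_pwDl.
have q1 (y : R) : 1 <= 1 + `|y| by rewrite lerDl.
rewrite normrM [leRHS]normrM (ger0_norm (_ : 0 <= K)); last by rewrite mulr_ge0 ?exprn_ge0 ?addr_ge0.
rewrite [leRHS]mulrC normrX (gtr0_norm (p1 _)) normfV normrX (gtr0_norm (p1 _)).
set x := t - j%:~R; have := hC x.
have h : (1 + `|j%:~R - c|) ^+ m <= ((1 + `|t - c|) * (1 + `|x|)) ^+ m.
  have hle : 1 + `|j%:~R - c| <= (1 + `|t - c|) * (1 + `|x|).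
    have -> : j%:~R - c = (t - c) - x by rewrite /x; ring.
    have := ler_normB (t - c) x; have := normr_ge0 (t - c); have := normr_ge0 x.
    by move: `|t - c - x| `|t - c| `|x| => u v w; nra.
  by apply: lerXn2r hle; rewrite nnegrE ?mulr_ge0 // addr_ge0.
move=> h1; apply: (le_trans (ler_pM (normr_ge0 _) _ h1 h)); first by rewrite exprn_ge0 // addr_ge0.
have -> : (L.+1 = m + (L - m.+1) + 2)%N by lia.
rewrite exprMn !exprD /K.
have P0 : 0 < (1 + `|x|) ^+ m by rewrite exprn_gt0.
have Q0 : 1 <= (1 + `|x|) ^+ (L - m.+1) by rewrite exprn_ege1.
have X0 : 0 < 1 + `|x| by [].
have T0 : 0 <= (1 + `|t - c|) ^+ m by rewrite exprn_ge0 // addr_ge0.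
have E (P Q X T D : R) : 0 < P -> 1 <= Q -> 0 < X -> 0 <= T -> 0 <= D ->
    D / (P * Q * X ^+ 2) * (T * P) <= X ^- 2 * (D * T).
  move=> p0 q0 x0 t0 d0; have Q1 : 0 < Q by apply: lt_le_trans q0.
  have -> : D / (P * Q * X ^+ 2) * (T * P) = X ^- 2 * (D * T) * Q^-1.
    by field; rewrite (gt_eqF p0) (gt_eqF x0) (gt_eqF Q1).
  by rewrite ler_piMr ?invf_le1 // !mulr_ge0 // invr_ge0 exprn_ge0 // ltW.
exact: E.
Qed.

(** The argument runs in the frequency: the quotient [q v z] vanishes at [z = 0] and its derivative
    in [z] is [- sin (v z + b)], for which sampling is known. The sampling error [H] therefore
    varies at most quadratically in [z], so it is constant, equal to 0. *)
Lemma sampling_divdiff L t c xi a : (1 < L)%N -> `|xi| <= 1 -> t != c ->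
  (forall j : int, j%:~R != c) ->
  sums (fun j : int => skernel L (t - j%:~R) * ((cos (j%:~R * xi + a) - cos (c * xi + a)) / (j%:~R - c)))
    ((cos (t * xi + a) - cos (c * xi + a)) / (t - c)).
Proof.
move=> L1 xi1 tc jc.
have L0 : (0 < L)%N by exact: ltnW.
pose b := c * xi + a.
pose q (v z : R) := (cos (v * z + b) - cos b) / v.
suff: sums (fun j : int => skernel L (t - j%:~R) * q (j%:~R - c) xi) (q (t - c) xi).
  rewrite /q /b; have -> : (t - c) * xi + (c * xi + a) = t * xi + a by ring.
  apply: eq_sums => j; have -> : (j%:~R - c) * xi + (c * xi + a) = j%:~R * xi + a by ring.
  by [].
have qle v z : `|z| <= 1 -> v != 0 -> `|q v z| <= 1.
  move=> z1 v0; rewrite /q normrM normfV ler_pdivrMr ?normr_gt0 // mul1r.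
  apply: le_trans (cos_lip _ _) _.
  by rewrite addrK normrM ler_piMr.
have vj (j : int) : j%:~R - c != 0 by rewrite subr_eq0.
have vt : t - c != 0 by rewrite subr_eq0.
have [B hB] := kernel_abs_bounded t L0.
(* The implication makes the sum a total function of [z]; its value for [|z| > 1] is arbitrary. *)
have ex z : exists l, `|z| <= 1 -> sums (fun j : int => skernel L (t - j%:~R) * q (j%:~R - c) z) l.
  have [z1|_] := leP `|z| 1; last by exists 0.
  have [|l hl] := @sums_exist R _ (fun j : int => skernel L (t - j%:~R) * q (j%:~R - c) z) B.
    by apply: abs_bounded_le hB => j; rewrite normrM ler_piMr // qle.
  by exists l.
have /(@choice R R) [S hS] := ex.
have [M hM] := kernel_moment t c (L1 : (1 < L)%N).
pose H z := S z - q (t - c) z.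
have HC z w : `|z| <= 1 -> `|w| <= 1 -> `|H z - H w| <= 3 * (M + `|t - c|) * (z - w) ^+ 2.
  move=> z1 w1.
  (* The Taylor remainder of [q v] in the frequency. Its bound grows like [|v|], which takes one
     moment of the kernel and explains [1 < L]. *)
  pose r v := q v z - q v w + (z - w) * sin (v * w + b).
  have rle v : v != 0 -> `|r v| <= 3 * `|v| * (z - w) ^+ 2.
    move=> v0; have -> : r v = (cos ((v * w + b) + v * (z - w)) - cos (v * w + b) + (v * (z - w)) * sin (v * w + b)) / v.
      rewrite /r /q (_ : v * w + b + v * (z - w) = v * z + b); last by ring.
      by field.
    rewrite normrM normfV ler_pdivrMr ?normr_gt0 //.
    apply: le_trans (cos_taylor _ _) _.
    rewrite exprMn -[v ^+ 2]real_normK ?num_real // le_eqVlt; apply/orP; left; apply/eqP; ring.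
  have hsin : sums (fun j : int => skernel L (t - j%:~R) * sin ((j%:~R - c) * w + b)) (sin ((t - c) * w + b)).
    have := @sampling_sin R L t (- w) ((t - c) * w + b) L0; rewrite normrN => /(_ w1).
    by apply: eq_sums => j; congr (_ * sin _); ring.
  have := sumsD (sumsB (hS z z1) (hS w w1)) (sumsZ (z - w) hsin).
  have e1 (j : int) : skernel L (t - j%:~R) * q (j%:~R - c) z - skernel L (t - j%:~R) * q (j%:~R - c) w
     + (z - w) * (skernel L (t - j%:~R) * sin ((j%:~R - c) * w + b)) = skernel L (t - j%:~R) * r (j%:~R - c).
    by rewrite /r; ring.
  move/(eq_sums e1) => h.
  have -> : H z - H w = (S z - S w + (z - w) * sin ((t - c) * w + b)) - r (t - c).
    by rewrite /H /r; ring.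
  apply: le_trans (ler_normB _ _) _.
  have h2 := rle _ vt.
  have : abs_bounded (fun j : int => skernel L (t - j%:~R) * r (j%:~R - c)) (3 * (z - w) ^+ 2 * M).
    have p3 : 0 <= 3 * (z - w) ^+ 2 by rewrite mulr_ge0 // sqr_ge0.
    have := abs_boundedZ (3 * (z - w) ^+ 2) hM; rewrite (ger0_norm p3).
    apply: abs_bounded_le => j; rewrite normrM; apply: (le_trans (ler_wpM2l _ (rle _ (vj j)))) => //.
    have q0 : 0 <= 1 + `|j%:~R - c| by rewrite addr_ge0.
    rewrite expr1 [leRHS]normrM (ger0_norm p3) (normrM _ (1 + _)) (ger0_norm q0).
    have := normr_ge0 (skernel L (t - j%:~R)); have := sqr_ge0 (z - w).
    move: (_ ^+ 2) `|skernel _ _| `|_ - c| => s K v s0 K0.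
    rewrite -subr_ge0 (_ : _ - _ = 3 * s * K); last by ring.
    by rewrite !mulr_ge0.
  move/sums_abs_le => /(_ _ h); lra.
have S0 : S 0 = 0.
  have := hS 0; rewrite normr0 ler01 => /(_ isT) h.
  apply: (sums_unique h); apply: eq_sums (sums0 _) => j.
  by rewrite /q mulr0 add0r subrr mul0r mulr0.
have H0 : H 0 = 0 by rewrite /H S0 /q sub0r mulr0 add0r subrr mul0r oppr0.
have Hxi : H xi = 0.
  rewrite -H0; move: xi1; rewrite ler_norml => /andP[x1 x2].
  have [x0|x0] := leP 0 xi.
    apply/esym; apply: (quadratic_const x0) => z w /andP[? ?] /andP[? ?].
    by apply: HC; rewrite ler_norml; lra.
  apply: (quadratic_const (ltW x0)) => z w /andP[? ?] /andP[? ?].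
  by apply: HC; rewrite ler_norml; lra.
have <- : S xi = q (t - c) xi by apply/eqP; rewrite -subr_eq0; exact/eqP.
exact: hS.
Qed.

End DividedDifferenceSampling.

(** * Band-limited functions on the line *)

Section PoissonKernel.
Context {R : realType}.
Let mu := @lebesgue_measure R.
Implicit Types (u : R -> R) (e v p xi : R).

Lemma integrable_prod (f g : R -> R) :
  mu.-integrable setT (EFin \o f) -> mu.-integrable setT (EFin \o g) ->
  (mu \x mu)%E.-integrable setT (EFin \o (fun z : R * R => f z.1 * g z.2)).
Proof.
move=> fi gi.
have mf : measurable_fun setT f by apply/measurable_EFinP; exact: measurable_int fi.
have mg : measurable_fun setT g by apply/measurable_EFinP; exact: measurable_int gi.
apply/integrable12ltyP.
  by apply/measurable_EFinP; apply: measurable_funM; apply: measurableT_comp.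
rewrite /=.
have e x : (\int[mu]_y `|(f x * g y)%:E|)%E = (`|(f x)%:E| * \int[mu]_y `|(g y)%:E|)%E.
  under eq_integral do rewrite EFinM abseM.
  rewrite ge0_integralZl //.
  by apply: measurableT_comp => //; apply/measurable_EFinP.
under eq_integral do rewrite e.
rewrite ge0_integralZr //; last 2 first.
- by apply: measurableT_comp => //; apply/measurable_EFinP.
- by apply: integral_ge0.
case/integrableP : fi => _; case/integrableP : gi => _ /=.
set a := (\int[mu]_x _)%E; set b := (\int[mu]_x _)%E => a0 b0.
have : (0 <= a)%E by apply: integral_ge0.
have : (0 <= b)%E by apply: integral_ge0.
by move=> h1 h2; rewrite lte_mul_pinfty // ge0_fin_numE.
Qed.

Lemma le_integrableR d (T : measurableType d) (nu : {measure set T -> \bar R}) (f g : T -> R) :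
  measurable_fun setT f -> (forall x, `|f x| <= g x) -> nu.-integrable setT (EFin \o g) ->
  nu.-integrable setT (EFin \o f).
Proof.
move=> mf fg; apply: le_integrable => //; first exact/measurable_EFinP.
by move=> x _ /=; rewrite lee_fin (le_trans (fg x)) // ler_norm.
Qed.

Section RealIntegrable.
Context d (T : measurableType d) (nu : {measure set T -> \bar R}).
Implicit Types f g : T -> R.

Lemma integrableRZ f (a : R) : nu.-integrable setT (EFin \o f) ->
  nu.-integrable setT (EFin \o (fun x => a * f x)).
Proof. by move=> h; have := integrableZl measurableT a h. Qed.

Lemma integrableRD f g : nu.-integrable setT (EFin \o f) -> nu.-integrable setT (EFin \o g) ->
  nu.-integrable setT (EFin \o (fun x => f x + g x)).
Proof. by move=> h1 h2; have := integrableD measurableT h1 h2. Qed.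

Lemma integrableRB f g : nu.-integrable setT (EFin \o f) -> nu.-integrable setT (EFin \o g) ->
  nu.-integrable setT (EFin \o (fun x => f x - g x)).
Proof. by move=> h1 h2; have := integrableB measurableT h1 h2. Qed.

End RealIntegrable.

(** Poisson kernel of the half plane without the factor [1 / pi]; it is the integral of
    [exp (- e xi) cos (v xi)] over [xi >= 0]. *)
Definition poisson e v : R := e / (e ^+ 2 + v ^+ 2).

Definition expweight e xi : R := if 0 <= xi then expR (- (e * xi)) else 0.

Lemma expweight_ge0 e xi : 0 <= expweight e xi.
Proof. by rewrite /expweight; case: ifP => // _; exact: expR_ge0. Qed.

Lemma expweight_le1 e xi : 0 < e -> expweight e xi <= 1.
Proof.
move=> e0; rewrite /expweight; case: ifP => // x0.
by rewrite -expR0 ler_expR oppr_le0 mulr_ge0 // ltW.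
Qed.

Lemma measurable_expweight e : measurable_fun setT (expweight e).
Proof.
apply: measurable_fun_ifT => //.
  by apply: measurable_fun_ler => //.
by apply: measurableT_comp => //; apply: measurableT_comp.
Qed.

Lemma cvg_exp_bounded e (g : R -> R) (B : R) : 0 < e -> (forall x, `|g x| <= B) ->
  expR (- (e * x)) * g x @[x --> +oo] --> (0 : R).
Proof.
move=> e0 gB; apply/cvgr0Pnorm_le => d d0.
near=> x.
have x0 : 0 < x by near: x; exact: nbhs_pinfty_gt.
rewrite normrM ger0_norm ?expR_ge0 //.
apply: (@le_trans _ _ (expR (- (e * x)) * B)); first by rewrite ler_wpM2l ?expR_ge0.
have B0 : 0 <= B by apply: le_trans (gB 0).
rewrite expRN -ler_pdivlMl ?invr_gt0 ?expR_gt0 // invrK.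
have h : B / (d * e) <= x by near: x; apply: nbhs_pinfty_ge; rewrite num_real.
have : e * x <= expR (e * x) by apply: le_trans (expR_ge1Dx _); rewrite lerDr.
move=> h2; have h3 : (e * x) * d <= expR (e * x) * d by rewrite ler_pM2r.
apply: le_trans h3.
by move: h; rewrite ler_pdivrMr ?mulr_gt0 // => h; rewrite (_ : e * x * d = x * (d * e)) //; ring.
Unshelve. all: by end_near. Qed.

(** The summand 1 keeps the integrand nonnegative, so that the fundamental theorem applies on the
    half line; the cosine integral is the case [c = 1] minus the case [c = 0]. *)
Lemma integral_exp_trig e v (c : R) : 0 < e -> c = 0 \/ c = 1 ->
  (\int[mu]_(x in `[0%R, +oo[) (expR (- (e * x)) * (1 + c * cos (v * x)))%:E =
   (e^-1 + c * poisson e v)%:E)%E.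
Proof.
move=> e0 c01.
have c0 : 0 <= c <= 1 by case: c01 => ->; rewrite lexx ler01.
pose D := e ^+ 2 + v ^+ 2.
have D0 : 0 < D by rewrite ltr_wpDr ?sqr_ge0 // exprn_gt0.
pose F (x : R) : R := expR (- (e * x)) * (- e^-1 + c * ((v * sin (v * x) - e * cos (v * x)) / D)).
have dF (x : R) : is_derive x 1 F (expR (- (e * x)) * (1 + c * cos (v * x))).
  apply: is_derive_eq.
  rewrite /GRing.scale /= /D; field.
  by rewrite (gt_eqF e0) (gt_eqF D0).
have cF : continuous F by move=> x; apply: differentiable_continuous; apply/derivable1_diffP.
rewrite (@ge0_continuous_FTC2y R _ F 0 0).
- rewrite /F !mulr0 oppr0 expR0 sin0 cos0 mulr0 sub0r mulr1 mul1r -EFinB; congr (_%:E).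
  by rewrite /poisson -/D; field; rewrite (gt_eqF e0) (gt_eqF D0).
- move=> x _; rewrite mulr_ge0 ?expR_ge0 //.
  have := cos_geN1 (v * x); move: (cos _) => y y1; nra.
- by apply: derivable_within_continuous => x _; exact: ex_derive.
- apply: (@cvg_exp_bounded e _ (e^-1 + (`|v| + e) / D)) => // x.
  apply: le_trans (ler_normD _ _) _; rewrite normrN ger0_norm ?invr_ge0 ?(ltW e0) // lerD2l.
  have [a1 a2] := andP c0.
  rewrite normrM (ger0_norm a1) (@le_trans _ _ `|(v * sin (v * x) - e * cos (v * x)) / D|) //.
    by rewrite ler_piMl.
  rewrite normrM normfV (gtr0_norm D0) ler_pM2r ?invr_gt0 //.
  apply: le_trans (ler_normB _ _) _; rewrite !normrM (gtr0_norm e0) lerD //.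
    by rewrite ler_piMr // sin_max.
  by rewrite ler_piMr ?(ltW e0) // cos_max.
- by move=> x _; exact: ex_derive.
- by apply: cvg_at_right_filter; exact: cF.
- by move=> x _; rewrite derive1E; exact: derive_val.
Qed.

Lemma expweight_trigE e v (c : R) :
  (\int[mu]_x (expweight e x * (1 + c * cos (v * x)))%:E =
   \int[mu]_(x in `[0%R, +oo[) (expR (- (e * x)) * (1 + c * cos (v * x)))%:E)%E.
Proof.
rewrite [RHS]integral_mkcond; apply: eq_integral => x _.
rewrite patchE /expweight mem_setE in_itv /= andbT; case: ifP => // _.
by rewrite mul0r.
Qed.

Lemma integral_expweight e : 0 < e -> (\int[mu]_x (expweight e x)%:E = (e^-1)%:E)%E.
Proof.
move=> e0; have := @expweight_trigE e 0 0; rewrite integral_exp_trig //; last by left.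
rewrite mul0r addr0 => <-; apply: eq_integral => x _.
by rewrite mul0r addr0 mulr1.
Qed.

Lemma integrable_expweight e : 0 < e -> mu.-integrable setT (EFin \o expweight e).
Proof.
move=> e0; apply/integrableP; split; first by apply/measurable_EFinP; exact: measurable_expweight.
under eq_integral => x _ do rewrite /= ger0_norm ?expweight_ge0 //.
by rewrite integral_expweight // ltry.
Qed.

Lemma measurable_cosM v : measurable_fun setT (fun x : R => cos (v * x)).
Proof. apply: measurableT_comp; last exact: measurable_funM.
by apply: continuous_measurable_fun; exact: continuous_cos. Qed.

Lemma Rintegral_expweight_cos e v : 0 < e ->
  Rintegral mu setT (fun xi => expweight e xi * cos (v * xi)) = poisson e v.
Proof.
move=> e0.
have i0 := integrable_expweight e0.
have i1 : mu.-integrable setT (EFin \o (fun xi => expweight e xi * cos (v * xi))).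
  apply: le_integrableR i0.
    by apply: measurable_funM; [exact: measurable_expweight|exact: measurable_cosM].
  by move=> x; rewrite normrM ger0_norm ?expweight_ge0 // ler_piMr ?expweight_ge0 // cos_max.
have := @expweight_trigE e v 1; rewrite integral_exp_trig //; last by right.
move/(congr1 fine) => /= h; rewrite mul1r in h.
have h2 : e^-1 = Rintegral mu setT (expweight e) by rewrite /Rintegral integral_expweight.
apply: (addrI e^-1); rewrite -h {1}h2 -RintegralD //.
by rewrite /Rintegral; congr fine; apply: eq_integral => x _; rewrite mul1r mulrDr mulr1.
Qed.

Lemma poisson_ge0 e v : 0 < e -> 0 <= poisson e v.
Proof. by move=> e0; rewrite divr_ge0 ?addr_ge0 ?sqr_ge0 // ltW. Qed.

Lemma continuous_poisson e p : 0 < e -> continuous (fun x => poisson e (x - p)).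
Proof.
move=> e0 x; apply: differentiable_continuous; apply/derivable1_diffP.
rewrite /poisson; apply: derivableM; first exact: derivable_cst.
apply: derivableV; first by rewrite gt_eqF // ltr_wpDr ?sqr_ge0 // exprn_gt0.
exact: ex_derive.
Qed.

Lemma integral_poisson e p : 0 < e -> (\int[mu]_x (poisson e (x - p))%:E = pi%:E)%E.
Proof.
move=> e0.
pose F (x : R) : R := e * x + p.
have dF (x : R) : is_derive x 1 F e.
  by apply: is_derive_eq; rewrite /GRing.scale /=; ring.
have F' : F^`()%classic = fun=> e by apply/funext => x; rewrite derive1E; exact: derive_val.
rewrite (@increasing_ge0_integration_by_substitutionT R F (fun x => poisson e (x - p))).
- rewrite F' (_ : (fun x => _) = fun x => ((1 + x ^+ 2)^-1)%:E); last first.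
    apply/funext => x; congr (_%:E); rewrite /poisson /F /= fctE /=.
    have h : 0 < 1 + x ^+ 2 by rewrite ltr_wpDr ?sqr_ge0.
    rewrite addrK exprMn -[X in e / (X + _)]mulr1 -mulrDr expr2 invfM mulrA.
    by field; rewrite (gt_eqF e0) (gt_eqF h).
  rewrite ge0_symfun_integralT.
  + have -> : [set x : R | 0 <= x] = `[0, +oo[%classic by rewrite set_itvcy.
    have := @integral0y_oneDsqr R; rewrite /oneDsqr => ->.
    by rewrite -EFinM; congr (_%:E); field.
  + by move=> x; rewrite invr_ge0 addr_ge0 // sqr_ge0.
  + exact: continuous_oneDsqrV.
  + by move=> x; rewrite /= sqrrN.
- by move=> x y xy; rewrite /F ltrD2r ltr_pM2l.
- by rewrite F'; exact: cst_continuous.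
- by rewrite F'; apply: is_cvg_cst.
- by rewrite F'; apply: is_cvg_cst.
- by move=> x; exact: ex_derive.
- apply/cvgrNyPle => A; near=> x.
  rewrite /F -lerBrDr -ler_pdivlMl //; near: x; apply: nbhs_ninfty_le; exact: num_real.
- apply/cvgryPge => A; near=> x.
  rewrite /F -lerBlDr -ler_pdivrMl //; near: x; apply: nbhs_pinfty_ge; exact: num_real.
- exact: continuous_poisson.
- by move=> x; exact: poisson_ge0.
Unshelve. all: by end_near. Qed.

Lemma integrable_poisson e p : 0 < e -> mu.-integrable setT (EFin \o (fun x => poisson e (x - p))).
Proof.
move=> e0; apply/integrableP; split.
  by apply/measurable_EFinP; apply: continuous_measurable_fun; exact: continuous_poisson.
under eq_integral => x _ do rewrite /= ger0_norm ?poisson_ge0 //.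
by rewrite integral_poisson // ltry.
Qed.

(* The Poisson integrals of [u] converge pointwise to [pi * u]: away from [p]
   the kernel is at most [e (1 + 1/r^2) / (1 + v^2)]. *)
Lemma poisson_cvg u B p : continuous u -> (forall x, `|u x| <= B) ->
  Rintegral mu setT (fun x => u x * poisson e (x - p)) @[e --> 0^'+] --> pi * u p.
Proof.
move=> cu uB; have B0 : 0 <= B by apply: le_trans (uB 0).
have mu_ : measurable_fun setT u by exact: continuous_measurable_fun.
have iP := integrable_poisson.
have iu e : 0 < e -> mu.-integrable setT (EFin \o (fun x => u x * poisson e (x - p))).
  move=> e0.
  have i : mu.-integrable setT (EFin \o (fun x => B * poisson e (x - p))).
    exact: integrableZl (iP _ _ e0).
  apply: le_integrableR i.
  - by apply: measurable_funM => //; apply: continuous_measurable_fun; exact: continuous_poisson.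
  - by move=> x; rewrite normrM (ger0_norm (poisson_ge0 _ e0)) ler_wpM2r ?poisson_ge0.
apply/cvgrPdist_le => d d0.
have d2 : 0 < d / (2 * pi) by rewrite divr_gt0 ?mulr_gt0 ?pi_gt0.
have /cvgrPdist_le /(_ _ d2) := cu p.
move=> [r /= r0 hr].
pose K := 2 * B * (1 + r ^- 2).
have K0 : 0 <= K by rewrite !mulr_ge0 // addr_ge0 // invr_ge0 sqr_ge0.
have Kp : 0 < K * pi + 1 by rewrite ltr_wpDl // mulr_ge0 // pi_ge0.
have Kq : 0 < d / 2 / (K * pi + 1) by rewrite divr_gt0 // divr_gt0.
near=> e.
have e0 : 0 < e by near: e; exact: nbhs_right_gt.
have hp : pi * u p = Rintegral mu setT (fun x => u p * poisson e (x - p)).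
  rewrite RintegralZl //; last exact: iP.
  by rewrite /Rintegral integral_poisson // mulrC.
rewrite hp -RintegralB //; [|by apply: integrableRZ; exact: iP|exact: iu].
have iD : mu.-integrable setT (EFin \o (fun x => u p * poisson e (x - p) - u x * poisson e (x - p))).
  by apply: integrableRB; [apply: integrableRZ; exact: iP|exact: iu].
apply: (le_trans (le_normr_Rintegral _ iD)) => //.
have i1 := integrableRZ (d / (2 * pi)) (iP e p e0).
have i2 := integrableRZ (e * K) (iP 1 p ltr01).
apply: (@le_trans _ _ (Rintegral mu setT (fun x => d / (2 * pi) * poisson e (x - p) + e * K * poisson 1 (x - p)))).
  apply: le_Rintegral => //; first exact: integrable_norm.
    exact: integrableRD i1 i2.
  move=> x _; rewrite -mulrBl normrM (ger0_norm (poisson_ge0 _ e0)).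
  have [xr|xr] := ltP `|p - x| r.
    apply: (@le_trans _ _ (d / (2 * pi) * poisson e (x - p))).
      by rewrite ler_wpM2r ?poisson_ge0 //; exact: hr.
    by rewrite lerDl mulr_ge0 ?poisson_ge0 // mulr_ge0 // ltW.
  apply: (@le_trans _ _ (e * K * poisson 1 (x - p))); last first.
    by rewrite lerDr mulr_ge0 ?poisson_ge0 // ltW.
  have uu : `|u p - u x| <= 2 * B.
    by apply: (le_trans (ler_normB _ _)); have := uB p; have := uB x; lra.
  apply: (le_trans (ler_wpM2r (poisson_ge0 _ e0) uu)).
  have -> : e * K * poisson 1 (x - p) = 2 * B * (e * (1 + r ^- 2) * poisson 1 (x - p)).
    by rewrite /K; ring.
  rewrite ler_wpM2l ?mulr_ge0 //.
  rewrite distrC in xr; rewrite /poisson; set v := x - p in xr *.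
  have v2 : r ^+ 2 <= v ^+ 2 by rewrite -[v ^+ 2]real_normK ?num_real // lerXn2r ?nnegrE // ltW.
  have r2 : 0 < r ^+ 2 by rewrite exprn_gt0.
  have v0 : 0 < v ^+ 2 by apply: lt_le_trans v2.
  rewrite expr1n div1r -mulrA ler_wpM2l ?(ltW e0) //.
  rewrite ler_pdivlMr ?ltr_wpDr ?(ltW v0) // mulrC ler_pdivrMr ?ltr_wpDl ?sqr_ge0 //.
  have : 1 <= r ^- 2 * v ^+ 2 by rewrite mulrC ler_pdivlMr // mul1r.
  have : 0 <= e ^+ 2 * (1 + r ^- 2) by rewrite mulr_ge0 ?sqr_ge0 // addr_ge0 // invr_ge0 ltW.
  move: (r ^- 2) (v ^+ 2) (e ^+ 2) => a b c; lra.
rewrite (RintegralD measurableT i1 i2) RintegralZl //; last exact: (iP e p e0).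
rewrite RintegralZl //; last exact: (iP 1 p ltr01).
rewrite {1 2}/Rintegral !integral_poisson //=.
have E (P : R) : 0 < P -> d / (2 * P) * P = d / 2 by move=> P0; field; rewrite gt_eqF.
rewrite E ?pi_gt0 // -mulrA.
have : e * (K * pi) <= d / 2.
  have : e <= d / 2 / (K * pi + 1).
    by near: e; exact: nbhs_right_le.
  rewrite ler_pdivlMr // mulrDr mulr1; lra.
lra.
Unshelve. all: by end_near. Qed.

(* Integrating the Poisson kernel against [u] in two ways (Fubini) shows that only
   the frequencies below [s] contribute. *)
Lemma bandlimited_bound u B (s : R) : 0 <= s -> continuous u -> (forall x, `|u x| <= B) ->
  mu.-integrable setT (EFin \o u) ->
  (forall xi, s < xi -> Rintegral mu setT (fun x => u x * cos (x * xi)) = 0 /\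
                        Rintegral mu setT (fun x => u x * sin (x * xi)) = 0) ->
  exists2 K, 0 <= K & forall (I : Type) (r : seq I) (c p : I -> R) (q tau : R),
    (forall xi, 0 <= xi <= s ->
      `|\sum_(i <- r) c i * (cos (p i * xi) - cos (q * xi))| <= tau /\
      `|\sum_(i <- r) c i * (sin (p i * xi) - sin (q * xi))| <= tau) ->
    `|\sum_(i <- r) c i * (u (p i) - u q)| <= K * tau.
Proof.
move=> s0 cu uB iu hu.
have mu_ : measurable_fun setT u by exact: continuous_measurable_fun.
pose A xi := Rintegral mu setT (fun x => u x * cos (x * xi)).
pose S xi := Rintegral mu setT (fun x => u x * sin (x * xi)).
pose N := Rintegral mu setT (fun x => `|u x|).
have iuc (g : R -> R) : measurable_fun setT g -> (forall x, `|g x| <= 1) ->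
    mu.-integrable setT (EFin \o (fun x => u x * g x)).
  move=> mg g1; apply: (le_integrableR _ _ (integrable_norm iu)).
    exact: measurable_funM.
  by move=> x; rewrite normrM ler_piMr.
have mcs xi : measurable_fun setT (fun x : R => cos (x * xi)).
  by under eq_fun do rewrite mulrC; exact: measurable_cosM.
have msn xi : measurable_fun setT (fun x : R => sin (x * xi)).
  apply: measurableT_comp; last exact: measurable_funM.
  by apply: continuous_measurable_fun; exact: continuous_sin.
have iuC xi : mu.-integrable setT (EFin \o (fun x => u x * cos (x * xi))).
  by apply: iuc => // x; exact: cos_max.
have iuS xi : mu.-integrable setT (EFin \o (fun x => u x * sin (x * xi))).
  by apply: iuc => // x; exact: sin_max.
have AN xi : `|A xi| <= N.
  apply: (le_trans (le_normr_Rintegral _ (iuC xi))) => //.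
  apply: le_Rintegral => //; [exact: integrable_norm|exact: integrable_norm|].
  by move=> x _; rewrite normrM ler_piMr // cos_max.
have SN xi : `|S xi| <= N.
  apply: (le_trans (le_normr_Rintegral _ (iuS xi))) => //.
  apply: le_Rintegral => //; [exact: integrable_norm|exact: integrable_norm|].
  by move=> x _; rewrite normrM ler_piMr // sin_max.
have N0 : 0 <= N by apply: le_trans (AN 0).
have pi0 := @pi_gt0 R.
(* Two transforms [A] and [S], each at most [N], over an interval of length [s]; the [pi] is the
   mass of the Poisson kernel. *)
exists (2 * N * s / pi); first by rewrite !mulr_ge0 // invr_ge0 ltW.
move=> I r c p q tau htau.
pose h e p' xi := expweight e xi * (cos (p' * xi) * A xi + sin (p' * xi) * S xi).
have key e p' : 0 < e -> mu.-integrable setT (EFin \o h e p') /\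
    Rintegral mu setT (h e p') = Rintegral mu setT (fun x => u x * poisson e (x - p')).
  move=> e0.
  pose f (z : R * R) : R := expweight e z.1 * u z.2 * cos (z.1 * (z.2 - p')).
  have iE := integrable_expweight e0.
  have mE := measurable_expweight e.
  have if_ : (mu \x mu)%E.-integrable setT (EFin \o f).
    apply: (le_integrableR _ _ (integrable_norm (integrable_prod iE iu))).
      apply: measurable_funM.
        by apply: measurable_funM; apply: measurableT_comp.
      apply: measurableT_comp; first by apply: continuous_measurable_fun; exact: continuous_cos.
      by apply: measurable_funM => //; apply: measurable_funB.
    by move=> x; rewrite normrM ler_piMr // cos_max.
  have F1 xi : (\int[mu]_x (EFin \o f) (xi, x) = (h e p' xi)%:E)%E.
    rewrite /h.
    have -> : cos (p' * xi) * A xi + sin (p' * xi) * S xi =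
      Rintegral mu setT (fun x => cos (p' * xi) * (u x * cos (x * xi)) + sin (p' * xi) * (u x * sin (x * xi))).
      rewrite RintegralD //; [|exact: integrableRZ|exact: integrableRZ].
      by rewrite !RintegralZl.
    rewrite -RintegralZl //; last by apply: integrableRD; apply: integrableRZ.
    rewrite /Rintegral fineK; last first.
      apply: integrable_fin_num => //; apply: integrableRZ.
      by apply: integrableRD; apply: integrableRZ.
    apply: eq_integral => x _; congr (_%:E); rewrite /f /= mulrBr cosB.
    by rewrite (mulrC xi x) (mulrC xi p'); ring.
  have F2 x : (\int[mu]_xi (EFin \o f) (xi, x) = (u x * poisson e (x - p'))%:E)%E.
    rewrite -Rintegral_expweight_cos //.
    have i1 : mu.-integrable setT (EFin \o (fun xi => expweight e xi * cos ((x - p') * xi))).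
      apply: (le_integrableR _ _ iE).
        by apply: measurable_funM; [exact: measurable_expweight|exact: measurable_cosM].
      by move=> y; rewrite normrM ger0_norm ?expweight_ge0 // ler_piMr ?expweight_ge0 // cos_max.
    rewrite -RintegralZl // /Rintegral fineK; last first.
      by apply: integrable_fin_num => //; exact: integrableRZ.
    apply: eq_integral => xi _; congr (_%:E); rewrite /f /= (mulrC xi).
    by ring.
  split.
    have := integrable_fubini_F if_; rewrite /fubini_F.
    by under eq_fun do rewrite F1.
  rewrite /Rintegral; congr fine.
  transitivity (\int[mu]_xi \int[mu]_x (EFin \o f) (xi, x))%E.
    by apply: eq_integral => x _; rewrite F1.
  rewrite (Fubini if_).
  by apply: eq_integral => x _; exact: F2.
have tau0 : 0 <= tau by have := htau 0; rewrite lexx s0 => /(_ isT) [+ _]; exact: le_trans.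
pose D := `[0, s]%classic : set R.
have bound e : 0 < e ->
  `|\sum_(i <- r) c i * (Rintegral mu setT (fun x => u x * poisson e (x - p i)) -
      Rintegral mu setT (fun x => u x * poisson e (x - q)))| <= 2 * N * s * tau.
  move=> e0.
  pose H xi := \sum_(i <- r) c i * (h e (p i) xi - h e q xi).
  have HE : mu.-integrable setT (EFin \o H) /\
    Rintegral mu setT H = \sum_(i <- r) c i * (Rintegral mu setT (fun x => u x * poisson e (x - p i)) -
      Rintegral mu setT (fun x => u x * poisson e (x - q))).
    have [iq Eq] := key e q e0.
    rewrite /H; elim: r {htau H} => [|i r [IH1 IH2]].
      have -> : (fun xi => \sum_(i <- [::]) c i * (h e (p i) xi - h e q xi)) = fun=> 0.
        by apply/funext => x; rewrite big_nil.
      split; first exact: (integrable0 _ setT).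
      by rewrite big_nil /Rintegral integral0.
    have [ip Ep] := key e (p i) e0.
    under eq_fun do rewrite big_cons.
    have i1 : mu.-integrable setT (EFin \o (fun xi => c i * (h e (p i) xi - h e q xi))).
      by apply: integrableRZ; exact: integrableRB.
    split; first exact: integrableRD.
    rewrite big_cons RintegralD // IH2; congr (_ + _).
    by rewrite RintegralZl ?RintegralB ?Ep ?Eq //; exact: integrableRB.
  rewrite -HE.2.
  have hH xi : H xi = expweight e xi *
     (A xi * (\sum_(i <- r) c i * (cos (p i * xi) - cos (q * xi))) +
      S xi * (\sum_(i <- r) c i * (sin (p i * xi) - sin (q * xi)))).
    rewrite /H !mulr_sumr -big_split mulr_sumr /=; apply: eq_bigr => i _.
    by rewrite /h; ring.
  have HD : H = H \_ D.
    apply/funext => xi; rewrite patchE; case: ifPn => //.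
    rewrite /D notin_setE /= in_itv /= => /negP; rewrite negb_and -!ltNge => /orP[xi0|xis].
      by rewrite hH /expweight leNgt xi0 /= mul0r.
    by have [a b] := hu _ xis; rewrite hH /A /S a b !mul0r addr0 mulr0.
  rewrite HD -Rintegral_mkcond.
  have mD : measurable D by exact: measurable_itv.
  have iHD : mu.-integrable D (EFin \o H) by apply: (@integrableS _ _ R mu setT D) => //; exact: HE.1.
  apply: (le_trans (le_normr_Rintegral _ iHD)) => //.
  have ic : mu.-integrable D (EFin \o (fun _ : R => 2 * N * tau)).
    apply: continuous_compact_integrable; first exact: segment_compact.
    by apply: continuous_subspaceT => x; exact: cst_continuous.
  apply: (@le_trans _ _ (Rintegral mu D (fun _ => 2 * N * tau))).
    apply: le_Rintegral => //; first exact: integrable_norm.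
    move=> xi; rewrite /D /= in_itv /= => xs; have [t1 t2] := htau _ xs.
    rewrite hH normrM ger0_norm ?expweight_ge0 //.
    apply: (@le_trans _ _ (1 * (N * tau + N * tau))); last by rewrite mul1r le_eqVlt; apply/orP; left; apply/eqP; ring.
    apply: ler_pM; rewrite ?expweight_ge0 ?expweight_le1 //.
    apply: (le_trans (ler_normD _ _)); rewrite !normrM lerD // ler_pM //.
  have hm : fine (@lebesgue_measure R `[0, s]%classic) = s.
    rewrite lebesgue_measure_itv /= lte_fin; case: ltP => [_|s0'] /=; first by rewrite oppr0 addr0.
    by apply/eqP; rewrite eq_le s0 s0'.
  rewrite Rintegral_cst //; set m := fine _; have -> : m = s by exact: hm.
  by rewrite mulrAC.
have cv : `|\sum_(i <- r) c i * (Rintegral mu setT (fun x => u x * poisson e (x - p i)) -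
      Rintegral mu setT (fun x => u x * poisson e (x - q)))| @[e --> 0^'+] -->
    `|\sum_(i <- r) c i * (pi * u (p i) - pi * u q)|.
  apply: cvg_norm; apply: cvg_big => [|i _]; first exact: add_continuous.
  apply: cvgM; first exact: cvg_cst.
  by apply: cvgB; [exact: (@poisson_cvg u B (p i) cu uB)|exact: (@poisson_cvg u B q cu uB)].
have : `|\sum_(i <- r) c i * (pi * u (p i) - pi * u q)| <= 2 * N * s * tau.
  rewrite -(cvg_lim _ cv) //; apply: limr_le; first by apply/cvg_ex; eexists; exact: cv.
  by near=> e; apply: bound; near: e; exact: nbhs_right_gt.
have -> : \sum_(i <- r) c i * (pi * u (p i) - pi * u q) = pi * \sum_(i <- r) c i * (u (p i) - u q).
  by rewrite mulr_sumr; apply: eq_bigr => i _; ring.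
rewrite normrM (gtr0_norm pi0) mulrC -ler_pdivlMr //.
by move/le_trans; apply; rewrite le_eqVlt; apply/orP; left; apply/eqP; ring.
Unshelve. all: by end_near. Qed.

End PoissonKernel.

(** * Spectrum of one-dimensional slices of functions on the plane *)

Section Slices.
Context {R : realType}.
Let mu := @lebesgue_measure R.
Implicit Types (a phi : R * R -> R) (i : bool) (x y t xi eta : R).

(* [t] is the coordinate in direction [i] and [y] the other one. *)
Definition pt i t y : R * R := if i then (y, t) else (t, y).

(** Lorentzian weight, the Poisson kernel at [e = 1]: an integrable majorant whose integral is
    already known to be [pi]. *)
Definition lor x : R := (1 + x ^+ 2)^-1.

Lemma lor_gt0 x : 0 < lor x.
Proof. by rewrite invr_gt0 ltr_wpDr ?sqr_ge0. Qed.

Lemma lor_ge0 x : 0 <= lor x. Proof. exact/ltW/lor_gt0. Qed.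

Lemma lor_le1 x : lor x <= 1.
Proof. by rewrite invf_le1 ?lerDl ?sqr_ge0 // ltr_wpDr ?sqr_ge0. Qed.

Lemma integrable_lor : mu.-integrable setT (EFin \o lor).
Proof.
have := @integrable_poisson R 1 0 ltr01; congr (_.-integrable _ _).
apply/funext => x /=; congr (_%:E).
by rewrite /poisson /lor subr0 expr1n div1r.
Qed.

Lemma continuous_pt i y : continuous (fun t => pt i t y).
Proof.
move=> t; have h1 : (fun _ : R => y) @ t --> y by exact: cvg_cst.
have h2 : (fun x : R => x) @ t --> t by exact: cvg_id.
by rewrite /pt; case: i; [exact: (cvg_pair h1 h2)|exact: (cvg_pair h2 h1)].
Qed.

Lemma continuous_ptr i t : continuous (fun y => pt i t y).
Proof.
move=> y; have h1 : (fun _ : R => t) @ y --> t by exact: cvg_cst.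
have h2 : (fun x : R => x) @ y --> y by exact: cvg_id.
by rewrite /pt; case: i; [exact: (cvg_pair h2 h1)|exact: (cvg_pair h1 h2)].
Qed.

Lemma integrable_lor2 : (mu \x mu)%E.-integrable setT (EFin \o (fun z : R * R => lor z.1 * lor z.2)).
Proof. exact: integrable_prod integrable_lor integrable_lor. Qed.

Definition decays2 phi B := forall z, `|phi z| <= B * (lor z.1 * lor z.2).

Lemma decays2_pt phi B i t y : decays2 phi B -> `|phi (pt i t y)| <= B * (lor t * lor y).
Proof.
by move=> h; have := h (pt i t y); rewrite /pt; case: i => //=; rewrite (mulrC (lor t)).
Qed.

Lemma decays2_ge0 phi B : decays2 phi B -> 0 <= B.
Proof.
move=> /(_ (0, 0)) /= h; have : 0 <= B * (lor 0 * lor 0) by apply: le_trans h.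
by rewrite pmulr_lge0 // mulr_gt0 // lor_gt0.
Qed.

Lemma decays2M phi B (g : R * R -> R) : decays2 phi B -> (forall z, `|g z| <= 1) ->
  decays2 (fun z => phi z * g z) B.
Proof. by move=> h g1 z; rewrite normrM; apply: le_trans (h z); rewrite ler_piMr. Qed.

Lemma decays2_integrable phi B : measurable_fun setT phi -> decays2 phi B ->
  (mu \x mu)%E.-integrable setT (EFin \o phi).
Proof.
move=> mphi h; have i := integrableRZ B integrable_lor2.
by apply: (le_integrableR _ _ i).
Qed.

Lemma integrable_slice phi B i y : continuous phi -> decays2 phi B ->
  mu.-integrable setT (EFin \o (fun t => phi (pt i t y))).
Proof.
move=> cphi h; have k := integrableRZ (B * lor y) integrable_lor.
apply: (le_integrableR _ _ k).
- apply: continuous_measurable_fun => t.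
  by apply: continuous_comp; [exact: continuous_pt|exact: cphi].
- by move=> t; apply: le_trans (decays2_pt i t y h) _; rewrite mulrCA mulrC mulrAC.
Qed.

Lemma Rintegral_slices phi B i : continuous phi -> measurable_fun setT phi -> decays2 phi B ->
  Rintegral (mu \x mu)%E setT phi =
  Rintegral mu setT (fun y => Rintegral mu setT (fun t => phi (pt i t y))).
Proof.
move=> cphi mphi h; have ip := decays2_integrable mphi h.
have e y : ((Rintegral mu setT (fun t => phi (pt i t y)))%:E =
    \int[mu]_t (phi (pt i t y))%:E)%E.
  by rewrite /Rintegral fineK //; apply: integrable_fin_num => //; exact: integrable_slice h.
rewrite /Rintegral; congr fine; symmetry.
under eq_integral do rewrite e.
rewrite /pt; case: i {e}.
  exact: (integral12_prod_meas1 ip).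
exact: (integral21_prod_meas1 ip).
Qed.

Lemma continuous_slice_integral phi B i (g : R -> R) : continuous phi -> continuous g ->
  (forall t, `|g t| <= 1) -> decays2 phi B ->
  continuous (fun y => Rintegral mu setT (fun t => phi (pt i t y) * g t)).
Proof.
move=> cphi cg g1 h y.
have B0 := decays2_ge0 h.
apply: (@continuity_under_integral R _ _ mu (fun y t => phi (pt i t y) * g t) setT measurableT
   (y - 1) (y + 1) _ _ (fun t => B * lor t)).
- move=> z _; apply: (le_integrableR _ _ (integrable_norm (integrable_slice i z cphi h))).
    apply: measurable_funM; last exact: continuous_measurable_fun.
    apply: continuous_measurable_fun => t.
    by apply: continuous_comp; [exact: continuous_pt|exact: cphi].
  by move=> t; rewrite normrM ler_piMr.
- apply: aeW => t _ z _; apply: continuousM; last exact: cst_continuous.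
  by apply: continuous_comp; [exact: continuous_ptr|exact: cphi].
- exact: (integrableRZ B integrable_lor).
- move=> z _; apply: aeW => t _; rewrite normrM.
  apply: (@le_trans _ _ `|phi (pt i t z)|); first by rewrite ler_piMr.
  apply: le_trans (decays2_pt i t z h) _; rewrite mulrA ler_piMr ?lor_le1 //.
  by rewrite mulr_ge0 // lor_ge0.
- by rewrite inE /= in_itv /=; lra.
Qed.

Lemma slice_integral_le phi B i (g : R -> R) y : continuous phi -> continuous g ->
  (forall t, `|g t| <= 1) -> decays2 phi B ->
  `|Rintegral mu setT (fun t => phi (pt i t y) * g t)| <= B * pi * lor y.
Proof.
move=> cphi cg g1 h.
have i1 : mu.-integrable setT (EFin \o (fun t => phi (pt i t y) * g t)).
  apply: (le_integrableR _ _ (integrable_norm (integrable_slice i y cphi h))).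
    apply: measurable_funM; last exact: continuous_measurable_fun.
    apply: continuous_measurable_fun => t.
    by apply: continuous_comp; [exact: continuous_pt|exact: cphi].
  by move=> t; rewrite normrM ler_piMr.
apply: (le_trans (le_normr_Rintegral _ i1)) => //.
have i2 := @integrableRZ R _ _ mu lor (B * lor y) integrable_lor.
apply: (@le_trans _ _ (Rintegral mu setT (fun t => B * lor y * lor t))).
  apply: le_Rintegral => //; first exact: integrable_norm.
  move=> t _; rewrite normrM; apply: (@le_trans _ _ `|phi (pt i t y)|); first by rewrite ler_piMr.
  by apply: le_trans (decays2_pt i t y h) _; rewrite mulrCA mulrC mulrAC.
rewrite RintegralZl //; last exact: integrable_lor.
rewrite mulrAC; suff -> : Rintegral mu setT lor = pi by rewrite mulrAC.
have := @integral_poisson R 1 0 ltr01; move/(congr1 fine) => /= <-.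
rewrite /Rintegral; congr fine; apply: eq_integral => t _.
by rewrite /poisson /lor subr0 expr1n div1r.
Qed.

Lemma continuous_lin_trig (g : R -> R) xi : continuous g -> continuous (fun t => g (t * xi)).
Proof.
move=> cg t; apply: (@continuous_comp _ _ _ (fun t => t * xi) g); last exact: cg.
exact: mulrr_continuous.
Qed.

(* Uniqueness: [U y] is bounded, integrable and all its frequencies vanish. *)
Lemma slice_spectrum phi B i (s xi : R) : continuous phi -> measurable_fun setT phi ->
  decays2 phi B ->
  (forall x y, s < `|x| ->
     Rintegral (mu \x mu)%E setT (fun z => phi z * cos (z.1 * (pt i x y).1 + z.2 * (pt i x y).2)) = 0 /\
     Rintegral (mu \x mu)%E setT (fun z => phi z * sin (z.1 * (pt i x y).1 + z.2 * (pt i x y).2)) = 0) ->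
  s < xi -> 0 <= s -> forall y,
  Rintegral mu setT (fun t => phi (pt i t y) * cos (t * xi)) = 0 /\
  Rintegral mu setT (fun t => phi (pt i t y) * sin (t * xi)) = 0.
Proof.
move=> cphi mphi h h0 sxi s0.
have xi0 : 0 <= xi by apply: le_trans s0 (ltW sxi).
have B0 := decays2_ge0 h.
have xis : s < `|xi| by rewrite ger0_norm.
have xis' : s < `|- xi| by rewrite normrN.
have cc := @continuous_cos R; have cs := @continuous_sin R.
have trig (e : bool) x eta : Rintegral mu setT (fun y => Rintegral mu setT (fun t =>
    phi (pt i t y) * (if e then sin else cos) (t * x + y * eta))) =
    Rintegral (mu \x mu)%E setT (fun z => phi z * (if e then sin else cos) (z.1 * (pt i x eta).1 + z.2 * (pt i x eta).2)).
  pose g (z : R * R) : R := (if e then sin else cos) (z.1 * (pt i x eta).1 + z.2 * (pt i x eta).2).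
  have cg : continuous g.
    move=> z; rewrite /g; apply: (@continuous_comp _ _ _ (fun z : R * R => z.1 * _ + z.2 * _)).
      by apply: continuousD; apply: continuousM; by [exact: cst_continuous|exact: cvg_fst|exact: cvg_snd].
    by case: (e); [exact: cs|exact: cc].
  have g1 z : `|g z| <= 1 by rewrite /g; case: (e); [exact: sin_max|exact: cos_max].
  have mg : measurable_fun setT g.
    rewrite /g; apply: measurableT_comp.
      by case: (e); exact: continuous_measurable_fun.
    by apply: measurable_funD; apply: measurable_funM.
  rewrite [RHS](@Rintegral_slices _ B i).
  - rewrite /pt; case: (i); apply: eq_Rintegral => y _; apply: eq_Rintegral => t _ //=.
    by rewrite addrC.
  - by move=> z; apply: continuousM; [exact: cphi|exact: cg].
  - exact: measurable_funM.
  - exact: (decays2M h g1).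
pose U (g : R -> R) y := Rintegral mu setT (fun t => phi (pt i t y) * g (t * xi)).
have ccx : continuous (fun t : R => cos (t * xi)) by exact: continuous_lin_trig.
have csx : continuous (fun t : R => sin (t * xi)) by exact: continuous_lin_trig.
have cUc : continuous (U cos) by apply: continuous_slice_integral ccx _ h => // t; exact: cos_max.
have cUs : continuous (U sin) by apply: continuous_slice_integral csx _ h => // t; exact: sin_max.
have lUc y : `|U cos y| <= B * pi * lor y by apply: slice_integral_le => // t; exact: cos_max.
have lUs y : `|U sin y| <= B * pi * lor y by apply: slice_integral_le => // t; exact: sin_max.
have intM (u k : R -> R) : continuous u -> continuous k -> (forall y, `|u y| <= B * pi * lor y) ->
    (forall y, `|k y| <= 1) -> mu.-integrable setT (EFin \o (fun y => u y * k y)).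
  move=> cu ck lu lk; have j := integrableRZ (B * pi) integrable_lor.
  apply: (le_integrableR _ _ j).
    by apply: measurable_funM; exact: continuous_measurable_fun.
  by move=> y; rewrite normrM; apply: le_trans (lu y); rewrite ler_piMr.
have isl y (g : R -> R) : continuous g -> (forall t, `|g t| <= 1) ->
    mu.-integrable setT (EFin \o (fun t => phi (pt i t y) * g t)).
  move=> cg g1; apply: (le_integrableR _ _ (integrable_norm (integrable_slice i y cphi h))).
    apply: measurable_funM; last exact: continuous_measurable_fun.
    apply: continuous_measurable_fun => t.
    by apply: continuous_comp; [exact: continuous_pt|exact: cphi].
  by move=> t; rewrite normrM ler_piMr.
have islc y : mu.-integrable setT (EFin \o (fun t => phi (pt i t y) * cos (t * xi))).
  by apply: isl => // t; exact: cos_max.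
have isls y : mu.-integrable setT (EFin \o (fun t => phi (pt i t y) * sin (t * xi))).
  by apply: isl => // t; exact: sin_max.
pose I (u k : R -> R) eta := Rintegral mu setT (fun y => u y * k (y * eta)).
have cl (k : R -> R) (eta : R) : continuous k -> continuous (fun y => k (y * eta)).
  by move=> ck; exact: continuous_lin_trig.
have E1 eta : I (U cos) cos eta - I (U sin) sin eta = 0.
  rewrite /I -RintegralB //; last 2 first.
  - by apply: intM => //; [exact: cl|move=> y; exact: cos_max].
  - by apply: intM => //; [exact: cl|move=> y; exact: sin_max].
  have [<- _] := h0 _ eta xis; rewrite -(trig false); apply: eq_Rintegral => y _.
  rewrite /U -RintegralZr // -RintegralZr // -RintegralB //; last 2 first.
  - by have := integrableRZ (cos (y * eta)) (islc y); under eq_fun do rewrite mulrC.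
  - by have := integrableRZ (sin (y * eta)) (isls y); under eq_fun do rewrite mulrC.
  by apply: eq_Rintegral => t _; rewrite cosD; ring.
have E2 eta : I (U sin) cos eta + I (U cos) sin eta = 0.
  rewrite /I -RintegralD //; last 2 first.
  - by apply: intM => //; [exact: cl|move=> y; exact: cos_max].
  - by apply: intM => //; [exact: cl|move=> y; exact: sin_max].
  have [_ <-] := h0 _ eta xis; rewrite -(trig true); apply: eq_Rintegral => y _.
  rewrite /U -RintegralZr // -RintegralZr // -RintegralD //; last 2 first.
  - by have := integrableRZ (cos (y * eta)) (isls y); under eq_fun do rewrite mulrC.
  - by have := integrableRZ (sin (y * eta)) (islc y); under eq_fun do rewrite mulrC.
  by apply: eq_Rintegral => t _; rewrite sinD; ring.
have Ic u eta : I u cos (- eta) = I u cos eta.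
  by apply: eq_Rintegral => y _; rewrite mulrN cosN.
have Is (u : R -> R) eta : continuous u -> (forall y, `|u y| <= B * pi * lor y) ->
    I u sin (- eta) = - I u sin eta.
  move=> cu lu; rewrite /I -[RHS]mulN1r -RintegralZl //; last first.
    by apply: intM => //; [exact: cl|move=> y; exact: sin_max].
  by apply: eq_Rintegral => y _; rewrite mulrN sinN mulN1r mulrN.
(* The equations at [eta] and [- eta] decouple, since only the sine integrals change sign. *)
have Z eta : [/\ I (U cos) cos eta = 0, I (U cos) sin eta = 0, I (U sin) cos eta = 0 & I (U sin) sin eta = 0].
  have := E1 eta; have := E1 (- eta); have := E2 eta; have := E2 (- eta).
  rewrite !Ic !(Is _ _ cUc lUc) !(Is _ _ cUs lUs); move: (I _ _ _) (I _ _ _) (I _ _ _) (I _ _ _) => a1 a2 a3 a4.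
  by move=> *; split; lra.
(* With band limit 0 only the frequency 0 remains, where differences of exponentials vanish: [u] is
   constant, and its decay makes it 0. *)
have zero (u : R -> R) : continuous u -> (forall y, `|u y| <= B * pi * lor y) ->
    (forall eta, I u cos eta = 0 /\ I u sin eta = 0) -> forall y, u y = 0.
  move=> cu lu Iu.
  have pi0 := @pi_gt0 R; have Bpi : 0 <= B * pi by rewrite mulr_ge0 // ltW.
  have iu : mu.-integrable setT (EFin \o u).
    have := intM u (fun=> 1) cu (@cst_continuous _ _ _) lu.
    rewrite normr1 => /(_ (fun=> lexx _)).
    by under eq_fun do rewrite mulr1.
  have [|K K0 hK] := @bandlimited_bound R u (B * pi) 0 (lexx _) cu _ iu (fun eta _ => Iu eta).
    by move=> y; apply: le_trans (lu y) _; rewrite ler_piMr // lor_le1.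
  have uc y z : u y = u z.
    have := hK unit [:: tt] (fun=> 1) (fun=> y) z 0.
    rewrite !big_seq1 mulr0 mul1r normr_le0 subr_eq0 => H; apply/eqP/H => eta.
    move=> e0; have -> : eta = 0 by apply/eqP; rewrite eq_le andbC.
    by rewrite !big_seq1 !mulr0 !subrr !mulr0 normr0.
  move=> y; apply/eqP; rewrite -normr_le0; apply/ler_addgt0Pl => e e0; rewrite addr0.
  rewrite (uc y (B * pi / e)); apply: (le_trans (lu _)).
  rewrite /lor ler_pdivrMr ?ltr_wpDr ?sqr_ge0 //.
  set v := B * pi / e; have -> : B * pi = e * v by rewrite /v mulrCA divff ?mulr1 // gt_eqF.
  rewrite ler_pM2l //; have := sqr_ge0 (v - 1); rewrite sqrrB1; have := sqr_ge0 v; lra.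
move=> y; split.
  by apply: (zero (U cos)) => // eta; have [] := Z eta.
by apply: (zero (U sin)) => // eta; have [] := Z eta.
Qed.

End Slices.

Local Open Scope complex_scope.

(** * Band-limited convolutions in the plane *)

Section PlaneMeasurability.
Context {R : realType}.

(** An open set is the union of the rational boxes inside it, which are countably many and
    measurable for the product sigma-algebra. *)
Lemma open2_measurable (O : set (R * R)) : open O -> measurable O.
Proof.
move=> oO.
pose rect (q : (rat * rat) * (rat * rat)) : set (R * R) :=
  `]ratr q.1.1, ratr q.1.2[%classic `*` `]ratr q.2.1, ratr q.2.2[%classic.
have -> : O = \bigcup_q (if `[< rect q `<=` O >] then rect q else set0).
  apply/seteqP; split=> [[x y] Oxy|z [q _]]; last first.
    by case: asboolP => // h; exact: h.
  have /nbhs_ballP[e /= e0 he] := oO _ Oxy.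
  have [a1 ha1] : exists q : rat, ratr q \in `]x - e, x[ by apply: rat_in_itvoo; rewrite gtrBl.
  have [a2 ha2] : exists q : rat, ratr q \in `]x, x + e[ by apply: rat_in_itvoo; rewrite ltrDl.
  have [b1 hb1] : exists q : rat, ratr q \in `]y - e, y[ by apply: rat_in_itvoo; rewrite gtrBl.
  have [b2 hb2] : exists q : rat, ratr q \in `]y, y + e[ by apply: rat_in_itvoo; rewrite ltrDl.
  move: ha1 ha2 hb1 hb2; rewrite !in_itv /= => /andP[? ?] /andP[? ?] /andP[? ?] /andP[? ?].
  exists ((a1, a2), (b1, b2)) => //; rewrite ifT.
    by split; rewrite /= in_itv /=; apply/andP.
  apply/asboolP => -[u v] [] /=; rewrite !in_itv /= => /andP[? ?] /andP[? ?].
  by apply: he; split; rewrite /= /ball /= ltr_norml; lra.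
apply: countable_bigcupT_measurable; first exact: countableP.
by move=> q; case: ifP => // _; apply: measurableX; exact: measurable_itv.
Qed.

Lemma continuous2_measurable (f : R * R -> R) : continuous f -> measurable_fun setT f.
Proof.
move=> /continuousP cf; apply: (measurability _ (RGenOpens.measurableE R)).
move=> _ [_ [a [b ->] <-]]; rewrite setTI; apply: open2_measurable.
by apply: cf; exact: interval_open.
Qed.

End PlaneMeasurability.

Section ComplexParts.
Context {R : realType}.
Implicit Types (z : R[i]) (b : bool).

Definition cpart b z : R := if b then complex.Im z else complex.Re z.

Lemma cpart_le b z : `|cpart b z| <= Cabs z.
Proof.
case: z => x y; rewrite /Cabs /cpart /ComplexField.Normc.normc.
by case: b => /=; rewrite -sqrtr_sqr ler_wsqrtr // ?lerDl ?lerDr sqr_ge0.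
Qed.

Lemma Cabs_le z : Cabs z <= `|cpart false z| + `|cpart true z|.
Proof.
case: z => x y; rewrite /Cabs /cpart /ComplexField.Normc.normc /=.
rewrite -[leRHS]ger0_norm ?addr_ge0 // -sqrtr_sqr ler_wsqrtr //.
by rewrite sqrrD !real_normK ?num_real // -addrA lerD2l lerDr mulrn_wge0 // mulr_ge0.
Qed.

Lemma Cabs_ge0 z : 0 <= Cabs z.
Proof. by case: z => x y; exact: sqrtr_ge0. Qed.

End ComplexParts.

(** * Decay of Schwartz functions and the spectrum of the kernels [W n] *)

Section SchwartzDecay.
Context {R : realType}.
Let mu := @lebesgue_measure R.
Implicit Types (F : R * R -> R[i]) (b i : bool) (s : seq bool).

Lemma norm2_ge (p : R * R) : `|p.1| <= norm2 p /\ `|p.2| <= norm2 p.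
Proof.
by rewrite /norm2; split; rewrite -sqrtr_sqr ler_wsqrtr // ?lerDl ?lerDr sqr_ge0.
Qed.

Lemma norm2_ge0 (p : R * R) : 0 <= norm2 p. Proof. exact: sqrtr_ge0. Qed.

Lemma norm2_sqr (p : R * R) : norm2 p ^+ 2 = p.1 ^+ 2 + p.2 ^+ 2.
Proof. by rewrite sqr_sqrtr // addr_ge0 // sqr_ge0. Qed.

Lemma schwartz_continuous F b s : schwartz F -> continuous (fun p => cpart b (pderivs s F p)).
Proof. by move=> [h _]; have [[h1 h2] _] := h s; case: b. Qed.

Lemma schwartz_derivable F b i s : schwartz F ->
  forall p, derivable (fun q => cpart b (pderivs s F q)) p (dir i).
Proof. by move=> [h _] p; have [_ /(_ i p) [h1 h2]] := h s; case: b. Qed.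

Lemma schwartz_bound F (m : nat) s : schwartz F -> exists2 B, 0 <= B &
  forall p b, (1 + norm2 p) ^+ m * `|cpart b (pderivs s F p)| <= B.
Proof.
move=> [_ /(_ m s) [B hB]]; exists B.
  by apply: le_trans (hB (0, 0)); rewrite mulr_ge0 ?Cabs_ge0 // exprn_ge0 // addr_ge0 // norm2_ge0.
move=> p b; apply: le_trans (hB p); rewrite ler_wpM2l ?cpart_le //.
by rewrite exprn_ge0 // addr_ge0 // norm2_ge0.
Qed.

(** Each of [1 + z.1 ^ 2] and [1 + z.2 ^ 2] is at most [(1 + norm2 z) ^ 2], hence the exponent 4. *)
Lemma decays2_of_bound (phi : R * R -> R) B :
  (forall p, (1 + norm2 p) ^+ 4 * `|phi p| <= B) -> decays2 phi B.
Proof.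
move=> h z; have := h z; have n0 := norm2_ge0 z; have n2 := norm2_sqr z.
rewrite /lor -invfM; have p1 (x : R) : 0 < 1 + x ^+ 2 by rewrite ltr_wpDr ?sqr_ge0.
rewrite ler_pdivlMr ?mulr_gt0 // => hB; apply: le_trans hB; rewrite mulrC ler_wpM2r //.
have -> : (1 + norm2 z) ^+ 4 = (1 + norm2 z) ^+ 2 * (1 + norm2 z) ^+ 2 by rewrite -exprD.
have e : (1 + norm2 z) ^+ 2 = 1 + 2 * norm2 z + (z.1 ^+ 2 + z.2 ^+ 2) by rewrite -n2; ring.
by apply: ler_pM; rewrite ?(ltW (p1 _)) // e; have := sqr_ge0 z.1; have := sqr_ge0 z.2; lra.
Qed.

Lemma schwartz_decays2 F s : schwartz F -> exists B, forall b,
  decays2 (fun p => cpart b (pderivs s F p)) B.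
Proof. by move=> /(schwartz_bound 4 s) [B _ hB]; exists B => b; exact: decays2_of_bound. Qed.

Lemma integrable_trig (phi : R * R -> R) B (g : R -> R) (x : R * R) : continuous phi ->
  decays2 phi B -> continuous g -> (forall t, `|g t| <= 1) ->
  (mu \x mu)%E.-integrable setT (EFin \o (fun z => phi z * g (z.1 * x.1 + z.2 * x.2))).
Proof.
move=> cphi h cg g1.
have ck : continuous (fun z : R * R => g (z.1 * x.1 + z.2 * x.2)).
  move=> z; apply: (@continuous_comp _ _ _ (fun z : R * R => z.1 * _ + z.2 * _)); last exact: cg.
  by apply: continuousD; apply: continuousM; by [exact: cst_continuous|exact: cvg_fst|exact: cvg_snd].
apply: (@decays2_integrable R _ B); last exact: decays2M.
by apply: measurable_funM; exact: continuous2_measurable.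
Qed.

(** Passing from [x] to [- x] flips the sign of the sine integrals only; the four real equations
    then separate the real part of [F] from its imaginary part. *)
Lemma fourier_vanish F (x : R * R) : schwartz F -> fourier F x = 0 -> fourier F (- x) = 0 ->
  forall b, Rintegral (mu \x mu)%E setT (fun z => cpart b (F z) * cos (z.1 * x.1 + z.2 * x.2)) = 0 /\
            Rintegral (mu \x mu)%E setT (fun z => cpart b (F z) * sin (z.1 * x.1 + z.2 * x.2)) = 0.
Proof.
move=> sF; have [B hB] := schwartz_decays2 [::] sF; rewrite /= in hB.
have cF b : continuous (fun p => cpart b (F p)) by exact: (@schwartz_continuous F b [::] sF).
pose C b y := Rintegral (mu \x mu)%E setT (fun z => cpart b (F z) * cos (z.1 * y.1 + z.2 * y.2)).
pose S b y := Rintegral (mu \x mu)%E setT (fun z => cpart b (F z) * sin (z.1 * y.1 + z.2 * y.2)).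
have iC b y := integrable_trig y (cF b) (hB b) (@continuous_cos R) (@cos_max R).
have iS b y := integrable_trig y (cF b) (hB b) (@continuous_sin R) (@sin_max R).
have CN b : C b (- x) = C b x.
  by apply: eq_Rintegral => z _; congr (_ * _); rewrite /= -cosN; congr cos; ring.
have SN b : S b (- x) = - S b x.
  rewrite /S -[RHS]mulN1r -(RintegralZl (-1) measurableT (iS b x)).
  apply: eq_Rintegral => z _; rewrite mulN1r -mulrN -sinN; congr (_ * sin _); rewrite /=; ring.
have E y : fourier F y = 0 -> C false y + S true y = 0 /\ C true y - S false y = 0.
  rewrite /fourier /Cintegral => -[h1 h2]; split.
    rewrite -[RHS]h1 /C /S -(RintegralD measurableT (iC false y) (iS true y)).
    by apply: eq_Rintegral => z _; case: (F z) => u v /=; ring.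
  rewrite -[RHS]h2 /C /S -(RintegralB measurableT (iC true y) (iS false y)).
  by apply: eq_Rintegral => z _; case: (F z) => u v /=; ring.
move=> /E [a1 a2] /E; rewrite !CN !SN => -[a3 a4] b.
by rewrite -/(C b x) -/(S b x); case: b; split; lra.
Qed.

Lemma kernel_fourier_vanish (w : R -> R) W n i (x y : R) : lp_profile w -> lp_kernels w W ->
  2 * 2 ^ n < `|x| -> fourier (W n) (pt i x y) = 0.
Proof.
move=> [_ _ hs _] /(_ n) [_ ->] h.
suff -> : w (norm2 (pt i x y) / 2 ^ n) = 0 by [].
apply/eqP; apply: contraT => w0.
have : `[2^-1, 2]%classic (norm2 (pt i x y) / 2 ^ n) by apply: hs; exact: subset_closure.
rewrite /= in_itv /= => /andP[_]; rewrite ler_pdivrMr ?exprz_gt0 //.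
have [h1 h2] := norm2_ge (pt i x y).
have : `|x| <= norm2 (pt i x y) by move: h1 h2; rewrite /pt; case: (i).
by move/(lt_le_trans h) => /lt_le_trans /[apply]; rewrite ltxx.
Qed.

Lemma kernel_slice_spectrum (w : R -> R) W n i b : lp_profile w -> lp_kernels w W ->
  forall (xi y : R), 2 * 2 ^ n < xi ->
  Rintegral mu setT (fun t => cpart b (W n (pt i t y)) * cos (t * xi)) = 0 /\
  Rintegral mu setT (fun t => cpart b (W n (pt i t y)) * sin (t * xi)) = 0.
Proof.
move=> hw hW xi y h; have [sW _] := hW n.
have [B hB] := schwartz_decays2 [::] sW; rewrite /= in hB.
have cW : continuous (fun p => cpart b (W n p)) by exact: (@schwartz_continuous (W n) b [::] sW).
apply: (@slice_spectrum R (fun p => cpart b (W n p)) B i (2 * 2 ^ n) xi) => //.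
- exact: continuous2_measurable.
- move=> x' y' hx; apply: fourier_vanish => //; first exact: kernel_fourier_vanish hw hW hx.
  rewrite (_ : - pt i x' y' = pt i (- x') (- y')); last by rewrite /pt; case: (i).
  by apply: kernel_fourier_vanish hw hW _; rewrite normrN.
- by rewrite mulr_ge0 // exprz_ge0.
Qed.

End SchwartzDecay.

(** * Linear relations between point values *)

Section Relations.
Context {R : realType}.
Let mu := @lebesgue_measure R.
Implicit Types (F : R * R -> R[i]) (b d : bool).

(** A relation valid for all exponentials of frequency up to [s] passes to [u]. As the coefficients
    are summable, one finite set, independent of [xi], makes all later partial sums for the
    exponentials uniformly small, which is the hypothesis of the bound for [u]. *)
Lemma relation_of_bound (u : R -> R) (K s : R) (I : choiceType) (c p : I -> R) (q M : R) : 0 <= K ->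
  (forall (r : seq I) tau,
    (forall xi, 0 <= xi <= s ->
      `|\sum_(i <- r) c i * (cos (p i * xi) - cos (q * xi))| <= tau /\
      `|\sum_(i <- r) c i * (sin (p i * xi) - sin (q * xi))| <= tau) ->
    `|\sum_(i <- r) c i * (u (p i) - u q)| <= K * tau) ->
  abs_bounded c M ->
  (forall xi, 0 <= xi <= s -> sums (fun i => c i * (cos (p i * xi) - cos (q * xi))) 0 /\
                             sums (fun i => c i * (sin (p i * xi) - sin (q * xi))) 0) ->
  sums (fun i => c i * (u (p i) - u q)) 0.
Proof.
move=> K0 hK hM hs e e0.
(* A difference of two cosines is at most 2, so this tail of the coefficients gives
   [tau = e / (K + 1)]. *)
have d0 : 0 < e / (2 * (K + 1)) by rewrite divr_gt0 // mulr_gt0 // ltr_wpDl.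
have [A hA] := abs_bounded_tail hM d0; exists A => B AB.
have tail (g : R -> R) xi : (forall x, `|g x| <= 1) -> forall D : {fset I}, [disjoint A & D]%fset ->
    \sum_(i <- D) `|c i * (g (p i * xi) - g (q * xi))| <= e / (K + 1).
  move=> g1 D /hA h; apply: (@le_trans _ _ (\sum_(i <- D) 2 * `|c i|)).
    apply: ler_sum => i _; rewrite normrM mulrC ler_wpM2r //.
    by apply: (le_trans (ler_normB _ _)); have := g1 (p i * xi); have := g1 (q * xi); lra.
  rewrite -mulr_sumr (le_trans (ler_wpM2l _ h)) // le_eqVlt; apply/orP; left; apply/eqP.
  by field; rewrite gt_eqF // ltr_wpDl.
rewrite subr0; apply: le_trans (hK B (e / (K + 1)) _) _.
  move=> xi /hs [h1 h2]; split.
    by have := sums_tail h1 (tail cos xi (@cos_max R)) AB; rewrite subr0.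
  by have := sums_tail h2 (tail sin xi (@sin_max R)) AB; rewrite subr0.
by rewrite mulrA ler_pdivrMr ?ltr_wpDl // mulrC ler_wpM2l ?(ltW e0) // lerDl.
Qed.

Lemma is_derive_line (f : R * R -> R) (p v : R * R) (t : R) : derivable f (p + t *: v) v ->
  is_derive t 1 (fun t => f (p + t *: v)) ('D_v f (p + t *: v)).
Proof.
move=> df.
have E : (fun h : R => h^-1 *: (((fun t => f (p + t *: v)) \o shift t) (h *: 1) - f (p + t *: v))) =
    (fun h : R => h^-1 *: ((f \o shift (p + t *: v)) (h *: v) - f (p + t *: v))).
  apply/funext => h /=; congr (_ *: (f _ - _)).
  by rewrite /shift /= scalerDl [h *: 1]mulr1 addrCA.
by split; rewrite /derivable /derive E.
Qed.

Lemma difference_bound (f : R * R -> R) (v : R * R) (B : R) : (forall p, derivable f p v) ->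
  (forall p, `|'D_v f p| <= B) -> forall p h, `|f (p + h *: v) - f p| <= B * `|h|.
Proof.
move=> df hB.
have pos p h : 0 < h -> `|f (p + h *: v) - f p| <= B * `|h|.
  move=> h0; have [|c _] := @MVT R (fun t => f (p + t *: v)) (fun t => 'D_v f (p + t *: v)) 0 h h0 (fun t _ => is_derive_line (df _)).
    by apply: derivable_within_continuous => x _; apply: ex_derive; exact: is_derive_line.
  rewrite scale0r addr0 subr0 => ->.
  by rewrite normrM ler_wpM2r.
move=> p h; have [h0|h0|->] := ltgtP h 0; last by rewrite scale0r addr0 subrr normr0 mulr0.
  have := pos (p + h *: v) (- h); rewrite oppr_gt0 scaleNr addrK distrC normrN; exact.
exact: pos.
Qed.

Lemma pderiv_cpart b d F p : cpart b (pderiv d F p) = 'D_(dir d) (fun q => cpart b (F q)) p.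
Proof. by case: b. Qed.

(* Differentiate the relation under the sum, by Tannery's theorem. *)
Lemma relation_derivs F (I : choiceType) (c : I -> R) (p : I -> R * R) (q : R * R) (M : R) :
  schwartz F -> abs_bounded c M ->
  (forall b z, sums (fun i => c i * (cpart b (F (p i + z)) - cpart b (F (q + z)))) 0) ->
  forall s b z, sums (fun i => c i * (cpart b (pderivs s F (p i + z)) - cpart b (pderivs s F (q + z)))) 0.
Proof.
move=> sF hM h; elim=> [|d s IH] b z; first exact: h.
have [B B0 hB] := schwartz_bound 0 (d :: s) sF.
pose G := fun x => cpart b (pderivs s F x); pose G' := fun x => cpart b (pderivs (d :: s) F x).
have G'B x : `|G' x| <= B by have := hB x b; rewrite expr0 mul1r.
have dG x : derivable G x (dir d) by exact: schwartz_derivable.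
have G'E x : G' x = 'D_(dir d) G x by rewrite /G' /= pderiv_cpart.
have GB x t : `|G (x + t *: dir d) - G x| <= B * `|t|.
  by apply: difference_bound => // y; rewrite -G'E.
(* Difference quotients of the relation in [z]; by the mean value theorem they are bounded by
   [2 B |c i|] uniformly in [t]. *)
pose u (t : R) i := c i * ((t^-1 * (G (p i + z + t *: dir d) - G (p i + z))) -
                    (t^-1 * (G (q + z + t *: dir d) - G (q + z)))).
have ub (t : R) i : t != 0 -> `|u t i| <= 2 * B * `|c i|.
  move=> t0; rewrite normrM mulrC ler_wpM2r //.
  have k x : `|t^-1 * (G (x + t *: dir d) - G x)| <= B.
    by rewrite normrM normfV mulrC ler_pdivrMr ?normr_gt0.
  by apply: (le_trans (ler_normB _ _)); have := k (p i + z); have := k (q + z); lra.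
have hM2 : abs_bounded (fun i => 2 * B * `|c i|) (`|2 * B| * M).
  by apply: abs_boundedZ; apply: abs_bounded_le hM => i; rewrite normr_id.
have [|l hl] := @sums_exist R I (fun i => c i * (G' (p i + z) - G' (q + z))) (`|2 * B| * M).
  apply: abs_bounded_le hM2 => i; rewrite normrM [leRHS]ger0_norm ?mulr_ge0 // mulrC ler_wpM2r //.
  by apply: (le_trans (ler_normB _ _)); have := G'B (p i + z); have := G'B (q + z); lra.
suff -> : 0 = l :> R by [].
have cv : (fun _ : R => 0 : R) @ 0^' --> l.
  apply: (@tannery R I R (0^') _ u (fun i => c i * (G' (p i + z) - G' (q + z)))
    (fun i => 2 * B * `|c i|) _ l (`|2 * B| * M)) => //.
  - move=> i; apply: cvgM; first exact: cvg_cst.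
    have k x : t^-1 * (G (x + t *: dir d) - G x) @[t --> 0^'] --> G' x.
      rewrite G'E; have := dG x; rewrite /derivable => /cvg_ex[m hm].
      have mE : 'D_(dir d) G x = m by exact: cvg_lim hm.
      rewrite mE; apply: cvg_trans hm; apply: near_eq_cvg; near=> t.
      by rewrite /= /shift /= [t *: dir d + x]addrC.
    by apply: cvgB; exact: k.
  - near=> t => i; apply: ub; near: t; exact: nbhs_dnbhs_neq.
  - near=> t.
    have h1 := sumsB (IH b (z + t *: dir d)) (IH b z).
    have := sumsZ (t^-1) h1; rewrite subr0 mulr0; apply: eq_sums => i.
    rewrite /u /G !addrA; ring.
by rewrite -(cvg_lim _ cv) //; apply/esym/lim_cst.
Unshelve. all: by end_near. Qed.

End Relations.

(** * Translates of Schwartz functions and relations under a tempered distribution *)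

Section SchwartzSpace.
Context {R : realType}.
Implicit Types (F G : R * R -> R[i]) (b d : bool) (s : seq bool) (p q x y z : R * R).

Lemma cpart_eq (u v : R[i]) : (forall b, cpart b u = cpart b v) -> u = v.
Proof. by move=> h; have := h false; have := h true; case: u v {h} => [? ?] [? ?] /= -> ->. Qed.

Lemma schwartzP F : schwartz F <->
  [/\ forall b s, continuous (fun p => cpart b (pderivs s F p)),
      forall b s d p, derivable (fun q => cpart b (pderivs s F q)) p (dir d) &
      forall (m : nat) s b, exists B, forall p, (1 + norm2 p) ^+ m * `|cpart b (pderivs s F p)| <= B].
Proof.
split=> [h|[h1 h2 h3]].
  split; [by move=> b s; exact: schwartz_continuous|by move=> *; exact: schwartz_derivable|].
  by move=> m s b; have [B _ hB] := schwartz_bound m s h; exists B => p; exact: hB.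
split.
  by move=> s; split; [split; [exact: (h1 false)|exact: (h1 true)]|move=> d p; split; [exact: (h2 false)|exact: (h2 true)]].
move=> m s; have [B1 H1] := h3 m s false; have [B2 H2] := h3 m s true.
exists (B1 + B2) => p; apply: le_trans (lerD (H1 p) (H2 p)); rewrite -mulrDr ler_wpM2l ?Cabs_le //.
by rewrite exprn_ge0 // addr_ge0 // norm2_ge0.
Qed.

Lemma derive_comp_sub (f : R * R -> R) x p (v : R * R) : derivable f (x - p) v ->
  derivable (fun q => f (x - q)) p v /\ 'D_v (fun q => f (x - q)) p = - 'D_v f (x - p).
Proof.
move=> df.
have : h^-1 *: (f (h *: v + (x - p)) - f (x - p)) @[h --> 0^'] --> 'D_v f (x - p) by exact: df.
move/cvgN => h1.
have cv : h^-1 *: (f (x - (h *: v + p)) - f (x - p)) @[h --> 0^'] --> - 'D_v f (x - p).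
  have -> : (fun h : R => h^-1 *: (f (x - (h *: v + p)) - f (x - p))) =
     (fun h : R => - (h^-1 *: (f (h *: v + (x - p)) - f (x - p)))) \o -%R.
    apply/funext => h /=; rewrite -scaleNr -invrN opprK; congr (_ *: (f _ - _)).
    by rewrite scaleNr opprD addrCA.
  apply: cvg_comp h1 => /=.
  move=> S [e /= e0 hS]; exists e => //= h; rewrite /= sub0r normrN => he h0.
  by apply: hS; rewrite /= ?oppr_eq0 // sub0r opprK.
split; last by apply: cvg_lim => //; exact: cv.
by apply/cvg_ex; exists (- 'D_v f (x - p)); exact: cv.
Qed.

Lemma pderivs_refl F x s : schwartz F ->
  forall b y, cpart b (pderivs s (fun y => F (x - y)) y) = (-1) ^+ size s * cpart b (pderivs s F (x - y)).
Proof.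
move=> sF; elim: s => [|d s IH] b y; first by rewrite mul1r.
rewrite /= !pderiv_cpart.
have -> : (fun q => cpart b (pderivs s (fun y => F (x - y)) q)) =
   (-1) ^+ size s *: (fun q => cpart b (pderivs s F (x - q))).
  by apply/funext => q; rewrite IH.
have [h1 h2] := derive_comp_sub (@schwartz_derivable R F b d s sF (x - y)).
by rewrite (deriveZ _ h1) h2 exprS mulN1r scalerN mulNr.
Qed.

Lemma norm2_triangle p q : norm2 (p + q) <= norm2 p + norm2 q.
Proof.
have hp := norm2_ge0 p; have hq := norm2_ge0 q.
rewrite -(@ler_pXn2r _ 2) ?nnegrE ?addr_ge0 ?norm2_ge0 //.
rewrite sqrrD !norm2_sqr /=.
have : p.1 * q.1 + p.2 * q.2 <= norm2 p * norm2 q.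
  apply: le_trans (ler_norm _) _.
  rewrite -(@ler_pXn2r _ 2) ?nnegrE ?mulr_ge0 // real_normK ?num_real // exprMn !norm2_sqr.
  by have := sqr_ge0 (p.1 * q.2 - p.2 * q.1); nra.
rewrite -mulr_natr; nra.
Qed.

Lemma norm2N p : norm2 (- p) = norm2 p.
Proof. by rewrite /norm2 /= !sqrrN. Qed.

(** Peetre's inequality: a weight at [y] is traded for one at the translation [x] and one at the
    argument [x - y]. *)
Lemma weight_shift x y (m : nat) : (1 + norm2 y) ^+ m <= (1 + norm2 x) ^+ m * (1 + norm2 (x - y)) ^+ m.
Proof.
rewrite -exprMn; apply: lerXn2r; rewrite ?nnegrE ?mulr_ge0 ?addr_ge0 ?norm2_ge0 //.
have := norm2_triangle x (- (x - y)); rewrite norm2N opprB addrCA subrr addr0.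
by have := norm2_ge0 x; have := norm2_ge0 (x - y); nra.
Qed.

Lemma schwartz_refl F x : schwartz F -> schwartz (fun y => F (x - y)).
Proof.
move=> sF; apply/schwartzP; split.
- move=> b s.
  have -> : (fun p => cpart b (pderivs s (fun y => F (x - y)) p)) =
      (fun p => (-1) ^+ size s * cpart b (pderivs s F (x - p))).
    by apply/funext => p; rewrite pderivs_refl.
  move=> y; apply: cvgM; first exact: cvg_cst.
  apply: (@continuous_comp _ _ _ (fun y => x - y) (fun y => cpart b (pderivs s F y))).
    by apply: cvgB; [exact: cvg_cst|exact: cvg_id].
  exact: schwartz_continuous.
- move=> b s d p.
  have -> : (fun p => cpart b (pderivs s (fun y => F (x - y)) p)) =
      (-1) ^+ size s *: (fun p => cpart b (pderivs s F (x - p))).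
    by apply/funext => q; rewrite pderivs_refl.
  by apply: derivableZ; have [] := derive_comp_sub (@schwartz_derivable R F b d s sF (x - p)).
- move=> m s b; have [B B0 hB] := schwartz_bound m s sF.
  exists ((1 + norm2 x) ^+ m * B) => p.
  rewrite pderivs_refl // normrM normrX normrN normr1 expr1n mul1r.
  apply: (le_trans (ler_wpM2r _ (weight_shift x p m))) => //.
  by rewrite -mulrA ler_wpM2l ?hB // exprn_ge0 // addr_ge0 // norm2_ge0.
Qed.

Lemma pderivs_lin (a : R) F G s : schwartz F -> schwartz G ->
  forall b y, cpart b (pderivs s (fun y => a%:C * F y + G y) y) =
    a * cpart b (pderivs s F y) + cpart b (pderivs s G y).
Proof.
move=> sF sG; elim: s => [|d s IH] b y.
  by rewrite /=; case: (F y) (G y) => [u v] [u' v']; case: b; rewrite /cpart /=; ring.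
rewrite /= !pderiv_cpart.
have -> : (fun q => cpart b (pderivs s (fun y => a%:C * F y + G y) q)) =
   a *: (fun q => cpart b (pderivs s F q)) + (fun q => cpart b (pderivs s G q)).
  by apply/funext => q; rewrite IH.
have hF := @schwartz_derivable R F b d s sF y; have hG := @schwartz_derivable R G b d s sG y.
have hZ : derivable (a *: (fun q => cpart b (pderivs s F q))) y (dir d) by exact: derivableZ.
by rewrite (deriveD hZ hG) (deriveZ _ hF).
Qed.

Lemma schwartz_lin (a : R) F G : schwartz F -> schwartz G -> schwartz (fun y => a%:C * F y + G y).
Proof.
move=> sF sG; apply/schwartzP; split.
- move=> b s.
  have -> : (fun p => cpart b (pderivs s (fun y => a%:C * F y + G y) p)) =
      (fun p => a * cpart b (pderivs s F p) + cpart b (pderivs s G p)).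
    by apply/funext => p; rewrite pderivs_lin.
  move=> y; apply: cvgD; last exact: (@schwartz_continuous R G b s sG).
  by apply: cvgM; [exact: cvg_cst|exact: (@schwartz_continuous R F b s sF)].
- move=> b s d p.
  have -> : (fun p => cpart b (pderivs s (fun y => a%:C * F y + G y) p)) =
      a *: (fun p => cpart b (pderivs s F p)) + (fun p => cpart b (pderivs s G p)).
    by apply/funext => q; rewrite pderivs_lin.
  have hZ : derivable (a *: (fun q => cpart b (pderivs s F q))) p (dir d).
    by apply: derivableZ; exact: schwartz_derivable.
  exact: (derivableD hZ (@schwartz_derivable R G b d s sG p)).
- move=> m s b; have [B B0 hB] := schwartz_bound m s sF; have [B' B'0 hB'] := schwartz_bound m s sG.
  exists (`|a| * B + B') => p; rewrite pderivs_lin //.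
  have w0 : 0 <= (1 + norm2 p) ^+ m by rewrite exprn_ge0 // addr_ge0 // norm2_ge0.
  apply: (le_trans (ler_wpM2l w0 (ler_normD _ _))).
  rewrite mulrDr lerD ?hB' // normrM mulrCA ler_wpM2l ?hB //.
Qed.

(* [tempered] with the number [N] of seminorms and the constant [MT] made explicit. *)
Definition tempered_order (T : (R * R -> R[i]) -> R[i]) (N : nat) (MT : R) :=
  (forall (a : R[i]) phi psi, schwartz phi -> schwartz psi ->
     T (fun p => a * phi p + psi p) = a * T phi + T psi) /\
  (forall phi, schwartz phi -> forall B : R,
     (forall (a : nat) (s : seq bool), (a <= N)%N -> (size s <= N)%N ->
        forall p, (1 + norm2 p) ^+ a * Cabs (pderivs s phi p) <= B) ->
     Cabs (T phi) <= MT * B).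

Section TemperedRelation.
Variables (T : (R * R -> R[i]) -> R[i]) (N : nat) (MT : R) (F : R * R -> R[i]).
Hypotheses (tT : tempered_order T N MT) (sF : schwartz F).

Let g := dist_conv T F.

Lemma tempered_lin (a : R) G H : schwartz G -> schwartz H ->
  T (fun y => a%:C * G y + H y) = a%:C * T G + T H.
Proof. by move=> sG sH; have [h _] := tT; exact: h. Qed.

Lemma schwartz0 : schwartz (fun _ : R * R => 0 : R[i]).
Proof.
have := schwartz_lin (-1) sF sF; congr schwartz; apply/funext => y.
by case: (F y) => u v; apply: cpart_eq => b; case: b; rewrite /cpart /=; ring.
Qed.

Lemma tempered0 : T (fun=> 0) = 0.
Proof.
have := tempered_lin 1 schwartz0 schwartz0.
rewrite (_ : (fun _ => _) = fun=> 0); last by apply/funext => y; rewrite mulr0 addr0.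
by rewrite mul1r => /eqP; rewrite -subr_eq subrr eq_sym => /eqP.
Qed.

(** The test function that [T] sends to a finite partial sum of the relation for [g]. *)
Definition comb (I : Type) (r : seq I) (c : I -> R) (p : I -> R * R) q y : R[i] :=
  \sum_(i <- r) (c i)%:C * (F (p i - y) - F (q - y)).

Lemma comb_spec (I : Type) (r : seq I) (c : I -> R) (p : I -> R * R) q :
  [/\ schwartz (comb r c p q),
      T (comb r c p q) = \sum_(i <- r) (c i)%:C * (g (p i) - g q) &
      forall s b y, cpart b (pderivs s (comb r c p q) y) = (-1) ^+ size s *
        \sum_(i <- r) c i * (cpart b (pderivs s F (p i - y)) - cpart b (pderivs s F (q - y)))].
Proof.
elim: r => [|i r [IH1 IH2 IH3]].
  have E : comb [::] c p q = fun=> 0 by apply/funext => y; rewrite /comb big_nil.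
  rewrite E big_nil tempered0; split => //; first exact: schwartz0.
  move=> s b y; rewrite big_nil mulr0.
  have := pderivs_lin 1 s schwartz0 schwartz0 b y.
  rewrite (_ : (fun _ => _) = fun=> 0); last by apply/funext => z; rewrite mulr0 addr0.
  by rewrite mul1r => /eqP; rewrite -subr_eq subrr eq_sym => /eqP.
pose A := fun y => (-1)%:C * F (q - y) + F (p i - y).
have sA : schwartz A by apply: schwartz_lin; exact: schwartz_refl.
have E : comb (i :: r) c p q = fun y => (c i)%:C * A y + comb r c p q y.
  apply/funext => y; rewrite /comb big_cons /A; congr (_ * _ + _).
  by rewrite rmorphN1 mulN1r addrC.
rewrite E; split; first exact: schwartz_lin.
  rewrite tempered_lin // IH2 big_cons; congr (_ * _ + _).
  rewrite tempered_lin; try exact: schwartz_refl.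
  by rewrite rmorphN1 mulN1r addrC.
move=> s b y; rewrite pderivs_lin // IH3 big_cons mulrDr; congr (_ + _).
rewrite pderivs_lin; try exact: schwartz_refl.
by rewrite !pderivs_refl //; ring.
Qed.

(** Only finitely many derivatives have order at most [m]; induction on the first letter of the word
    replaces taking a maximum. *)
Lemma uniform_seq_bound (P : seq bool -> R -> Prop) (m : nat) :
  (forall s B B', P s B -> B <= B' -> P s B') -> (forall s, exists B, P s B) ->
  exists2 B, 0 <= B & forall s, (size s <= m)%N -> P s B.
Proof.
elim: m P => [|m IH] P mP eP.
  have [B hB] := eP [::]; exists `|B| => // -[|//] _.
  by apply: mP hB _; exact: ler_norm.
have [B1 B10 h1] := IH (fun s => P (true :: s)) (fun s => mP (true :: s)) (fun s => eP (true :: s)).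
have [B2 B20 h2] := IH (fun s => P (false :: s)) (fun s => mP (false :: s)) (fun s => eP (false :: s)).
have [B3 h3] := eP [::].
exists (B1 + B2 + `|B3|); first by rewrite !addr_ge0.
move=> [|[] s] hs.
- by apply: mP h3 _; have := ler_norm B3; lra.
- by apply: mP (h1 s hs) _; have := normr_ge0 B3; lra.
- by apply: mP (h2 s hs) _; have := normr_ge0 B3; lra.
Qed.

(** It suffices that the seminorms of order [N] of [comb] be small. At each point the relation for
    the derivatives bounds them by a tail of the series, and Peetre's inequality makes this tail
    uniform in [y] at the price of the weights [(1 + norm2 (p i)) ^ N]. *)
Lemma tempered_relation (I : choiceType) (c : I -> R) (p : I -> R * R) q M :
    abs_bounded (fun i => c i * (1 + norm2 (p i)) ^+ N) M ->
    (forall s b y, sums (fun i => c i * (cpart b (pderivs s F (p i - y)) - cpart b (pderivs s F (q - y)))) 0) ->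
    forall b, sums (fun i => c i * (cpart b (g (p i)) - cpart b (g q))) 0.
Proof.
have [_ hT] := tT; move=> hM hs b e e0.
have [] := @uniform_seq_bound (fun s B => forall x b, (1 + norm2 x) ^+ N * `|cpart b (pderivs s F x)| <= B) N.
- by move=> s B B' h BB' x b'; apply: le_trans BB'.
- by move=> s; have [B _ hB] := schwartz_bound N s sF; exists B => x b'; exact: hB.
move=> K K0 hK.
pose Q := (1 + norm2 q) ^+ N.
have Q0 : 0 <= Q by rewrite exprn_ge0 // addr_ge0 // norm2_ge0.
have D0 : 0 < 2 * (`|MT| + 1) * (K * (1 + Q) + 1).
  by rewrite !mulr_gt0 // ltr_wpDl // mulr_ge0 // addr_ge0.
(* A tail [d] of the weighted coefficients keeps the parts of each seminorm below
   [eta = e / (2 (|MT| + 1))], and twice [eta] times [|MT| + 1] is [e]. *)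
pose d := e / (2 * (`|MT| + 1) * (K * (1 + Q) + 1)).
have d0 : 0 < d by rewrite divr_gt0.
have [A hA] := abs_bounded_tail hM d0; exists A => B AB.
pose eta := e / (2 * (`|MT| + 1)).
have [sC TC dC] := comb_spec B c p q.
have wp (x : R * R) : 1 <= 1 + norm2 x by rewrite lerDl norm2_ge0.
have seminorm (a : nat) s y b' : (a <= N)%N -> (size s <= N)%N ->
    (1 + norm2 y) ^+ a * `|cpart b' (pderivs s (comb B c p q) y)| <= eta.
  move=> aN sN; rewrite dC normrM normrX normrN normr1 expr1n mul1r.
  have w0 : 0 <= (1 + norm2 y) ^+ N by rewrite exprn_ge0 // addr_ge0 // norm2_ge0.
  apply: (@le_trans _ _ ((1 + norm2 y) ^+ N *
    `|\sum_(i <- B) c i * (cpart b' (pderivs s F (p i - y)) - cpart b' (pderivs s F (q - y)))|)).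
    by rewrite ler_wpM2r // ler_weXn2l.
  have := sumsZ ((1 + norm2 y) ^+ N) (hs s b' y); rewrite mulr0 => h.
  have := @sums_tail R I _ _ A eta h _ B AB; rewrite -mulr_sumr subr0 normrM (ger0_norm w0); apply.
  move=> D /hA hD; apply: (@le_trans _ _ (\sum_(i <- D) K * (1 + Q) * `|c i * (1 + norm2 (p i)) ^+ N|)).
    apply: ler_sum => i _.
    have P1 : 1 <= (1 + norm2 (p i)) ^+ N by rewrite exprn_ege1.
    have kx x : (1 + norm2 y) ^+ N * `|cpart b' (pderivs s F (x - y))| <= K * (1 + norm2 x) ^+ N.
      apply: (le_trans (ler_wpM2r _ (weight_shift x y N))) => //.
      by rewrite -mulrA mulrC ler_wpM2r ?hK // exprn_ge0 // addr_ge0 // norm2_ge0.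
    rewrite !normrM (ger0_norm w0) (ger0_norm (le_trans ler01 P1)) mulrCA [leRHS]mulrCA ler_wpM2l //.
    apply: (le_trans (ler_wpM2l w0 (ler_normB _ _))); rewrite mulrDr.
    have := kx (p i); have := kx q; rewrite -/Q.
    have : K * Q * 1 <= K * Q * (1 + norm2 (p i)) ^+ N by rewrite ler_wpM2l // mulr_ge0.
    move: ((1 + norm2 (p i)) ^+ N) => P; lra.
  rewrite -mulr_sumr; have KQ : 0 <= K * (1 + Q) by rewrite mulr_ge0 // addr_ge0.
  apply: (le_trans (ler_wpM2l KQ hD)); rewrite /d /eta.
  have m0 : 0 < 2 * (`|MT| + 1) by rewrite mulr_gt0 // ltr_wpDl.
  have k0 : 0 < K * (1 + Q) + 1 by rewrite ltr_wpDl.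
  have E (X m u : R) : 0 < m -> 0 < X + 1 -> X * (u / (m * (X + 1))) = u / m * (X / (X + 1)).
    by move=> M0 X0; field; rewrite (gt_eqF M0) (gt_eqF X0).
  rewrite E //; apply: ler_piMr; first by rewrite divr_ge0 // ltW.
  by rewrite ler_pdivrMr // mul1r lerDl.
have TB : Cabs (T (comb B c p q)) <= MT * (eta + eta).
  apply: hT => // a s aN sN y.
  have w0 : 0 <= (1 + norm2 y) ^+ a by rewrite exprn_ge0 // addr_ge0 // norm2_ge0.
  by apply: (le_trans (ler_wpM2l w0 (Cabs_le _))); rewrite mulrDr lerD // seminorm.
rewrite subr0; have -> : \sum_(i <- B) c i * (cpart b (g (p i)) - cpart b (g q)) = cpart b (T (comb B c p q)).
  rewrite TC; elim: (B : seq I) => [|i r IH]; first by rewrite !big_nil; case: b.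
  rewrite !big_cons IH; case: (g (p i)) (g q) (\sum_(j <- r) _ * _) => [u v] [u' v'] [u'' v''].
  by case: b {IH}; rewrite /cpart /=; ring.
apply: (le_trans (cpart_le _ _)); apply: (le_trans TB).
have eta0 : 0 <= eta by rewrite divr_ge0 ?mulr_ge0 ?ltW // addr_ge0.
apply: (@le_trans _ _ ((`|MT| + 1) * (eta + eta))).
  by rewrite ler_wpM2r ?addr_ge0 //; have := ler_norm MT; lra.
rewrite le_eqVlt; apply/orP; left; apply/eqP; rewrite /eta; field.
by rewrite gt_eqF // ltr_wpDl.
Qed.

End TemperedRelation.

End SchwartzSpace.

(** * Sampling of divided differences of a dyadic block *)

Section BandDividedDifference.
Context {R : realType}.
Let mu := @lebesgue_measure R.
Implicit Types (b i : bool).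

(** In [option int] the samples are indexed by [Some j] and the evaluation point by [None], so that
    a sampling formula becomes a single relation with sum 0. *)
Lemma sums_option (u : option int -> R) (l : R) : sums (fun j : int => u (Some j)) l ->
  sums u (l + u None).
Proof.
move=> h e /h [A hA]; pose S (B : {fset int}) : {fset (option int)} := [fset Some j | j in B]%fset.
exists (None |` S A)%fset => B AB.
pose B' : {fset int} := [fset j | j in pmap id B]%fset.
have memB' j : (j \in B') = (Some j \in B).
  rewrite !inE; apply/idP/idP.
    by rewrite mem_pmap => /mapP[[k|] kB //= [->]].
  by move=> jB; rewrite mem_pmap; apply/mapP; exists (Some j).
have -> : \sum_(i <- B) u i = u None + \sum_(j <- B') u (Some j).
  rewrite -(big_map Some xpredT u) -[RHS](big_cons _ _ _ _ xpredT).
  apply: perm_big; apply: uniq_perm => //.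
    rewrite /= map_inj_uniq ?fset_uniq ?andbT; last by move=> ? ? [].
    by apply/mapP => -[].
  move=> [j|]; rewrite inE /=.
    by rewrite mem_map ?memB' // => ? ? [].
  by rewrite (fsubsetP AB) // !inE eqxx.
rewrite [u None + _]addrC opprD addrACA subrr addr0; apply: hA; apply/fsubsetP => j jA.
by rewrite memB'; apply: (fsubsetP AB); rewrite !inE in_imfset // orbT.
Qed.

Lemma sums_optionE (u : option int -> R) (l : R) : sums u l ->
  sums (fun j : int => u (Some j)) (l - u None).
Proof.
move=> h e /h [A hA].
exists [fset j | j in pmap id A]%fset => B AB.
pose S : {fset (option int)} := (None |` [fset Some j | j in B])%fset.
have -> : \sum_(j <- B) u (Some j) = \sum_(i <- S) u i - u None.
  have -> : \sum_(i <- S) u i = \sum_(i <- None :: map Some B) u i.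
    apply: perm_big; apply: uniq_perm => //.
      rewrite /= map_inj_uniq ?fset_uniq ?andbT; last by move=> ? ? [].
      by apply/mapP => -[].
    move=> [j|]; rewrite !inE //=.
    rewrite mem_map; last by move=> ? ? [].
    by apply/imfsetP/idP => [[k /= kB [->]] //|jB]; exists j.
  by rewrite big_cons big_map addrAC subrr add0r.
rewrite opprB addrA subrK; apply: hA; apply/fsubsetP => -[j|] jA; rewrite !inE //=.
apply/imfsetP; exists j => //=; apply: (fsubsetP AB); rewrite !inE.
by rewrite mem_pmap; apply/mapP; exists (Some j).
Qed.

Lemma dist_int_gt0 (c : R) : (forall j : int, j%:~R != c) -> exists2 e, 0 < e &
  forall j : int, e <= `|j%:~R - c|.
Proof.
move=> jc; pose z := Num.floor c.
have z1 : z%:~R < c by rewrite lt_neqAle jc ge_floor.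
have z2 : c < z%:~R + 1 by have := floorD1_gt c; rewrite intrD.
exists (Num.min (c - z%:~R) (z%:~R + 1 - c)); first by rewrite lt_min !subr_gt0 z1 z2.
move=> j; have [jz|jz] := lerP j z.
  have h : j%:~R <= z%:~R :> R by rewrite ler_int.
  by rewrite ge_min distrC; apply/orP; left; apply: le_trans (ler_norm _); rewrite lerB.
have h : z%:~R + 1 <= j%:~R :> R by rewrite -[1]/(1%:~R) -intrD ler_int; lia.
by rewrite ge_min; apply/orP; right; apply: le_trans (ler_norm _); rewrite lerB.
Qed.

Section Band.
Variables (w : R -> R) (W : int -> R * R -> R[i]) (n : int) (T : (R * R -> R[i]) -> R[i]) (N : nat) (MT : R).
Hypotheses (hw : lp_profile w) (hW : lp_kernels w W) (tT : tempered_order T N MT).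

Let sW : schwartz (W n). Proof. by have [] := hW n. Qed.

Let g := dist_conv T (W n).

Lemma pt_shift i (x : R) (z : R * R) : pt i x 0 + z = pt i (x + (if i then z.2 else z.1)) (if i then z.1 else z.2).
Proof. by case: z => u v; rewrite /pt; case: i; congr (_, _) => /=; rewrite add0r. Qed.

(* The relation holds for the exponentials of frequency at most [2 * 2 ^ n], hence
   for [W n] and its derivatives, hence for [g]. *)
Lemma band_divdiff i b (y d t c th : R) :
  0 < d -> d * (2 * 2 ^ n) <= 1 -> t != c -> (forall j : int, j%:~R != c) ->
  let G (x : R) := cpart b (g (pt i x y)) in
  sums (fun j : int => skernel N.+2 (t - j%:~R) *
         ((G (d * (j%:~R + th)) - G (d * (c + th))) / (j%:~R - c)))
    ((G (d * (t + th)) - G (d * (c + th))) / (t - c)).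
Proof.
(* [N.+2] exceeds both [N], for the weights in [tempered_relation], and 1, as [sampling_divdiff]
   demands even when [N = 0]. *)
move=> d0 dn tc jc G; pose L := N.+2.
have s0 : 0 < 2 * 2 ^ n :> R by rewrite mulr_gt0 // exprz_gt0.
(* Coefficients of the sampling formula with everything moved to one side; [Q] is the common
   reference point of the differences. *)
pose C (o : option int) : R := if o is Some j then - (skernel L (t - j%:~R) / (j%:~R - c)) else (t - c)^-1.
pose p (o : option int) : R := if o is Some j then j%:~R else t.
pose P o := pt i (d * (p o + th)) 0; pose Q := pt i (d * (c + th)) 0.
have [dc dc0 hdc] := dist_int_gt0 jc.
have [M hM] := @kernel_moment R L N t c (leqnSn _).
pose Y := 1 + norm2 (pt i 0 y) + d * (`|c| + `|th|) + d.
have Y0 : 0 <= Y by rewrite !addr_ge0 ?norm2_ge0 // ?mulr_ge0 ?addr_ge0 // ltW.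
have wP o : 1 + norm2 (P o + pt i 0 y) <= Y * (1 + `|p o - c|).
  have h1 := norm2_triangle (P o) (pt i 0 y).
  have h2 : norm2 (P o) = `|d * (p o + th)|.
    by rewrite /norm2 /P /pt; case: (i) => /=; rewrite expr0n /= ?addr0 ?add0r sqrtr_sqr.
  have h3 : `|d * (p o + th)| <= d * (`|p o - c| + `|c| + `|th|).
    rewrite normrM (gtr0_norm d0) ler_wpM2l ?(ltW d0) //.
    apply: (le_trans (ler_normD _ _)); rewrite lerD2r.
    by have := ler_normD (p o - c) c; rewrite subrK.
  have := norm2_ge0 (pt i 0 y); have := normr_ge0 (p o - c).
  have : 0 <= d * (`|c| + `|th|) by rewrite mulr_ge0 ?addr_ge0 // ltW.
  move: h1 h3; rewrite h2 /Y.
  have E (u v e f D A : R) : 0 <= D -> f <= v + e -> v <= D * u + A -> 0 <= A -> 0 <= u -> 0 <= e ->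
      1 + f <= (1 + e + A + D) * (1 + u).
    move=> ? ? ? ? u0 ?; have : 0 <= e * u by exact: mulr_ge0.
    by have : 0 <= A * u by [exact: mulr_ge0]; lra.
  move=> k1 k2 k3 k4 k5; apply: E k1 _ _ _ _ => //; first exact: ltW.
  by apply: le_trans k2 _; rewrite -addrA mulrDr.
have hC : exists M', abs_bounded (fun o => C o * (1 + norm2 (P o + pt i 0 y)) ^+ N) M'.
  pose v (j : int) := Y ^+ N / dc * (skernel L (t - j%:~R) * (1 + `|j%:~R - c|) ^+ N).
  have hv := abs_boundedZ (Y ^+ N / dc) hM.
  exists (`|C None * (1 + norm2 (P None + pt i 0 y)) ^+ N| + `|Y ^+ N / dc| * M) => A.
  have split_A : \sum_(o <- A) `|C o * (1 + norm2 (P o + pt i 0 y)) ^+ N| <=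
     \sum_(o <- None :: map Some [fset j | j in pmap id A]%fset) `|C o * (1 + norm2 (P o + pt i 0 y)) ^+ N|.
    apply: ler_sum_uniq => // -[j|] jA; rewrite inE //=.
    by apply/mapP; exists j => //; rewrite !inE mem_pmap; apply/mapP; exists (Some j).
  apply: (le_trans split_A); rewrite big_cons big_map lerD2l.
  apply: le_trans (hv _); apply: ler_sum => j _.
  have k0 : 0 <= Y ^+ N / dc by rewrite divr_ge0 ?exprn_ge0 // ltW.
  have w0 : 0 <= (1 + norm2 (P (Some j) + pt i 0 y)) ^+ N.
    by rewrite exprn_ge0 // addr_ge0 // norm2_ge0.
  have u0 : 0 <= (1 + `|j%:~R - c|) ^+ N by rewrite exprn_ge0 // addr_ge0.
  have -> : `|C (Some j) * (1 + norm2 (P (Some j) + pt i 0 y)) ^+ N| =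
      `|skernel L (t - j%:~R)| / `|j%:~R - c| * (1 + norm2 (P (Some j) + pt i 0 y)) ^+ N.
    by rewrite normrM (ger0_norm w0) normrN normrM normfV.
  have -> : `|Y ^+ N / dc * (skernel L (t - j%:~R) * (1 + `|j%:~R - c|) ^+ N)| =
      Y ^+ N / dc * (`|skernel L (t - j%:~R)| * (1 + `|j%:~R - c|) ^+ N).
    by rewrite normrM (ger0_norm k0) normrM (ger0_norm u0).
  have h1 : (1 + norm2 (P (Some j) + pt i 0 y)) ^+ N <= Y ^+ N * (1 + `|j%:~R - c|) ^+ N.
    rewrite -exprMn; apply: lerXn2r (wP (Some j)); rewrite nnegrE; first by rewrite addr_ge0 // norm2_ge0.
    by apply: mulr_ge0 => //; rewrite addr_ge0.
  have h2 : `|j%:~R - c|^-1 <= dc^-1 by rewrite lef_pV2 ?posrE ?hdc // (lt_le_trans dc0).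
  rewrite -mulrA [leRHS](_ : _ = `|skernel L (t - j%:~R)| * (dc^-1 * (Y ^+ N * (1 + `|j%:~R - c|) ^+ N))); last by ring.
  by rewrite ler_wpM2l // ler_pM // invr_ge0.
have [M1 hM1] := hC.
have hC1 : abs_bounded C M1.
  apply: abs_bounded_le hM1 => o; rewrite normrM ler_peMr //.
  by rewrite ger0_norm ?exprn_ge0 ?addr_ge0 ?norm2_ge0 // exprn_ege1 // lerDl norm2_ge0.
have expo xi a : `|xi| <= 1 -> sums (fun o => C o * (cos (p o * xi + a) - cos (c * xi + a))) 0.
  move=> xi1; have := @sampling_divdiff R L t c xi a isT xi1 tc jc.
  move/(sumsZ (-1)) => h.
  have := @sums_option (fun o => C o * (cos (p o * xi + a) - cos (c * xi + a)))
    (-1 * ((cos (t * xi + a) - cos (c * xi + a)) / (t - c))).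
  have -> : -1 * ((cos (t * xi + a) - cos (c * xi + a)) / (t - c)) +
      C None * (cos (p None * xi + a) - cos (c * xi + a)) = 0 by rewrite /=; ring.
  apply; apply: eq_sums h => j /=; rewrite mulN1r mulNr; congr (- _).
  by rewrite mulrA mulrAC -mulrA.
have relW b' z : sums (fun o => C o * (cpart b' (W n (P o + z)) - cpart b' (W n (Q + z)))) 0.
  pose zi := if i then z.2 else z.1; pose zo := if i then z.1 else z.2.
  pose u x := cpart b' (W n (pt i x zo)).
  have [B hB] := schwartz_decays2 [::] sW; rewrite /= in hB.
  have cW : continuous (fun z => cpart b' (W n z)) by exact: (@schwartz_continuous R (W n) b' [::] sW).
  have cu : continuous u.
    by move=> x; exact: (cvg_comp _ _ (@continuous_pt R i zo x) (cW _)).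
  have uB x : `|u x| <= B.
    apply: le_trans (decays2_pt i x zo (hB b')) _; rewrite ler_piMr ?(decays2_ge0 (hB b')) //.
    by rewrite mulr_ile1 ?lor_ge0 ?lor_le1.
  have iu := integrable_slice i zo cW (hB b').
  have [K K0 hK] := bandlimited_bound (ltW s0) cu uB iu (fun xi h => kernel_slice_spectrum i b' hw hW zo h).
  have := @relation_of_bound R u K (2 * 2 ^ n) _ C (fun o => d * (p o + th) + zi) (d * (c + th) + zi) M1 K0.
  move=> /(_ (fun r tau h => hK _ r C _ _ tau h) hC1) H.
  have {}H : sums (fun o => C o * (u (d * (p o + th) + zi) - u (d * (c + th) + zi))) 0.
    apply: H => xi /andP[x0 xs].
    (* This is what the step [d] is for: after rescaling, the spectrum of the block lies within the
       frequencies that the kernel reproduces. *)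
    have xi1 : `|d * xi| <= 1.
      rewrite ger0_norm ?mulr_ge0 ?(ltW d0) //; apply: le_trans dn.
      by rewrite ler_wpM2l // ltW.
    split.
      apply: eq_sums (expo _ ((d * th + zi) * xi) xi1) => o.
      by congr (_ * (cos _ - cos _)); ring.
    apply: eq_sums (expo _ ((d * th + zi) * xi - pi / 2) xi1) => o.
    by rewrite !addrA !cosBpihalf; congr (_ * (sin _ - sin _)); ring.
  apply: eq_sums H => o; rewrite /u /P /Q /zi /zo !pt_shift //.
have relW' s b' z : sums (fun o => C o * (cpart b' (pderivs s (W n) (P o + z)) -
    cpart b' (pderivs s (W n) (Q + z)))) 0.
  exact: relation_derivs sW hC1 relW s b' z.
have := @tempered_relation R T N MT (W n) tT sW _ C (fun o => P o + pt i 0 y) (Q + pt i 0 y) M1 hM1.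
have hyp s b' z : sums (fun o => C o * (cpart b' (pderivs s (W n) (P o + pt i 0 y - z)) -
    cpart b' (pderivs s (W n) (Q + pt i 0 y - z)))) 0.
  by apply: eq_sums (relW' s b' (pt i 0 y - z)) => o; rewrite !addrA.
move=> /(_ hyp b) /sums_optionE; rewrite sub0r => h.
have ptE x : pt i x 0 + pt i 0 y = pt i x y.
  by rewrite /pt; case: (i); congr (_, _) => /=; rewrite ?addr0 ?add0r.
have := sumsZ (-1) h; rewrite mulN1r opprK -/g /P /Q !ptE /= -/(G _) -/(G _) [(t - c)^-1 * _]mulrC.
by apply: eq_sums => j; rewrite !ptE -/(G _); ring.
Qed.

(** The increment of [g] is [T] applied to a difference of translates of [W n]. By the mean value
    theorem its seminorms of order [N] are [O (|h|)], with derivatives of order [N + 1] in the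
    constant. *)
Lemma conv_lipschitz (x : R * R) : exists2 C, 0 <= C & forall b d h, `|h| <= 1 ->
  forall x', norm2 (x' - x) <= 2 ->
  `|cpart b (g (x' + h *: dir d)) - cpart b (g x')| <= C * `|h|.
Proof.
have [_ hT] := tT.
have [] := @uniform_seq_bound R (fun s B => forall (z : R * R) b, (1 + norm2 z) ^+ N * `|cpart b (pderivs s (W n) z)| <= B) N.+1.
- by move=> s B B' h BB' z b'; apply: le_trans BB'.
- by move=> s; have [B _ hB] := schwartz_bound N s sW; exists B => z b'; exact: hB.
move=> K K0 hK.
(* [4 + norm2 x] bounds [1 + norm2 (x' + c *: dir d)]: the point [x'] is within 2 of [x], and
   [|c| <= 1]. *)
pose Z := (4 + norm2 x) ^+ N.
have Z0 : 0 <= Z by rewrite exprn_ge0 // addr_ge0 // norm2_ge0.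
exists (`|MT| * (2 * (Z * K))) => [|b d h h1 x' hx']; first by rewrite !mulr_ge0.
have [sC TC dC] := @comb_spec R T N MT (W n) tT sW unit [:: tt] (fun=> 1) (fun=> x' + h *: dir d) x'.
rewrite big_seq1 rmorph1 mul1r in TC.
have -> : cpart b (g (x' + h *: dir d)) - cpart b (g x') = cpart b (g (x' + h *: dir d) - g x').
  by case: (g _) (g x') => [? ?] [? ?]; case: (b).
rewrite -TC; apply: (le_trans (cpart_le _ _)).
apply: (@le_trans _ _ (MT * (2 * (Z * K) * `|h|))); last first.
  by rewrite -!mulrA ler_wpM2r ?ler_norm // !mulr_ge0.
apply: hT => // a s aN sN y.
have seminorm b' : (1 + norm2 y) ^+ a * `|cpart b' (pderivs s
     (comb (W n) [:: tt] (fun=> 1) (fun=> x' + h *: dir d) x') y)| <= Z * K * `|h|.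
  rewrite dC big_seq1 mul1r normrM normrX normrN normr1 expr1n mul1r.
  apply: (@le_trans _ _ ((1 + norm2 y) ^+ N * `|cpart b' (pderivs s (W n) (x' + h *: dir d - y)) -
     cpart b' (pderivs s (W n) (x' - y))|)).
    by rewrite ler_wpM2r // ler_weXn2l // lerDl norm2_ge0.
  pose G z := cpart b' (pderivs s (W n) z).
  have [c c1 ->] : exists2 c : R, `|c| <= 1 & cpart b' (pderivs s (W n) (x' + h *: dir d - y)) -
     cpart b' (pderivs s (W n) (x' - y)) = h * 'D_(dir d) G (x' - y + c *: dir d).
    have dG z : derivable G z (dir d) by exact: schwartz_derivable.
    have pos h0 p : 0 < h0 -> `|h0| <= 1 -> exists2 c : R, 0 <= c <= h0 & G (p + h0 *: dir d) - G p = h0 * 'D_(dir d) G (p + c *: dir d).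
      move=> h0p h01; have [|c] := @MVT R (fun t => G (p + t *: dir d)) (fun t => 'D_(dir d) G (p + t *: dir d)) 0 h0 h0p (fun t _ => is_derive_line (dG _)).
        by apply: derivable_within_continuous => u _; apply: ex_derive; exact: is_derive_line.
      rewrite in_itv /= scale0r addr0 subr0 => /andP[ca cb] ->; exists c; last by rewrite mulrC.
      by rewrite !ltW.
    have -> : x' + h *: dir d - y = (x' - y) + h *: dir d by rewrite addrAC.
    have [h0|h0|->] := ltgtP h 0.
    - have [||c c1 E] := pos (- h) (x' - y + h *: dir d); rewrite ?oppr_gt0 ?normrN //.
      have E1 : x' - y + h *: dir d + - h *: dir d = x' - y by rewrite scaleNr addrK.
      have E2 : x' - y + h *: dir d + c *: dir d = x' - y + (h + c) *: dir d by rewrite -addrA -scalerDl.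
      rewrite E1 E2 in E.
      exists (h + c); last by rewrite -/(G _) -/(G _) -[LHS]opprB E mulNr opprK.
      by move: h1; rewrite !ler_norml; lra.
    - have [||c c1 E] := pos h (x' - y) => //; exists c => //.
      by move: h1; rewrite !ler_norml; lra.
    - by exists 0; rewrite ?normr0 // scale0r addr0 subrr mul0r.
  have -> : 'D_(dir d) G (x' - y + c *: dir d) = cpart b' (pderivs (d :: s) (W n) (x' + c *: dir d - y)).
    by rewrite /= pderiv_cpart addrAC.
  rewrite normrM mulrCA mulrC ler_wpM2r //.
  apply: (le_trans (ler_wpM2r _ (weight_shift (x' + c *: dir d) y N))) => //.
  rewrite -mulrA ler_pM ?hK // ?exprn_ge0 ?addr_ge0 ?norm2_ge0 // ?mulr_ge0 ?exprn_ge0 ?addr_ge0 ?norm2_ge0 //.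
  apply: lerXn2r; rewrite ?nnegrE ?addr_ge0 ?norm2_ge0 //.
  have t1 := norm2_triangle x' (c *: dir d).
  have t2 := norm2_triangle (x' - x) x; rewrite subrK in t2.
  have t3 : norm2 (c *: dir d) = `|c|.
    by rewrite /norm2 /dir; case: (d) => /=; rewrite [_ *: 0]mulr0 [_ *: 1]mulr1 expr0n /= ?addr0 ?add0r sqrtr_sqr.
  lra.
have w0 : 0 <= (1 + norm2 y) ^+ a by rewrite exprn_ge0 // addr_ge0 // norm2_ge0.
apply: (le_trans (ler_wpM2l w0 (Cabs_le _))); rewrite mulrDr.
by have := seminorm false; have := seminorm true; lra.
Qed.

Lemma conv_continuous b : continuous (fun x => cpart b (g x)).
Proof.
move=> x; have [C C0 hC] := conv_lipschitz x.
apply/cvgrPdist_le => e e0.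
pose r := Num.min 1 (e / (2 * (C + 1))).
have C1 : 0 < C + 1 by rewrite ltr_wpDl.
have r0 : 0 < r by rewrite lt_min ltr01 divr_gt0 // mulr_gt0.
near=> y.
have [y1 y2] : `|x.1 - y.1| < r /\ `|x.2 - y.2| < r.
  near: y; exists (ball x.1 r, ball x.2 r) => /=; [by split; exact: nbhsx_ballx|by move=> z []].
have ry := y1; rewrite lt_min in ry; have rz := y2; rewrite lt_min in rz.
have [ry1 ry2] := andP ry; have [rz1 rz2] := andP rz.
have yE : y = x + (y.1 - x.1) *: dir false + (y.2 - x.2) *: dir true.
  case: (x) (y) => [x1 x2] [y1' y2'] /=; congr (_, _) => /=.
    by rewrite [_ *: 1]mulr1 [_ *: 0]mulr0 addr0 addrC subrK.
  by rewrite [_ *: 0]mulr0 [_ *: 1]mulr1 addr0 addrC subrK.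
pose m := x + (y.1 - x.1) *: dir false.
have h1 : `|cpart b (g m) - cpart b (g x)| <= C * `|y.1 - x.1|.
  apply: hC; first by rewrite distrC ltW.
  by rewrite subrr /norm2 /= expr0n /= addr0 sqrtr0.
have h2 : `|cpart b (g y) - cpart b (g m)| <= C * `|y.2 - x.2|.
  rewrite [in g y]yE; apply: hC; first by rewrite distrC ltW.
  rewrite /m addrAC subrr add0r /norm2 /= [_ *: 1]mulr1 [_ *: 0]mulr0 expr0n /= addr0 sqrtr_sqr distrC.
  by rewrite ltW // (lt_trans ry1) // ltr1n.
have E : C * (2 * (e / (2 * (C + 1)))) <= e.
  have -> : C * (2 * (e / (2 * (C + 1)))) = e * (C / (C + 1)) by field; rewrite gt_eqF.
  by rewrite ler_piMr ?(ltW e0) // ler_pdivrMr // mul1r lerDl.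
rewrite (_ : _ - _ = - ((cpart b (g y) - cpart b (g m)) + (cpart b (g m) - cpart b (g x)))); last by ring.
rewrite normrN; apply: (le_trans (ler_normD _ _)); apply: le_trans E.
rewrite distrC in ry2; rewrite distrC in rz2.
have k1 := ler_wpM2l C0 (ltW ry2); have k2 := ler_wpM2l C0 (ltW rz2).
lra.
Unshelve. all: by end_near. Qed.

(** By continuity a value above the essential supremum would persist on a box of positive measure.
    The Besov norm thus controls [g] at every sample point. *)
Lemma conv_le_Linfty (x : R * R) : ((Cabs (g x))%:E <= Linfty_norm g)%E.
Proof.
rewrite leNgt; apply/negP => h.
have ae := ess_sup_ge (@lebesgue2 R) (fun p => (Cabs (g p))%:E).
have cA : continuous (fun x => Cabs (g x)).
  have -> : (fun x => Cabs (g x)) = (fun x => Num.sqrt (cpart false (g x) * cpart false (g x) + cpart true (g x) * cpart true (g x))).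
    by apply/funext => z; rewrite -!expr2; case: (g z).
  move=> z; apply: (@continuous_comp _ _ _ (fun x => cpart false (g x) * cpart false (g x) + cpart true (g x) * cpart true (g x)) Num.sqrt); last exact: sqrt_continuous.
  by apply: cvgD; apply: cvgM; exact: conv_continuous.
have [r hr] : exists r : R, (Linfty_norm g <= r%:E)%E /\ r < Cabs (g x).
  move: h; case: (Linfty_norm g) => [r| |] //.
    by rewrite lte_fin => h; exists r.
  by move=> _; exists (Cabs (g x) - 1); rewrite leNye gtrBl.
have [[U V] /= [/nbhs_ballP[e1 /= e10 h1] /nbhs_ballP[e2 /= e20 h2]] he] : nbhs x [set z | r < Cabs (g z)].
  have := cA x => /cvgrPdist_lt /(_ (Cabs (g x) - r)); rewrite subr_gt0 => /(_ hr.2).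
  apply: filterS => z /= hz; have := le_lt_trans (ler_norm _) hz; lra.
case: ae => A [mA A0 sA].
pose e := Num.min e1 e2; have e0 : 0 < e by rewrite lt_min e10 e20.
have [ee1 ee2] : e <= e1 /\ e <= e2 by rewrite /e !ge_min !lexx orbT.
pose box : set (R * R) := `]x.1 - e, x.1 + e[%classic `*` `]x.2 - e, x.2 + e[%classic.
have mbox : measurable box by apply: measurableX; exact: measurable_itv.
have boxA : box `<=` A.
  move=> z [] /=; rewrite !in_itv /= => /andP[z1 z2] /andP[z3 z4].
  apply: sA => /= hz; have : r < Cabs (g z).
    by apply: he; split; [apply: h1|apply: h2]; rewrite /ball /= ltr_norml; lra.
  apply/negP; rewrite -leNgt -lee_fin; exact: le_trans hz hr.1.
have : (lebesgue2 box <= 0)%E by rewrite -A0; apply: le_measure; rewrite ?inE.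
rewrite /lebesgue2 product_measure1E; try exact: measurable_itv.
rewrite leNgt => /negP; apply.
have lE (u : R) : lebesgue_measure `]u - e, u + e[%classic = (e + e)%:E.
  rewrite lebesgue_measure_itv /= lte_fin ifT; last lra.
  by rewrite -EFinD; congr (_%:E); ring.
rewrite [X in (0 < X * _)%E]lE [X in (0 < _ * X)%E]lE -EFinM lte_fin mulr_gt0 //; lra.
Qed.

End Band.

End BandDividedDifference.

(** * Twofold sampling and Hilbert matrices *)

Section DoubleSums.
Context {R : realType}.

Lemma abs_bounded_pair (I J : choiceType) (w : I * J -> R) (m : I -> R) M :
  (forall i, abs_bounded (fun j => w (i, j)) (m i)) -> abs_bounded m M -> abs_bounded w M.
Proof.
move=> hw hm A.
pose A1 : {fset I} := [fset p.1 | p in A]%fset; pose A2 : {fset J} := [fset p.2 | p in A]%fset.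
apply: (@le_trans _ _ (\sum_(p <- [seq (i, j) | i <- A1, j <- A2]) `|w p|)).
  apply: ler_sum_uniq => // p pA; apply/allpairsP; exists p; split; last by case: p {pA}.
    by apply/imfsetP; exists p.
  by apply/imfsetP; exists p.
rewrite big_allpairs; apply: le_trans (hm A1); apply: ler_sum => i _.
exact: le_trans (hw i A2) (ler_norm _).
Qed.

Lemma abs_bounded_prod (I J : choiceType) (u : I -> R) (v : J -> R) M N :
  abs_bounded u M -> abs_bounded v N -> abs_bounded (fun p => u p.1 * v p.2) (M * N).
Proof.
move=> hu hv; apply: (@abs_bounded_pair _ _ _ (fun i => `|u i| * N)).
  by move=> i /=; exact: (abs_boundedZ (u i) hv).
move=> A; under eq_bigr do rewrite normrM normr_id.
rewrite -mulr_suml (ger0_norm (abs_bounded_ge0 hv)) ler_wpM2r //; exact: abs_bounded_ge0 hv.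
Qed.

(** Fubini for absolutely bounded families: a finite rectangle [P] on [B] and [K] approximates the
    double sum, and each of its rows is allowed the error [e / 2 / (#|B| + 1)]. *)
Lemma sums_pair (I J : choiceType) (w : I * J -> R) (v : I -> R) M l :
  abs_bounded w M -> (forall i, sums (fun j => w (i, j)) (v i)) -> sums v l -> sums w l.
Proof.
move=> hM hr hv; have [l' hl'] := sums_exist hM.
suff /(sums_unique hv) -> : sums v l' by [].
move=> e e0; have e2 : 0 < e / 2 by lra.
have [A hA] := hl' _ e2; exists [fset p.1 | p in A]%fset => B AB.
have eps0 : 0 < e / 2 / (#|` B|%:R + 1) by rewrite divr_gt0 // ltr_wpDl.
pose J0 i := sval (cid (hr i _ eps0)).
have hJ i (K : {fset J}) : (J0 i `<=` K)%fset ->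
    `|\sum_(j <- K) w (i, j) - v i| <= e / 2 / (#|` B|%:R + 1).
  by apply: (svalP (cid (hr i _ eps0))).
pose K : {fset J} := ([fset p.2 | p in A] `|` \bigcup_(i <- B) J0 i)%fset.
have JK i : i \in B -> (J0 i `<=` K)%fset.
  by move=> iB; apply: (fsubset_trans _ (fsubsetUr _ _)); exact: bigfcup_sup.
pose P : {fset I * J} := [fset p | p in [seq (i, j) | i <- B, j <- K]]%fset.
have sP : \sum_(p <- P) w p = \sum_(i <- B) \sum_(j <- K) w (i, j).
  rewrite -big_allpairs; apply: perm_big; apply: uniq_perm; first exact: fset_uniq.
    by apply: allpairs_uniq => // -[a b] [c d].
  by move=> p; rewrite !inE.
have AP : (A `<=` P)%fset.
  apply/fsubsetP => p pA; rewrite !inE; apply/allpairsP; exists p; split; last by case: p {pA}.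
    by apply: (fsubsetP AB); apply/imfsetP; exists p.
  by rewrite inE; apply/orP; left; apply/imfsetP; exists p.
have h1 := hA _ AP; rewrite sP in h1.
have h2 : `|\sum_(i <- B) v i - \sum_(i <- B) \sum_(j <- K) w (i, j)| <= e / 2.
  rewrite -sumrB; apply: le_trans (ler_norm_sum _ _ _) _.
  apply: (@le_trans _ _ (\sum_(i <- B) e / 2 / (#|` B|%:R + 1))).
    rewrite big_seq [leRHS]big_seq; apply: ler_sum => i iB.
    by rewrite distrC; apply: hJ; exact: JK.
  rewrite big_const_seq count_predT iter_addr_0 -[X in X <= _]mulr_natr -mulrA ler_piMr ?(ltW e2) //.
  by rewrite mulrC ler_pdivrMr ?ltr_wpDl // mul1r lerDl.
set x := \sum_(i <- B) v i in h2 *; set y := \sum_(i <- B) _ in h1 h2.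
rewrite (_ : x - l' = (x - y) + (y - l')); last by ring.
by rewrite (le_trans (ler_normD _ _)) //; lra.
Qed.

Section Embedding.
Variables (I K : choiceType) (h : I -> K) (p : K -> option I).
Hypotheses (hp : pcancel h p) (ph : ocancel p h).

Lemma big_pmap_oapp (v : I -> R) (s : seq K) :
  \sum_(k <- s) oapp v 0 (p k) = \sum_(i <- pmap p s) v i.
Proof.
elim: s => [|k s IH]; rewrite ?big_nil // big_cons IH /=.
by case: (p k) => [i|] /=; rewrite ?big_cons // add0r.
Qed.

Lemma big_fset_oapp (v : I -> R) (B : {fset K}) :
  \sum_(k <- B) oapp v 0 (p k) = \sum_(i <- [fset i | i in pmap p B]%fset) v i.
Proof.
rewrite big_pmap_oapp; apply: perm_big; apply: uniq_perm => //.
  by rewrite (pmap_uniq ph).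
by move=> i; rewrite !inE.
Qed.

Lemma abs_bounded_embed (v : I -> R) M :
  abs_bounded v M -> abs_bounded (fun k => oapp v 0 (p k)) M.
Proof.
move=> hv B; rewrite (eq_bigr (fun k => oapp (fun i => `|v i|) 0 (p k))).
  by rewrite big_fset_oapp; exact: hv.
by move=> k _; case: (p k) => //=; rewrite normr0.
Qed.

(** Extension by zero along an injection; through it sums over pairs of integers become sums over
    natural numbers. *)
Lemma sums_embed (v : I -> R) l : sums v l -> sums (fun k => oapp v 0 (p k)) l.
Proof.
move=> hv e /hv[A hA]; exists [fset h i | i in A]%fset => B AB.
rewrite big_fset_oapp; apply: hA; apply/fsubsetP => i iA.
rewrite !inE mem_pmap; apply/mapP; exists (h i); last by rewrite hp.
by apply: (fsubsetP AB); apply/imfsetP; exists i.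
Qed.

End Embedding.

Lemma sums_nat2 (u : nat * nat -> R) l : sums u l ->
  (fun MN : nat * nat => \sum_(j < MN.2.+1) \sum_(k < MN.1.+1) u (j : nat, k : nat))
    @ filter_prod \oo \oo --> l.
Proof.
move=> hu; apply/cvgrPdist_le => e /hu[A hA].
have [n hn] : exists n : nat, forall p, p \in A -> (p.1 <= n)%N /\ (p.2 <= n)%N.
  exists (\max_(p <- A) (p.1 + p.2))%N => p pA.
  have : (p.1 + p.2 <= \max_(p <- A) (p.1 + p.2))%N by rewrite (big_rem p) //= leq_maxl.
  by move=> H; split; apply: leq_trans H; rewrite ?leq_addr ?leq_addl.
exists ([set k | (n <= k)%N], [set k | (n <= k)%N]); first by split; exists n.
move=> [a b] [/= na nb].
pose s := [seq (i, j) | i <- iota 0 b.+1, j <- iota 0 a.+1].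
pose S : {fset nat * nat} := [fset p | p in s]%fset.
have memS p : (p \in S) = (p \in s).
  by apply/imfsetP/idP => [[q qs ->] //|ps]; exists p.
rewrite (_ : \sum_(j < b.+1) _ = \sum_(p <- S) u p).
  rewrite distrC; apply: hA; apply/fsubsetP => p pA; rewrite memS.
  have [p1 p2] := hn _ pA; apply/allpairsP; exists p; split; last by case: p {pA p1 p2}.
    by rewrite mem_iota /= add0n ltnS (leq_trans p1).
  by rewrite mem_iota /= add0n ltnS (leq_trans p2).
rewrite [RHS](perm_big s).
  rewrite big_allpairs -(big_mkord xpredT (fun j => \sum_(k < a.+1) u (j, k : nat))) /index_iota subn0.
  by apply: eq_bigr => j _; rewrite -(big_mkord xpredT (fun k => u (j, k))) /index_iota subn0.
apply: uniq_perm; [exact: fset_uniq| |exact: memS].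
by apply: allpairs_uniq; rewrite ?iota_uniq // => -[? ?] [].
Qed.

End DoubleSums.

(** * Hilbert matrices and bounded matrices on l^2 *)

Section MatricesOnL2.
Context {R : realType}.

Lemma sums_ge_partial (I : choiceType) (u : I -> R) l (A : {fset I}) :
  (forall i, 0 <= u i) -> sums u l -> \sum_(i <- A) u i <= l.
Proof.
move=> u0 h; apply/ler_addgt0Pl => e /h[B /(_ _ (fsubsetUr A B))] /ler_normlP[_ hB].
have : \sum_(i <- A) u i <= \sum_(i <- (A `|` B)%fset) u i.
  rewrite (big_fset_cat _ (fsubsetUl A B)) lerDl; exact: sumr_ge0.
by move: hB; set x := \sum_(i <- (A `|` B)%fset) _; lra.
Qed.

Lemma sums_big (I : choiceType) (J : Type) (s : seq J) (u : J -> I -> R) (v : J -> R) :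
  (forall j, sums (u j) (v j)) -> sums (fun i => \sum_(j <- s) u j i) (\sum_(j <- s) v j).
Proof.
move=> h; elim: s => [|j s IH].
  by rewrite big_nil; apply: eq_sums (@sums0 R I) => i; rewrite big_nil.
rewrite big_cons; apply: eq_sums (sumsD (h j) IH) => i; by rewrite big_cons.
Qed.

Lemma sums_shift (u : int -> R) l m : sums u l -> sums (fun j => u (j - m)) l.
Proof.
move=> h; apply: (@sums_embed R _ _ (fun j => j + m) (fun j => Some (j - m)) _ _ _ _ h).
- by move=> j; rewrite addrK.
- by move=> j /=; rewrite subrK.
Qed.

(** Hilbert matrix of two interleaved grids; every denominator is at least 1/2 in absolute value. *)
Definition hilbert (j k : int) : R := (j%:~R - k%:~R - 2^-1)^-1.

Lemma half_int_ge (j : int) : 2^-1 <= `|j%:~R - 2^-1| :> R.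
Proof.
have [j0|j1] := lerP j 0.
  have : j%:~R <= 0 :> R by rewrite lerz0.
  by move=> h; rewrite ler0_norm; lra.
have : 1 <= j%:~R :> R by rewrite ler1z.
by move=> h; rewrite ger0_norm; lra.
Qed.

(** [45 = 9 * 5]: for [x >= 1/2] one has [1 + x <= 3 x], hence [x ^- 2 <= 9 (1 + x) ^- 2], and
    [decay_abs_bounded] gives the 5. *)
Lemma hilbert_sqr k : abs_bounded (fun j => hilbert j k ^+ 2) 45.
Proof.
have -> : 45 = `|9 : R| * 5 by rewrite ger0_norm; lra.
apply: abs_bounded_le (abs_boundedZ 9 (decay_abs_bounded (k%:~R + 2^-1))) => j.
rewrite [leRHS]normrM [leLHS]normrX /hilbert !normfV [X in _ <= _ * X^-1]normrX (ger0_norm (_ : 0 <= 9)) //.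
have := half_int_ge (j - k); rewrite intrB => h.
have -> : k%:~R + 2^-1 - j%:~R = - (j%:~R - k%:~R - 2^-1) :> R by ring.
rewrite normrN; move: h; set x := `|_ - _ - _| => h.
have x0 : 0 < x by lra.
rewrite (ger0_norm (_ : 0 <= 1 + x)); last lra.
rewrite -[9](_ : 3 ^+ 2 = _); last by ring.
rewrite -expr_div_n lerXn2r ?nnegrE ?invr_ge0 ?divr_ge0 //; try lra.
by rewrite -[x^-1]mul1r ler_pdivrMr // mulrAC ler_pdivlMr; lra.
Qed.

Lemma hilbert_mul k l : abs_bounded (fun j => hilbert j k * hilbert j l) 90.
Proof.
have -> : 90 = 45 + 45 :> R by lra.
apply: abs_bounded_le (abs_boundedD (hilbert_sqr k) (hilbert_sqr l)) => j.
set x := hilbert j k; set y := hilbert j l.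
rewrite [leRHS]ger0_norm ?addr_ge0 ?sqr_ge0 // normrM.
have := sqr_ge0 (`|x| - `|y|); rewrite -(real_normK (num_real x)) -(real_normK (num_real y)).
have := normr_ge0 x; have := normr_ge0 y; nra.
Qed.

Lemma hilbert_sub j k l : k != l ->
  hilbert j k - hilbert j l = (k - l)%:~R * (hilbert j k * hilbert j l).
Proof.
move=> kl; rewrite /hilbert.
have := half_int_ge (j - k); have := half_int_ge (j - l); rewrite !intrB => h1 h2.
have z1 : j%:~R - k%:~R - 2^-1 != 0 :> R by rewrite -normr_gt0; lra.
have z2 : j%:~R - l%:~R - 2^-1 != 0 :> R by rewrite -normr_gt0; lra.
move: z1 z2; set x := j%:~R - k%:~R - 2^-1; set y := j%:~R - l%:~R - 2^-1 => z1 z2.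
have -> : k%:~R - l%:~R = y - x by rewrite /x /y; ring.
by field; rewrite z1 z2.
Qed.

(** As [hilbert j 1 = hilbert (j - 1) 0], the sum over [- M <= j <= M] telescopes to two end terms
    of order [1 / M]. The sum is known to exist, so these windows determine it. *)
Lemma hilbert_telescope : sums (fun j => hilbert j 0 - hilbert j 1) 0.
Proof.
have [l hl] := sums_exist (hilbert_mul 0 1).
have h : sums (fun j => hilbert j 0 - hilbert j 1) (- l).
  rewrite -mulN1r; apply: eq_sums (sumsZ (-1) hl) => j.
  by rewrite hilbert_sub // sub0r mulrNz.
suff <- : - l = 0 by [].
apply/eqP; rewrite -normr_le0; apply/ler_addgt0Pl => e e0; rewrite addr0.
have [A hA] := h _ (divr_gt0 e0 (ltr0n _ 2)).
pose M := (\max_(j <- A) absz j + (Num.truncn (4 / e)).+2)%N.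
have AM j : j \in A -> (absz j <= M)%N.
  by move=> jA; apply: leq_trans (leq_addr _ _); rewrite (big_rem j) //= leq_maxl.
have M0 : 4 / e + 1 <= M%:R.
  have := truncnS_gt (4 / e); rewrite /M -[(_).+2]addn1 !natrD; set x := (_.+1)%:R => hx; have := ler0n R (\max_(j <- A) absz j); set y := (_)%:R; lra.
pose s := [seq (Posz n - Posz M)%R | n <- iota 0 (M + M).+1].
have us : uniq s by rewrite map_inj_uniq ?iota_uniq // => a b /= ?; lia.
have := hA [fset j in s]%fset; rewrite (perm_big s) /=; last first.
  by apply: uniq_perm; [exact: fset_uniq|exact: us|move=> j; apply/imfsetP/idP => [[? ? ->]|js] //; exists j].
rewrite big_map -/(index_iota 0 (M + M).+1).
have -> : \sum_(0 <= n < (M + M).+1) (hilbert (Posz n - Posz M) 0 - hilbert (Posz n - Posz M) 1)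
   = hilbert M 0 - hilbert (- Posz M - 1) 0.
  rewrite (@telescope_sumr_eq _ 0 (M + M).+1 (fun n => hilbert (Posz n - Posz M - 1) 0)) //.
    by congr (hilbert _ _ - hilbert _ _); lia.
  move=> n _; congr (_ - _); first by congr (hilbert _ _); lia.
  by rewrite /hilbert; congr (_ ^-1); rewrite !intrB subr0; ring.
have e4 : 0 < 4 / e by rewrite divr_gt0.
have inv x : 4 / e <= `|x| -> `|x^-1| <= e / 4.
  move=> hx; rewrite normfV -[leRHS]invrK invf_div lef_pV2 ?posrE //.
  exact: lt_le_trans hx.
have hM1 : `|hilbert M 0| <= e / 4.
  by apply: inv; rewrite subr0 ger0_norm; rewrite -pmulrn; lra.
have hM2 : `|hilbert (- Posz M - 1) 0| <= e / 4.
  by apply: inv; rewrite subr0 intrB mulrNz -pmulrn ler0_norm; lra.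
move=> H; have {H} H := H _.
have {}H : `|hilbert M 0 - hilbert (- Posz M - 1) 0 + l| <= e / 2.
  rewrite opprK in H; apply: H; apply/fsubsetP => j jA; apply/imfsetP; exists j => //=.
  have jM := AM j jA; apply/mapP; exists (absz (j + Posz M)); last by lia.
  by rewrite mem_iota; lia.
rewrite normrN (_ : l = (hilbert M 0 - hilbert (- Posz M - 1) 0 + l) - hilbert M 0 + hilbert (- Posz M - 1) 0); last by ring.
rewrite (le_trans (ler_normD _ _)) // (le_trans (lerD (ler_normB _ _) (lexx _))) //; lra.
Qed.

(* Distinct columns are orthogonal: a product of two entries of a row is a multiple of
   their difference, and the sum over the rows telescopes. *)
Lemma hilbert_orth k l : k != l -> sums (fun j => hilbert j k * hilbert j l) 0.
Proof.
have tele (m : nat) : sums (fun j => hilbert j 0 - hilbert j m) 0.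
  elim: m => [|m IH]; first by apply: eq_sums (@sums0 R int) => j; rewrite subrr.
  have := sumsD IH (sums_shift (Posz m) hilbert_telescope); rewrite addr0; apply: eq_sums => j.
  have -> : hilbert (j - Posz m) 0 = hilbert j m by rewrite /hilbert subr0 intrB.
  rewrite addrA subrK; congr (_ - _).
  by rewrite /hilbert intS; congr (_ ^-1); rewrite intrB intrD; ring.
wlog : k l / (k < l)%R.
  move=> H kl; have [h|h|h] := ltrgtP k l; [exact: H| |by rewrite h eqxx in kl].
  by apply: eq_sums (H l k h _) => [j|]; rewrite 1?mulrC // lt_eqF.
move=> kl kl0; have [m hm] : exists m : nat, l = k + m by exists (absz (l - k)); lia.
have d0 : (k - l)%:~R != 0 :> R by rewrite intr_eq0 subr_eq0.
rewrite -(mulr0 ((k - l)%:~R^-1)); apply: eq_sums (sumsZ _ (sums_shift k (tele m))) => j.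
rewrite -[RHS](mulKf d0) -hilbert_sub //; congr (_ * _).
by rewrite /hilbert hm !intrB !intrD; congr (_ ^-1 - _ ^-1); ring.
Qed.

(** [C] bounds the square of the operator norm; finite sections determine it, so no convergence is
    involved. *)
Definition l2bounded (I J : choiceType) (g : I -> J -> R) (C : R) : Prop :=
  forall (A : {fset I}) (B : {fset J}) (a : J -> R),
    \sum_(i <- A) (\sum_(j <- B) g i j * a j) ^+ 2 <= C * \sum_(j <- B) a j ^+ 2.

(** The columns are orthogonal with squared norms [c k <= 45], so over all rows the squared norm of
    the image is the sum of the [c k * a k ^ 2]; keeping only the rows in [A] decreases it. *)
Lemma hilbert_l2bounded : l2bounded hilbert 45.
Proof.
move=> A B a.
have [c hc] : exists c : int -> R, forall k, sums (fun j => hilbert j k ^+ 2) (c k) /\ c k <= 45.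
  suff H k : exists c, sums (fun j => hilbert j k ^+ 2) c /\ c <= 45.
    by exists (fun k => sval (cid (H k))) => k; exact: svalP (cid (H k)).
  have [c hc] := sums_exist (hilbert_sqr k); exists c; split => //.
  exact: le_trans (ler_norm _) (sums_abs_le (hilbert_sqr k) hc).
pose V k l := a k * a l * (if k == l then c k else 0).
have h k l : sums (fun j => a k * a l * (hilbert j k * hilbert j l)) (V k l).
  apply: sumsZ; case: eqP => [<-|/eqP kl]; last exact: hilbert_orth.
  by apply: eq_sums (hc k).1 => j; rewrite expr2.
have {}h := sums_big B (fun k => sums_big B (h k)).
apply: (@le_trans _ _ (\sum_(k <- B) \sum_(l <- B) V k l)).
  apply: le_trans (sums_ge_partial A _ h).
    apply: ler_sum => j _; rewrite expr2 mulr_suml le_eqVlt; apply/orP; left; apply/eqP.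
    apply: eq_bigr => k _; rewrite mulr_sumr; apply: eq_bigr => l _; ring.
  move=> j; rewrite (_ : \sum_(k <- B) _ = (\sum_(k <- B) hilbert j k * a k) ^+ 2) ?sqr_ge0 //.
  rewrite expr2 mulr_suml; apply: eq_bigr => k _; rewrite mulr_sumr; apply: eq_bigr => l _; ring.
rewrite mulr_sumr big_seq [leRHS]big_seq; apply: ler_sum => k kB.
rewrite (big_fsetD1 k) //= big1_seq ?addr0; last first.
  by move=> l /andP[_]; rewrite !inE => /andP[lk _]; rewrite /V eq_sym (negbTE lk) mulr0.
by rewrite /V eqxx -expr2 mulrC ler_wpM2r ?sqr_ge0 // (hc k).2.
Qed.

(** A diagonal matrix times [hilbert] minus [hilbert] times a diagonal matrix;
    [(x - y) ^ 2 <= 2 x ^ 2 + 2 y ^ 2] gives [180 = 2 * 45 + 2 * 45]. *)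
Lemma divdiff_l2bounded (p q : int -> R) s : (forall j, `|p j| <= s) -> (forall j, `|q j| <= s) ->
  l2bounded (fun j k => (p j - q k) * hilbert j k) (180 * s ^+ 2).
Proof.
move=> hp hq A B a; have s0 : 0 <= s by exact: le_trans (hp 0).
pose X j := \sum_(k <- B) hilbert j k * a k; pose Y j := \sum_(k <- B) hilbert j k * (q k * a k).
apply: (@le_trans _ _ (2 * s ^+ 2 * \sum_(j <- A) X j ^+ 2 + 2 * \sum_(j <- A) Y j ^+ 2)).
  rewrite !mulr_sumr -big_split; apply: ler_sum => j _ /=.
  have -> : \sum_(k <- B) (p j - q k) * hilbert j k * a k = p j * X j - Y j.
    by rewrite mulr_sumr -sumrB; apply: eq_bigr => k _; ring.
  have : (p j * X j) ^+ 2 <= s ^+ 2 * X j ^+ 2.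
    by rewrite exprMn ler_wpM2r ?sqr_ge0 // -(real_normK (num_real (p j))) lerXn2r ?nnegrE.
  have := sqr_ge0 (p j * X j + Y j); nra.
have hX := hilbert_l2bounded A B a; have hY := hilbert_l2bounded A B (fun k => q k * a k).
have hq2 : \sum_(k <- B) (q k * a k) ^+ 2 <= s ^+ 2 * \sum_(k <- B) a k ^+ 2.
  rewrite mulr_sumr; apply: ler_sum => k _.
  by rewrite exprMn ler_wpM2r ?sqr_ge0 // -(real_normK (num_real (q k))) lerXn2r ?nnegrE.
have s2 := sqr_ge0 s; rewrite -/(X _) in hX.
have := ler_wpM2l s2 hX; move: hY hq2.
rewrite /X /Y.
set S := \sum_(k <- B) a k ^+ 2; set S1 := \sum_(i <- A) _; set S2 := \sum_(i <- A) _.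
set S3 := \sum_(k <- B) _; lra.
Qed.

Lemma l2bounded_diag (K I J : choiceType) (g : K -> I -> J -> R) C :
  (forall n, l2bounded (g n) C) -> 0 <= C ->
  l2bounded (fun (p : K * I) (q : K * J) => if p.1 == q.1 then g p.1 p.2 q.2 else 0) C.
Proof.
move=> hg C0 A B a.
pose A1 : {fset K} := [fset p.1 | p in A]%fset; pose A2 : {fset I} := [fset p.2 | p in A]%fset.
pose B1 : {fset K} := [fset p.1 | p in B]%fset; pose B2 : {fset J} := [fset p.2 | p in B]%fset.
(* [B] need not be a rectangle; the vector is extended by 0 to [B1] times [B2]. *)
pose a' n j := if (n, j) \in B then a (n, j) else 0.
have sumB (F : K -> J -> R -> R) : (forall n j, F n j 0 = 0) ->
    \sum_(q <- B) F q.1 q.2 (a q) = \sum_(n <- B1) \sum_(j <- B2) F n j (a' n j).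
  move=> F0; transitivity (\sum_(q <- [seq (n, j) | n <- B1, j <- B2]) F q.1 q.2 (a' q.1 q.2)).
    2: by rewrite big_allpairs.
  rewrite [RHS](bigID (fun q => q \in B)) /= [X in _ = _ + X]big1 ?addr0; last first.
    by move=> q qB; rewrite /a' -surjective_pairing (negbTE qB).
  rewrite -[RHS]big_filter [RHS](perm_big B) /=; last first.
    apply: uniq_perm => //; first by rewrite filter_uniq // allpairs_uniq // => -[? ?] [].
    move=> q; rewrite mem_filter; apply/andP/idP => [[] //|qB]; split => //.
    apply/allpairsP; exists q; split; last by case: q {qB}.
      by apply/imfsetP; exists q.
    by apply/imfsetP; exists q.
  by rewrite big_seq [RHS]big_seq; apply: eq_bigr => q qB; rewrite /a' -surjective_pairing qB.
rewrite (sumB (fun _ _ x => x ^+ 2)) ?expr0n // mulr_sumr.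
pose f n i := \sum_(j <- B2) g n i j * a' n j.
have row p : \sum_(q <- B) (if p.1 == q.1 then g p.1 p.2 q.2 else 0) * a q =
    if p.1 \in B1 then f p.1 p.2 else 0.
  rewrite (sumB (fun n j x => (if p.1 == n then g p.1 p.2 j else 0) * x)); last by move=> *; rewrite mulr0.
  case: ifP => pB; last first.
    rewrite big1_seq // => n /andP[_ nB]; rewrite big1 // => j _.
    by rewrite ifF ?mul0r //; apply/negP => /eqP pn; rewrite pn nB in pB.
  rewrite (big_fsetD1 p.1) //= [X in _ + X]big1_seq ?addr0.
    by apply: eq_bigr => j _; rewrite eqxx.
  by move=> n /andP[_]; rewrite !inE eq_sym => /andP[/negbTE -> _]; rewrite big1 // => j _; rewrite mul0r.
under eq_bigr do rewrite row.
apply: (@le_trans _ _ (\sum_(p <- [seq (n, i) | n <- B1, i <- A2]) f p.1 p.2 ^+ 2)).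
  rewrite (bigID (fun p => p.1 \in B1)) /= [X in _ + X]big1 ?addr0; last first.
    by move=> p /negbTE ->; rewrite expr0n.
  rewrite (eq_bigr (fun p => f p.1 p.2 ^+ 2)); last by move=> p ->.
  rewrite -big_filter; apply: ler_sum_uniq; [by apply: filter_uniq; exact: fset_uniq| |by move=> ?; exact: sqr_ge0].
  move=> p; rewrite mem_filter => /andP[pB pA]; apply/allpairsP; exists p; split => //; last by case: p {pA pB}.
  by apply/imfsetP; exists p.
by rewrite big_allpairs; apply: ler_sum => n _; exact: (hg n A2 B2 (a' n)).
Qed.

Lemma l2bounded_embed (I J K L : choiceType) (p : K -> option I) (q : L -> option J)
    (h : I -> K) (h' : J -> L) (g : I -> J -> R) C :
  ocancel p h -> ocancel q h' -> 0 <= C -> l2bounded g C ->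
  l2bounded (fun k l => oapp (fun i => oapp (g i) 0 (q l)) 0 (p k)) C.
Proof.
move=> ph qh C0 hg A B a.
pose A' : {fset I} := [fset i | i in pmap p A]%fset; pose B' : {fset J} := [fset j | j in pmap q B]%fset.
have row i : \sum_(l <- B) oapp (g i) 0 (q l) * a l = \sum_(j <- B') g i j * a (h' j).
  rewrite -(big_fset_oapp qh (fun j => g i j * a (h' j))); apply: eq_bigr => l _.
  by have := qh l; case: (q l) => [j|] /=; [move=> ->|rewrite mul0r].
rewrite (eq_bigr (fun k => oapp (fun i => (\sum_(j <- B') g i j * a (h' j)) ^+ 2) 0 (p k))); last first.
  move=> k _; case: (p k) => [i|] /=; first by rewrite row.
  by rewrite big1 ?expr0n // => l _; rewrite mul0r.
rewrite (big_fset_oapp ph); apply: le_trans (hg A' B' _) _.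
rewrite -(big_fset_oapp qh (fun j => a (h' j) ^+ 2)) ler_wpM2l //; apply: ler_sum => l _.
by have := qh l; case: (q l) => [j|] /=; [move=> ->|rewrite sqr_ge0].
Qed.

End MatricesOnL2.

(** * Sampling in both arguments of a divided difference *)

Section TwofoldSampling.
Context {R : realType}.
Implicit Types (b i : bool).

Lemma continuous_sinc : continuous (@sinc R).
Proof.
move=> x; have [->|x0] := eqVneq x 0; last first.
  have h : {near x, (fun y => sin y / y) =1 sinc}.
    near=> y; rewrite /sinc ifF //; apply/negbTE; near: y.
    by apply: open_neq.
  rewrite /continuous_at {2}/sinc (negbTE x0).
  apply: cvg_trans (near_eq_cvg h) _.
  apply: cvgM; first exact: continuous_sin.
  by apply: cvgV => //; exact: cvg_id.
apply/continuous_withinNx; rewrite {2}/sinc eqxx.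
have [d1 d2] := is_derive_sin (0 : R).
have : (fun h => h^-1 *: ((sin \o shift 0) (h *: (1 : R)) - sin (0 : R))) @ (0 : R)^' --> (1 : R).
  have e1 : 'D_1 sin 0 = 1 :> R by rewrite d2 cos0.
  rewrite -[X in _ --> X]e1 /derive; exact: d1.
apply: cvg_trans; apply: near_eq_cvg; near=> h.
rewrite /sinc ifF; last by apply/negbTE; near: h; exact: nbhs_dnbhs_neq.
by rewrite /= sin0 subr0 addr0 /GRing.scale /= mulr1 mulrC.
Unshelve. all: by end_near. Qed.

Lemma continuous_skernel L : continuous (@skernel R L).
Proof.
move=> x; apply: cvgM.
  apply: (@continuous_comp _ _ _ (fun x => pi * x) sinc); last exact: continuous_sinc.
  by apply: cvgM; [exact: cvg_cst|exact: cvg_id].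
apply: (@continuous_comp _ _ _ (fun x => sinc (pi * x / 2 ^+ L.+2)) (fun x => x ^+ L)); last exact: exprn_continuous.
apply: (@continuous_comp _ _ _ (fun x => pi * x / 2 ^+ L.+2) sinc); last exact: continuous_sinc.
by apply: cvgM; [apply: cvgM; [exact: cvg_cst|exact: cvg_id]|exact: cvg_cst].
Qed.

Lemma kernel_decay2 L : (0 < L)%N -> exists2 C, 0 <= C & forall x : R, `|skernel L x| <= C * (1 + `|x|) ^- 2.
Proof.
move=> L0; have [C C0 hC] := @kernel_decay R L; exists C => // x.
apply: le_trans (hC x) _; rewrite ler_wpM2l // lef_pV2 ?posrE ?exprn_gt0 ?ltr_wpDr //.
by rewrite ler_weXn2l // lerDl.
Qed.

Lemma hilbert_le2 j k : `|hilbert j k : R| <= 2.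
Proof.
have := @half_int_ge R (j - k); rewrite intrB /hilbert normfV => h.
by rewrite -[X in _ <= X]invrK lef_pV2 ?posrE; lra.
Qed.

Lemma double_series_bounded (k : R -> R) C (c : int * int -> R) B t1 t2 : 0 <= C ->
  (forall x, `|k x| <= C * (1 + `|x|) ^- 2) -> (forall p, `|c p| <= B) ->
  abs_bounded (fun p : int * int => k (t1 - p.1%:~R) * k (t2 - p.2%:~R) * c p) (25 * C ^+ 2 * B).
Proof.
move=> C0 hk hc; have B0 : 0 <= B by exact: le_trans (hc (0, 0)).
have := abs_boundedZ (C ^+ 2 * B) (abs_bounded_prod (decay_abs_bounded t1) (decay_abs_bounded t2)).
have -> : `|C ^+ 2 * B| * (5 * 5) = 25 * C ^+ 2 * B.
  by rewrite ger0_norm ?mulr_ge0 ?sqr_ge0 //; ring.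
apply: abs_bounded_le => p /=.
have hd t (j : int) : 0 <= (1 + `|t - j%:~R|) ^- 2 by rewrite invr_ge0 exprn_ge0 // addr_ge0.
rewrite (ger0_norm (_ : 0 <= C ^+ 2 * B * _)); last by rewrite !mulr_ge0 ?sqr_ge0.
rewrite !normrM (_ : C ^+ 2 * B * _ = (C * (1 + `|t1 - p.1%:~R|) ^- 2) * (C * (1 + `|t2 - p.2%:~R|) ^- 2) * B); last by ring.
by rewrite !ler_pM // mulr_ge0.
Qed.

(** Tannery's theorem: moving the argument by at most 1 shrinks [1 + |x - z|] by at most a factor 2,
    which costs 4 in each kernel bound and 16 in the majorant. *)
Lemma double_series_continuous (k : R -> R) C (c : int * int -> R) B (T : Type) (F : set_system T)
    (FF : Filter F) (X1 X2 l : T -> R) (p1 p2 l0 : R) : 0 <= C -> continuous k ->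
  (forall x, `|k x| <= C * (1 + `|x|) ^- 2) -> (forall p, `|c p| <= B) ->
  X1 @ F --> p1 -> X2 @ F --> p2 ->
  (\forall t \near F, sums (fun p : int * int => k (X1 t - p.1%:~R) * k (X2 t - p.2%:~R) * c p) (l t)) ->
  sums (fun p : int * int => k (p1 - p.1%:~R) * k (p2 - p.2%:~R) * c p) l0 -> l @ F --> l0.
Proof.
move=> C0 ck hk hc h1 h2 hl hl0; have B0 : 0 <= B by exact: le_trans (hc (0, 0)).
pose v (p : int * int) := 16 * C ^+ 2 * B * ((1 + `|p1 - p.1%:~R|) ^- 2 * (1 + `|p2 - p.2%:~R|) ^- 2).
have hv := abs_boundedZ (16 * C ^+ 2 * B) (abs_bounded_prod (decay_abs_bounded p1) (decay_abs_bounded p2)).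
apply: (@tannery R _ _ F FF (fun t p => k (X1 t - p.1%:~R) * k (X2 t - p.2%:~R) * c p) _ v l l0 _ _ _ hv hl hl0).
  move=> p; apply: cvgM; last exact: cvg_cst.
  apply: cvgM.
    by apply: (continuous_cvg _ (ck _)); apply: cvgB; [exact: h1|exact: cvg_cst].
  by apply: (continuous_cvg _ (ck _)); apply: cvgB; [exact: h2|exact: cvg_cst].
near=> t => p.
have n1 : `|p1 - X1 t| <= 1 by near: t; move/cvgrPdist_le : h1; apply.
have n2 : `|p2 - X2 t| <= 1 by near: t; move/cvgrPdist_le : h2; apply.
have hd (q x z : R) : `|q - x| <= 1 -> `|k (x - z)| <= 4 * C * (1 + `|q - z|) ^- 2.
  move=> qx; apply: le_trans (hk _) _; rewrite [4 * C]mulrC -mulrA ler_wpM2l //.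
  have d : 1 + `|q - z| <= 2 * (1 + `|x - z|).
    have := ler_normD (q - x) (x - z); have -> : q - x + (x - z) = q - z by ring.
    have := normr_ge0 (x - z); lra.
  rewrite -[4]invrK -invfM lef_pV2 ?posrE.
  - rewrite -[4^-1](_ : 2^-1 ^+ 2 = _); last by field.
    rewrite -exprMn lerXn2r ?nnegrE ?mulr_ge0 ?addr_ge0 ?invr_ge0 //.
    by rewrite mulrC ler_pdivrMr // mulrC.
  - by rewrite exprn_gt0 // ltr_wpDr.
  - by rewrite mulr_gt0 ?invr_gt0 // exprn_gt0 // ltr_wpDr.
rewrite !normrM /v (_ : 16 * C ^+ 2 * B * _ = (4 * C * (1 + `|p1 - p.1%:~R|) ^- 2) * (4 * C * (1 + `|p2 - p.2%:~R|) ^- 2) * B); last by ring.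
by rewrite !ler_pM ?mulr_ge0 ?normr_ge0 //; apply: hd.
Unshelve. all: by end_near. Qed.

Section Band.
Variables (w : R -> R) (W : int -> R * R -> R[i]) (n : int) (T : (R * R -> R[i]) -> R[i]) (N : nat) (MT : R).
Hypotheses (hw : lp_profile w) (hW : lp_kernels w W) (tT : tempered_order T N MT).

Let g := dist_conv T (W n).
Let k := @skernel R N.+2.

(** Divided differences of [G] between the two interleaved grids of step [d], in the factored form
    that exhibits the Hilbert matrix. *)
Definition sampling_matrix i b y d (p : int * int) : R :=
  let G (x : R) := cpart b (g (pt i x y)) in
  (G (d * p.1%:~R) - G (d * (p.2%:~R + 2^-1))) * hilbert p.1 p.2 / d.

Lemma sampling_matrix_le i b y d s : 0 < d -> (forall x, Cabs (g x) <= s) ->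
  forall p, `|sampling_matrix i b y d p| <= 4 * s / d.
Proof.
move=> d0 hs p; rewrite /sampling_matrix !normrM (gtr0_norm (_ : 0 < d^-1)) ?invr_gt0 //.
rewrite ler_pM2r ?invr_gt0 // (_ : 4 * s = (s + s) * 2); last by ring.
rewrite ler_pM //; last exact: hilbert_le2.
by rewrite (le_trans (ler_normB _ _)) // lerD // (le_trans (cpart_le _ _)).
Qed.

(* Sampling in the first variable on [d * Z] and then in the second on
   [d * (Z + 1/2)]; the shift keeps the two grids apart. *)
Lemma twofold_sampling_generic i b y d s x1 x2 : 0 < d -> d * (2 * 2 ^ n) <= 1 ->
  (forall x, Cabs (g x) <= s) -> x1 != x2 -> (forall j : int, j%:~R != x2 / d) ->
  let G (x : R) := cpart b (g (pt i x y)) in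
  sums (fun p : int * int => k (x1 / d - p.1%:~R) * k (x2 / d - 2^-1 - p.2%:~R) * sampling_matrix i b y d p)
    ((G x1 - G x2) / (x1 - x2)).
Proof.
move=> d0 dn hs x12 jx2 G.
have [C C0 hC] := @kernel_decay2 N.+2 isT.
have dN0 : d != 0 by rewrite gt_eqF.
have dx x : d * (x / d) = x by field.
have D := double_series_bounded (x1 / d) (x2 / d - 2^-1) C0 hC (sampling_matrix_le i b y d0 hs).
have t12 : x1 / d != x2 / d by apply: contra x12 => /eqP h; rewrite -(dx x1) h dx.
have s1 := @band_divdiff R w W n T N MT hw hW tT i b y d _ _ 0 d0 dn t12 jx2.
rewrite /= !addr0 !dx in s1.
have s2 (j : int) : sums (fun l : int => k (x2 / d - 2^-1 - l%:~R) * ((G (d * (l%:~R + 2^-1)) - G (d * j%:~R)) / (l%:~R - (j%:~R - 2^-1))))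
    ((G x2 - G (d * j%:~R)) / (x2 / d - j%:~R)).
  have tc : x2 / d - 2^-1 != j%:~R - 2^-1.
    by apply: contra (jx2 j) => /eqP h; apply/eqP; lra.
  have jc (l : int) : l%:~R != j%:~R - 2^-1 :> R.
    apply/eqP => h; have := @half_int_ge R (j - l); rewrite intrB h.
    by rewrite (_ : j%:~R - (j%:~R - 2^-1) - 2^-1 = 0) ?normr0 ?lerNgt ?invr_gt0 //; [lra|ring].
  have := @band_divdiff R w W n T N MT hw hW tT i b y d _ _ 2^-1 d0 dn tc jc; rewrite /= !subrK dx -/(G _) -/(G _).
  have -> : x2 / d - 2^-1 - (j%:~R - 2^-1) = x2 / d - j%:~R by ring.
  by [].
apply: (@sums_pair _ _ _ _ (fun j : int => d^-1 * (k (x1 / d - j%:~R) * ((G (d * j%:~R) - G x2) / (j%:~R - x2 / d)))) _ _ D).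
  move=> j; have := sumsZ (d^-1 * k (x1 / d - j%:~R)) (s2 j).
  rewrite (_ : d^-1 * _ * _ = d^-1 * (k (x1 / d - j%:~R) * ((G (d * j%:~R) - G x2) / (j%:~R - x2 / d)))); last first.
    rewrite -mulrA; congr (_ * (_ * _)).
    by rewrite -(opprB (G (d * j%:~R))) -(opprB (j%:~R) (x2 / d)) invrN mulrNN.
  apply: eq_sums => l /=; rewrite /sampling_matrix /= /hilbert -/(G _) -/(G _).
  rewrite -(opprB (G (d * j%:~R))) (_ : l%:~R - _ = - (j%:~R - l%:~R - 2^-1)); last by ring.
  by rewrite invrN mulrNN /k; ring.
have -> : (G x1 - G x2) / (x1 - x2) = d^-1 * ((G x1 - G x2) / (x1 / d - x2 / d)).
  by rewrite -mulrBl invfM invrK [RHS]mulrC -[RHS]mulrA -[X in _ = _ * X]mulrA divff // mulr1.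
by apply: eq_sums (sumsZ d^-1 s1) => j /=; rewrite addr0.
Qed.

(** The values of [x2] on the grid, excluded in the generic case, are reached by letting a generic
    point tend to [x2]: both the quotient and the double series are continuous there. *)
Lemma twofold_sampling i b y d s x1 x2 : 0 < d -> d * (2 * 2 ^ n) <= 1 ->
  (forall x, Cabs (g x) <= s) -> x1 != x2 ->
  let G (x : R) := cpart b (g (pt i x y)) in
  sums (fun p : int * int => k (x1 / d - p.1%:~R) * k (x2 / d - 2^-1 - p.2%:~R) * sampling_matrix i b y d p)
    ((G x1 - G x2) / (x1 - x2)).
Proof.
move=> d0 dn hs x12 G.
have [C C0 hC] := @kernel_decay2 N.+2 isT.
have hm := sampling_matrix_le i b y d0 hs.
have D := double_series_bounded (x1 / d) (x2 / d - 2^-1) C0 hC hm.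
have [l hl] := sums_exist D.
suff <- : l = (G x1 - G x2) / (x1 - x2) by [].
have cG : continuous G.
  move=> x; exact: (@continuous_comp _ _ _ (fun x => pt i x y) (fun z => cpart b (g z)) x (@continuous_pt R i y x) (@conv_continuous R w W n T N MT hW tT b _)).
have h1 : (fun x => (G x1 - G x) / (x1 - x)) @ x2^' --> (G x1 - G x2) / (x1 - x2).
  apply: cvgM.
    by apply: cvgB; [exact: cvg_cst|exact: cvg_within_filter (cG x2)].
  apply: cvgV; first by rewrite subr_eq0.
  by apply: cvgB; [exact: cvg_cst|exact: cvg_within_filter cvg_id].
have h2 : (fun x => (G x1 - G x) / (x1 - x)) @ x2^' --> l.
  apply: (double_series_continuous (c := sampling_matrix i b y d) (X1 := fun=> x1 / d) (X2 := fun x => x / d - 2^-1) _ C0 (@continuous_skernel N.+2) hC hm _ _ _ hl).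
  - exact: cvg_cst.
  - apply: cvgB; last exact: cvg_cst.
    by apply: cvgM; [exact: cvg_within_filter cvg_id|exact: cvg_cst].
  (* A punctured neighbourhood of [x2] avoids the grid, whether or not [x2] itself lies on it. *)
  have [e e0 he] : exists2 e, 0 < e & forall j : int, j%:~R != x2 / d -> e <= `|j%:~R - x2 / d|.
    have [[j hj]|H] := pselect (exists j : int, j%:~R = x2 / d).
      exists 1 => // k'; rewrite -hj eqr_int -subr_eq0 -intrB -intr_norm ler1z => kj.
      by lia.
    have jx : forall j : int, j%:~R != x2 / d by move=> j; apply/eqP => hj; apply: H; exists j.
    have [e e0 he] := dist_int_gt0 jx.
    by exists e => // j _; exact: he.
  near=> x; apply: (@twofold_sampling_generic i b y d s x1 x) => //.
    rewrite eq_sym; near: x; apply: nbhs_dnbhs; apply: open_neq; by rewrite /= eq_sym.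
  move=> j; apply/eqP => jx.
  have jx2 : j%:~R != x2 / d.
    rewrite jx; apply/eqP => h; have : x != x2 by near: x; exact: nbhs_dnbhs_neq.
    by move/eqP; apply; rewrite -[x](divfK (lt0r_neq0 d0)) h divfK // lt0r_neq0.
  have := he j jx2; rewrite jx -mulrBl normrM normfV (gtr0_norm d0) ler_pdivlMr // leNgt => /negP; apply.
  rewrite distrC; near: x; apply: nbhs_dnbhs; apply: (@nbhsx_ballx _ _ x2 (e * d)); exact: mulr_gt0.
exact: (cvg_unique _ h2 h1).
Unshelve. all: by end_near. Qed.

End Band.
End TwofoldSampling.

(** * Recovering differences of [f] from the dyadic blocks *)

Section GaussianTestFunctions.
Context {R : realType}.
Implicit Types (lam x t r : R) (P Q : {poly R}) (i b : bool).
Let mu := @lebesgue_measure R.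

Definition gau lam x := expR (- (lam * x ^+ 2)).
(** [P] is an arbitrary polynomial. The class is closed under differentiation, through [dpoly], so
    its Schwartz bounds reduce to those of a Gaussian. *)
Definition hermite lam P x := P.[x] * gau lam x.
Definition gprod lam P Q (p : R * R) : R[i] := (hermite lam P p.1 * hermite lam Q p.2)%:C.

Lemma is_derive_gau lam x : is_derive x 1 (gau lam) (- (2 * lam) * x * gau lam x).
Proof.
rewrite /gau; apply: is_derive_eq; rewrite /GRing.scale /=; ring.
Qed.

Definition dpoly lam P : {poly R} := P^`() - (2 * lam) *: ('X * P).

Lemma is_derive_hermite lam P x : is_derive x 1 (hermite lam P) (hermite lam (dpoly lam P) x).
Proof.
have h1 := is_derive_poly P x; have h2 := is_derive_gau lam x.
have h := is_deriveM h1 h2; apply: is_derive_eq h _.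
by rewrite /hermite /dpoly !hornerE /GRing.scale /=; ring.
Qed.

Lemma continuous_hermite lam P : continuous (hermite lam P).
Proof.
move=> x; apply: differentiable_continuous; apply/derivable1_diffP.
by apply: ex_derive; exact: is_derive_hermite.
Qed.

(** The exponential dominates its Taylor term of degree [m + 1] in [lam x ^ 2]. The 4 is the product
    of two factors 2, from [1 + |x| <= 2 (1 + x ^ 2)] and from [(1 + t) ^ (m + 1) <= 2 ^ (m + 1) (1
    + t ^ (m + 1))]. *)
Lemma gau_bound lam (m : nat) : 0 < lam -> exists B, forall x, (1 + `|x|) ^+ m * gau lam x <= B.
Proof.
move=> l0; exists (4 ^+ m.+1 * (1 + (m.+1)`!%:R / lam ^+ m.+1)) => x.
set t := x ^+ 2; have t0 : 0 <= t by exact: sqr_ge0.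
have x1 : 1 <= 1 + `|x| by rewrite lerDl.
have x2 : 1 + `|x| <= 2 * (1 + t).
  have := sqr_ge0 (`|x| - 1); rewrite /t -(real_normK (num_real x)); nra.
have pw (a : R) : 0 <= a -> (1 + a) ^+ m.+1 <= 2 ^+ m.+1 * (1 + a ^+ m.+1).
  move=> a0; have [a1|a1] := lerP a 1.
    apply: (@le_trans _ _ (2 ^+ m.+1)); last by rewrite ler_peMr ?exprn_ge0 // lerDl exprn_ge0.
    by apply: lerXn2r; rewrite ?nnegrE; lra.
  apply: (@le_trans _ _ ((2 * a) ^+ m.+1)).
    by apply: lerXn2r; rewrite ?nnegrE; lra.
  by rewrite exprMn ler_wpM2l ?exprn_ge0 // lerDr.
have {}pw := pw t t0.
have E0 : 0 < expR (lam * t) by exact: expR_gt0.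
rewrite /gau expRN ler_pdivrMr //.
apply: (@le_trans _ _ (4 ^+ m.+1 * (1 + t ^+ m.+1))).
  apply: (@le_trans _ _ ((1 + `|x|) ^+ m.+1)); first by rewrite ler_weXn2l.
  apply: (@le_trans _ _ ((2 * (1 + t)) ^+ m.+1)).
    by rewrite lerXn2r ?nnegrE ?mulr_ge0 ?addr_ge0.
  rewrite exprMn (_ : 4 ^+ m.+1 = 2 ^+ m.+1 * 2 ^+ m.+1 :> R).
    2: by rewrite -exprMn; congr (_ ^+ _); ring.
  rewrite -mulrA.
  by rewrite ler_wpM2l ?exprn_ge0.
rewrite -mulrA ler_wpM2l ?exprn_ge0 // mulrDl mul1r lerD //.
  by rewrite -expR0 ler_expR mulr_ge0 // ltW.
have := expR_ge1Dxn m (mulr_ge0 (ltW l0) t0).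
rewrite exprMn => h; have {}h : lam ^+ m.+1 * t ^+ m.+1 / (m.+1)`!%:R <= expR (lam * t) by lra.
have f0 : 0 < (m.+1)`!%:R :> R by rewrite ltr0n fact_gt0.
have L0 : 0 < lam ^+ m.+1 by rewrite exprn_gt0.
move: h; rewrite ler_pdivrMr // => h.
by rewrite mulrAC ler_pdivlMr // mulrC [X in _ <= X]mulrC.
Qed.

Lemma hermite_bound lam (m : nat) P : 0 < lam -> exists B, forall x, (1 + `|x|) ^+ m * `|hermite lam P x| <= B.
Proof.
move=> l0; elim/poly_ind: P m => [|P c IH] m.
  by exists 0 => x; rewrite /hermite horner0 mul0r normr0 mulr0.
have [B hB] := IH m.+1; have [D hD] := gau_bound m l0.
exists (B + `|c| * D) => x.
have p0 : 0 <= (1 + `|x|) ^+ m by rewrite exprn_ge0 // addr_ge0.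
have g0 : 0 <= gau lam x by exact: expR_ge0.
rewrite /hermite !hornerE mulrDl; apply: le_trans (ler_wpM2l p0 (ler_normD _ _)) _.
rewrite mulrDr lerD //.
  apply: le_trans (hB x); rewrite exprSr -mulrA ler_wpM2l //.
  rewrite /hermite !normrM; have := normr_ge0 x; have := normr_ge0 P.[x]; have := normr_ge0 (gau lam x).
  set u := `|P.[x]|; set v := `|gau _ _|; set s := `|x| => v0 u0 s0.
  rewrite (_ : u * s * v = s * (u * v)); last by ring.
  by rewrite ler_wpM2r ?mulr_ge0 // lerDr.
by rewrite normrM (ger0_norm g0) mulrCA ler_wpM2l.
Qed.

Lemma prod_derive i (u v u' v' : R -> R) p :
  (forall x, is_derive x 1 u (u' x)) -> (forall x, is_derive x 1 v (v' x)) ->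
  is_derive p (dir i) (fun q : R * R => u q.1 * v q.2) (if i then u p.1 * v' p.2 else u' p.1 * v p.2).
Proof.
move=> hu hv; case: i.
  have E : (fun h : R => h^-1 *: (((fun q : R * R => u q.1 * v q.2) \o shift p) (h *: dir true) - u p.1 * v p.2)) =
      (fun h : R => h^-1 *: (((u p.1 *: v) \o shift p.2) (h *: 1) - (u p.1 *: v) p.2)).
    by apply/funext => h; rewrite /= [h *: 0]mulr0 add0r.
  have d : is_derive p.2 1 (u p.1 *: v) (u p.1 *: v' p.2) by exact: is_deriveZ.
  by split; rewrite /derivable /derive E; [apply: ex_derive; exact: d|have [_ e] := d; exact: e].
have E : (fun h : R => h^-1 *: (((fun q : R * R => u q.1 * v q.2) \o shift p) (h *: dir false) - u p.1 * v p.2)) =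
    (fun h : R => h^-1 *: (((v p.2 *: u) \o shift p.1) (h *: 1) - (v p.2 *: u) p.1)).
  by apply/funext => h; rewrite /= [h *: 0]mulr0 add0r; congr (_ *: (_ - _)); rewrite mulrC.
have d : is_derive p.1 1 (v p.2 *: u) (v p.2 *: u' p.1) by exact: is_deriveZ.
by split; rewrite /derivable /derive E; [apply: ex_derive; exact: d|have [_ e] := d; rewrite [RHS]mulrC; exact: e].
Qed.

Lemma gprod_derive i lam P Q p : is_derive p (dir i) (fun q => cpart false (gprod lam P Q q))
  (cpart false (gprod lam (if i then P else dpoly lam P) (if i then dpoly lam Q else Q) p)).
Proof.
have := prod_derive i p (is_derive_hermite lam P) (is_derive_hermite lam Q).
by case: i.
Qed.

Lemma pderiv_gprod i lam P Q :
  pderiv i (gprod lam P Q) = gprod lam (if i then P else dpoly lam P) (if i then dpoly lam Q else Q).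
Proof.
apply/funext => p; have [_ e] := gprod_derive i lam P Q p.
rewrite /pderiv; rewrite /cpart in e; rewrite e.
by rewrite (_ : (fun q => complex.Im (gprod lam P Q q)) = cst 0) // derive_cst /gprod; case: (i).
Qed.

Lemma pderivs_gprod s lam P Q : exists P' Q', pderivs s (gprod lam P Q) = gprod lam P' Q'.
Proof.
elim: s => [|i s [P' [Q' IH]]]; first by exists P, Q.
by rewrite /= IH pderiv_gprod; eexists; eexists.
Qed.

Lemma schwartz_gprod lam P Q : 0 < lam -> schwartz (gprod lam P Q).
Proof.
move=> l0; apply/schwartzP; split.
- move=> b s; have [P' [Q' ->]] := pderivs_gprod s lam P Q.
  case: b; first by move=> p; exact: cvg_cst.
  move=> p; apply: cvgM.
    by apply: (@continuous_comp _ _ _ (fun p : R * R => p.1) (hermite lam P')); [exact: cvg_fst|exact: continuous_hermite].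
  by apply: (@continuous_comp _ _ _ (fun p : R * R => p.2) (hermite lam Q')); [exact: cvg_snd|exact: continuous_hermite].
- move=> b s d p; have [P' [Q' ->]] := pderivs_gprod s lam P Q.
  case: b; first exact: derivable_cst.
  by have [] := gprod_derive d lam P' Q' p.
move=> m s b; have [P' [Q' ->]] := pderivs_gprod s lam P Q.
have [B1 h1] := hermite_bound m P' l0; have [B2 h2] := hermite_bound m Q' l0.
exists (B1 * B2) => p.
have x1 := normr_ge0 p.1; have x2 := normr_ge0 p.2.
have n12 : 1 + norm2 p <= (1 + `|p.1|) * (1 + `|p.2|).
  have : norm2 p <= `|p.1| + `|p.2|.
    rewrite -(@ler_pXn2r _ 2) ?nnegrE ?addr_ge0 ?norm2_ge0 // norm2_sqr -(real_normK (num_real p.1)) -(real_normK (num_real p.2)); nra.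
  by nra.
have B10 : 0 <= B1 by apply: le_trans (h1 0); rewrite mulr_ge0 // exprn_ge0 // addr_ge0.
case: b; first by rewrite /= normr0 mulr0 mulr_ge0 //; apply: le_trans (h2 0); rewrite mulr_ge0 // exprn_ge0 // addr_ge0.
rewrite /= normrM; apply: (@le_trans _ _ (((1 + `|p.1|) ^+ m * `|hermite lam P' p.1|) * ((1 + `|p.2|) ^+ m * `|hermite lam Q' p.2|))).
  rewrite mulrACA -exprMn ler_wpM2r ?mulr_ge0 // lerXn2r ?nnegrE ?mulr_ge0 ?addr_ge0 ?norm2_ge0 //.
by rewrite ler_pM // mulr_ge0 // exprn_ge0 // addr_ge0.
Qed.

End GaussianTestFunctions.

(** * Pairings with Gaussians and their dependence on the centre *)

Section GaussianPairing.
Context {R : realType}.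
Implicit Types (lam x t r s : R) (P Q : {poly R}) (i b : bool) (h : R * R -> R) (y z : R * R).
Let mu := @lebesgue_measure R.

Lemma expR_taylor2 s : `|expR s - 1 - s| <= s ^+ 2 * expR `|s|.
Proof.
have h1 := expR_ge1Dx s; have h2 := expR_ge1Dx (- s); have e0 := expR_gt0 s.
have h3 : expR s - 1 <= s * expR s.
  have : (1 + - s) * expR s <= expR (- s) * expR s by rewrite ler_pM2r.
  by rewrite -expRD addNr expR0; nra.
rewrite ger0_norm; last lra.
have [s0|s0] := lerP 0 s; first by rewrite ger0_norm //; nra.
have : 1 <= expR `|s| by rewrite -expR0 ler_expR.
move: (expR `|s|) => E hE; nra.
Qed.

Lemma sqr_le_expR x : 0 <= x -> x ^+ 2 <= 2 * expR x.
Proof.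
move=> x0; have := expR_ge1Dxn 1 x0; rewrite (_ : (2`!)%:R = 2 :> R) //.
by move=> ?; lra.
Qed.

(** Writing [gau lam (x + d) = gau lam x * expR s], the growth in [x] of the second-order remainder
    of [expR s] is absorbed by half of the Gaussian decay, leaving the wider Gaussian as
    majorant. *)
Lemma gau_taylor lam D : 0 < lam -> 0 <= D -> exists2 A, 0 <= A & forall x d, `|d| <= D ->
  `|gau lam (x + d) - gau lam x + 2 * lam * x * d * gau lam x| <= d ^+ 2 * A * gau (lam / 2) x.
Proof.
(* [c] comes from completing the square, [lam / 2 * (|x| - 2 (1 + D)) ^ 2 >= 0]. *)
move=> l0 D0; pose c := 2 * lam * (1 + D) ^+ 2 + lam * D * (1 + D).
exists ((2 + lam) * expR c) => [|x d hd]; first by rewrite mulr_ge0 ?expR_ge0 //; lra.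
pose s := - (2 * lam * x * d) - lam * d ^+ 2; pose u := 2 * lam * `|x| + lam * D.
have u0 : 0 <= u by rewrite /u; have := normr_ge0 x; nra.
have -> : gau lam (x + d) = gau lam x * expR s by rewrite /gau -expRD; congr expR; rewrite /s; ring.
have -> : gau lam x * expR s - gau lam x + 2 * lam * x * d * gau lam x =
    gau lam x * ((expR s - 1 - s) - lam * d ^+ 2) by rewrite /s; ring.
have g0 : 0 < gau lam x by exact: expR_gt0.
rewrite normrM (gtr0_norm g0).
have hs : `|s| <= `|d| * u.
  rewrite /s -opprD normrN (_ : 2 * lam * x * d + lam * d ^+ 2 = d * (2 * lam * x + lam * d)); last by ring.
  rewrite normrM ler_wpM2l // (le_trans (ler_normD _ _)) // /u lerD //.
    by rewrite normrM ger0_norm // mulr_ge0 // ltW.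
  by rewrite normrM (gtr0_norm l0) ler_wpM2l // ltW.
have hs2 : s ^+ 2 <= d ^+ 2 * u ^+ 2.
  by rewrite -exprMn -(real_normK (num_real s)) -[leRHS](real_normK (num_real _)) lerXn2r ?nnegrE // normrM (ger0_norm u0).
have hE : expR `|s| <= expR (D * u).
  by rewrite ler_expR (le_trans hs) // ler_wpM2r.
have hu := sqr_le_expR u0.
have E1 : 1 <= expR ((1 + D) * u) by rewrite -expR0 ler_expR mulr_ge0 // addr_ge0.
have step : `|expR s - 1 - s - lam * d ^+ 2| <= d ^+ 2 * ((2 + lam) * expR ((1 + D) * u)).
  apply: le_trans (ler_normB _ _) _; rewrite (ger0_norm (_ : 0 <= lam * d ^+ 2)); last by rewrite mulr_ge0 ?sqr_ge0 // ltW.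
  rewrite mulrDl mulrDr lerD //.
    apply: le_trans (expR_taylor2 s) _; apply: le_trans (ler_pM (sqr_ge0 s) (expR_ge0 _) hs2 hE) _.
    rewrite -mulrA ler_wpM2l ?sqr_ge0 // (_ : (1 + D) * u = u + D * u); last by ring.
    by rewrite expRD mulrA ler_wpM2r ?expR_ge0.
  by rewrite mulrC ler_wpM2l ?sqr_ge0 // ler_peMr // ltW.
apply: le_trans (ler_wpM2l (ltW g0) step) _.
have key : gau lam x * expR ((1 + D) * u) <= expR c * gau (lam / 2) x.
  rewrite /gau -!expRD ler_expR /u /c.
  have : 0 <= lam / 2 * (`|x| - 2 * (1 + D)) ^+ 2 by rewrite mulr_ge0 ?sqr_ge0 //; lra.
  rewrite -(real_normK (num_real x)); set X := `|x|; lra.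
rewrite (_ : gau lam x * _ = (d ^+ 2 * (2 + lam)) * (gau lam x * expR ((1 + D) * u))); last by ring.
rewrite (_ : _ * gau (lam / 2) x = (d ^+ 2 * (2 + lam)) * (expR c * gau (lam / 2) x)); last by ring.
by rewrite ler_wpM2l // mulr_ge0 ?sqr_ge0 //; lra.
Qed.

Lemma gau_shift lam r s : 0 < lam -> gau lam (r - s) <= expR (lam * r ^+ 2) * gau (lam / 2) s.
Proof.
move=> l0; rewrite /gau -expRD ler_expR.
have : 0 <= lam / 2 * (2 * r - s) ^+ 2 by rewrite mulr_ge0 ?sqr_ge0 //; lra.
lra.
Qed.

Lemma gau_le lam lam' x : lam' <= lam -> gau lam x <= gau lam' x.
Proof. by move=> h; rewrite ler_expR lerN2 ler_wpM2r ?sqr_ge0. Qed.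

Definition tst lam P Q z y := hermite lam P (z.1 - y.1) * hermite lam Q (z.2 - y.2).

(** Derivative of [tst lam 1 1 z y] in the centre [z] along direction [i], hence minus its
    derivative in [y]. *)
Definition dtst i lam z := tst lam (if i then 1 else dpoly lam 1) (if i then dpoly lam 1 else 1) z.

Definition pairable h := forall lam P Q z, 0 < lam ->
  (mu \x mu)%E.-integrable setT (EFin \o (fun y => h y * tst lam P Q z y)).

Lemma hermite1 lam x : hermite lam 1 x = gau lam x.
Proof. by rewrite /hermite hornerE mul1r. Qed.

Lemma hermite_dpoly1 lam x : hermite lam (dpoly lam 1) x = - (2 * lam * x * gau lam x).
Proof. by rewrite /hermite /dpoly -[1]polyC1 derivC !hornerE /GRing.scale /=; ring. Qed.

Lemma tst_ge0 lam z y : 0 <= tst lam 1 1 z y.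
Proof. by rewrite /tst !hermite1 mulr_ge0 ?expR_ge0. Qed.

(** The exponent is halved twice, by the Taylor estimate and by recentring at 0; the resulting
    majorant with [lam / 4] does not depend on [t], [r] or [d]. *)
Lemma tst_taylor lam D i : 0 < lam -> 0 <= D -> exists2 A, 0 <= A & forall t r d y,
  `|t| <= D -> `|r| <= D -> `|d| <= D ->
  `|tst lam 1 1 (pt i (t + d) r) y - tst lam 1 1 (pt i t r) y - d * dtst i lam (pt i t r) y|
    <= d ^+ 2 * A * tst (lam / 4) 1 1 0 y.
Proof.
move=> l0 D0; have [A A0 hA] := gau_taylor l0 D0.
have l2 : 0 < lam / 2 by lra.
pose B := expR (lam / 2 * D ^+ 2) * expR (lam * D ^+ 2).
have B0 : 0 <= B by rewrite mulr_ge0 ?expR_ge0.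
exists (A * B) => [|t r d y ht hr hd]; first by rewrite mulr_ge0.
have gN x : gau (lam / 4) (0 - x) = gau (lam / 4) x by rewrite /gau sub0r sqrrN.
have core (a c : R) : `|gau lam (t + d - a) * gau lam (r - c) - gau lam (t - a) * gau lam (r - c)
    - d * (- (2 * lam * (t - a) * gau lam (t - a)) * gau lam (r - c))| <=
    d ^+ 2 * (A * B) * (gau (lam / 4) a * gau (lam / 4) c).
  have -> : gau lam (t + d - a) * gau lam (r - c) - gau lam (t - a) * gau lam (r - c)
      - d * (- (2 * lam * (t - a) * gau lam (t - a)) * gau lam (r - c)) =
     (gau lam (t - a + d) - gau lam (t - a) + 2 * lam * (t - a) * d * gau lam (t - a)) * gau lam (r - c).
    by rewrite -(addrAC t (- a) d); ring.
  rewrite normrM (ger0_norm (_ : 0 <= gau lam (r - c))); last exact: expR_ge0.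
  have h1 := hA (t - a) d hd; have h2 := gau_shift t a l2; have h3 := gau_shift r c l0.
  have d20 : 0 <= d ^+ 2 * A by rewrite mulr_ge0 ?sqr_ge0.
  have m1 (l q : R) : 0 < l -> `|q| <= D -> expR (l * q ^+ 2) <= expR (l * D ^+ 2).
    by move=> lp qD; rewrite ler_expR ler_wpM2l ?(ltW lp) // -(real_normK (num_real q)) lerXn2r ?nnegrE.
  apply: (@le_trans _ _ (d ^+ 2 * A * (expR (lam / 2 * D ^+ 2) * gau (lam / 4) a) * (expR (lam * D ^+ 2) * gau (lam / 4) c))).
    apply: ler_pM => //; first exact: expR_ge0.
      apply: le_trans h1 _; rewrite ler_wpM2l //; apply: le_trans h2 _.
      have -> : lam / 2 / 2 = lam / 4 by field.
      by rewrite ler_wpM2r ?expR_ge0 // m1.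
    apply: le_trans h3 _; apply: ler_pM; [exact: expR_ge0|exact: expR_ge0|exact: m1|].
    by apply: gau_le; clear -l0; lra.
  by rewrite /B le_eqVlt; apply/orP; left; apply/eqP; ring.
rewrite /dtst /tst; case: i => /=; rewrite !hermite1 !hermite_dpoly1 !gN.
  have := core y.2 y.1; rewrite [gau (lam / 4) y.2 * _]mulrC; congr (`|_| <= _).
  ring.
exact: core.
Qed.

Lemma continuous_tst lam P Q z : continuous (tst lam P Q z).
Proof.
move=> y; apply: cvgM.
  apply: (continuous_cvg _ (@continuous_hermite R lam P (z.1 - y.1))).
  by apply: cvgB; [exact: cvg_cst|exact: cvg_fst].
apply: (continuous_cvg _ (@continuous_hermite R lam Q (z.2 - y.2))).
by apply: cvgB; [exact: cvg_cst|exact: cvg_snd].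
Qed.

Lemma tst_growth lam P Q z h K : 0 < lam -> (forall y, `|h y| <= K * (1 + norm2 y)) ->
  exists B, decays2 (fun y => h y * tst lam P Q z y) B.
Proof.
move=> l0 hK.
have [B B0 hB] := schwartz_bound 5 [::] (schwartz_refl z (@schwartz_gprod R lam P Q l0)).
have K0 : 0 <= K by have := le_trans (normr_ge0 _) (hK 0); rewrite pmulr_lge0 // ltr_wpDr ?norm2_ge0.
exists (K * B); apply: decays2_of_bound => y; have := hB y false; rewrite /= -/(tst lam P Q z y) => H.
rewrite normrM; have n0 := norm2_ge0 y.
apply: (@le_trans _ _ ((1 + norm2 y) ^+ 4 * (K * (1 + norm2 y) * `|tst lam P Q z y|))).
  by rewrite ler_wpM2l ?exprn_ge0 ?addr_ge0 // ler_wpM2r.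
rewrite (_ : _ * _ = K * ((1 + norm2 y) ^+ 5 * `|tst lam P Q z y|)); last by ring.
by rewrite ler_wpM2l.
Qed.

Lemma pairable_growth h K : continuous h -> (forall y, `|h y| <= K * (1 + norm2 y)) -> pairable h.
Proof.
move=> ch hK lam P Q z l0; have [B hB] := tst_growth P Q z l0 hK.
apply: decays2_integrable hB; apply: continuous2_measurable => y.
by apply: cvgM; [exact: ch|exact: continuous_tst].
Qed.

Lemma pairable_cst (c : R) : pairable (fun=> c).
Proof.
apply: (@pairable_growth _ `|c|); first by move=> y; exact: cvg_cst.
by move=> y; rewrite ler_peMr // lerDl norm2_ge0.
Qed.

Lemma pairableB h h' : pairable h -> pairable h' -> pairable (fun y => h y - h' y).
Proof.
move=> p1 p2 lam P Q z l0; have := integrableRB (p1 lam P Q z l0) (p2 lam P Q z l0).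
by congr (_.-integrable _ _); apply/funext => y /=; rewrite mulrBl.
Qed.

Local Notation pairing h phi := (Rintegral (mu \x mu)%E setT (fun y => h y * phi y)).

Lemma pairing_taylor h lam D i r : 0 < lam -> 0 <= D -> pairable h -> `|r| <= D ->
  exists C, forall t d, `|t| <= D -> `|d| <= D ->
  `|pairing h (tst lam 1 1 (pt i (t + d) r)) - pairing h (tst lam 1 1 (pt i t r))
    - d * pairing h (dtst i lam (pt i t r))| <= C * d ^+ 2.
Proof.
move=> l0 D0 ph hr; have [A A0 hA] := tst_taylor i l0 D0.
have l4 : 0 < lam / 4 by lra.
pose I0 := Rintegral (mu \x mu)%E setT (fun y => `|h y * tst (lam / 4) 1 1 0 y|).
exists (A * I0) => t d ht hd.
have i1 := ph lam 1 1 (pt i (t + d) r) l0; have i2 := ph lam 1 1 (pt i t r) l0.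
have i3 : (mu \x mu)%E.-integrable setT (EFin \o (fun y => h y * dtst i lam (pt i t r) y)) by exact: ph.
have i4 := integrable_norm (ph (lam / 4) 1 1 0 l4).
have i12 := integrableRB i1 i2; have i3' := integrableRZ d i3; have i123 := integrableRB i12 i3'.
rewrite -RintegralB // -RintegralZl // -RintegralB //.
apply: le_trans (le_normr_Rintegral _ i123) _ => //.
have i5 := integrableRZ (d ^+ 2 * A) i4.
rewrite (_ : A * I0 * d ^+ 2 = d ^+ 2 * A * I0); last by ring.
rewrite -RintegralZl //; apply: le_Rintegral => //; first exact: integrable_norm i123.
move=> y _; rewrite (_ : h y * _ - _ - _ = h y * (tst lam 1 1 (pt i (t + d) r) y - tst lam 1 1 (pt i t r) y - d * dtst i lam (pt i t r) y)); last by ring.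
have -> : `|h y * tst (lam / 4) 1 1 0 y| = `|h y| * tst (lam / 4) 1 1 0 y.
  by rewrite normrM (ger0_norm (tst_ge0 _ _ _)).
rewrite normrM [leRHS]mulrCA ler_wpM2l //.
exact: hA.
Qed.

(** Gaussians are multiples of normal densities, from which integrability and total mass are
    inherited. *)
Lemma gau_normal lam t : 0 < lam ->
  (fun x => gau lam (t - x)) = (fun x => Num.sqrt (pi / lam) * normal_pdf t (Num.sqrt (2 * lam)^-1) x).
Proof.
move=> l0; set s := Num.sqrt (2 * lam)^-1.
have s2 : s ^+ 2 = (2 * lam)^-1 by rewrite sqr_sqrtr // invr_ge0 mulr_ge0 // ltW.
have s0 : s != 0 by rewrite gt_eqF // sqrtr_gt0 invr_gt0 mulr_gt0.
have lN0 : lam != 0 by rewrite gt_eqF.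
have -> : Num.sqrt (pi / lam) = (normal_peak s)^-1.
  rewrite /normal_peak invrK s2; congr Num.sqrt; rewrite -mulr_natr.
  have E (P : R) : P / lam = (2 * lam)^-1 * P * 2%:R by field.
  exact: E.
apply/funext => x; rewrite normal_pdfE // mulKf ?gt_eqF ?normal_peak_gt0 // /normal_fun /gau s2; congr expR.
rewrite -mulr_natr; field; exact: lN0.
Qed.

Lemma integrable_gau lam t : 0 < lam -> mu.-integrable setT (EFin \o (fun x => gau lam (t - x))).
Proof. by move=> l0; rewrite gau_normal //; apply: integrableRZ; exact: integrable_normal_pdf. Qed.

Lemma integral_gau lam t : 0 < lam ->
  Rintegral mu setT (fun x => gau lam (t - x)) = Num.sqrt (pi / lam).
Proof.
move=> l0; rewrite gau_normal // RintegralZl //; last exact: integrable_normal_pdf.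
by rewrite /Rintegral integral_normal_pdf /= mulr1.
Qed.

Lemma pairing_cst i lam t r : 0 < lam -> pairing (fun=> 1) (tst lam 1 1 (pt i t r)) = pi / lam.
Proof.
move=> l0.
have [B hB] : exists B, decays2 (fun y => 1 * tst lam 1 1 (pt i t r) y) B.
  by apply: (@tst_growth _ _ _ _ _ 1) => // y; rewrite normr1 mul1r lerDl norm2_ge0.
have c : continuous (fun y => 1 * tst lam 1 1 (pt i t r) y).
  by move=> y; apply: cvgM; [exact: cvg_cst|exact: continuous_tst].
rewrite (Rintegral_slices i c (continuous2_measurable c) hB).
have E q x : 1 * tst lam 1 1 (pt i t r) (pt i x q) = gau lam (r - q) * gau lam (t - x).
  by rewrite mul1r /tst !hermite1 /pt; case: (i) => //=; rewrite mulrC.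
have E' q : Rintegral mu setT (fun x => 1 * tst lam 1 1 (pt i t r) (pt i x q)) = Num.sqrt (pi / lam) * gau lam (r - q).
  transitivity (Rintegral mu setT (fun x => gau lam (r - q) * gau lam (t - x))).
    by apply: eq_Rintegral => x _; exact: E.
  by rewrite RintegralZl ?integral_gau ?(mulrC (gau _ _)) //; exact: integrable_gau.
transitivity (Rintegral mu setT (fun q => Num.sqrt (pi / lam) * gau lam (r - q))).
  by apply: eq_Rintegral => q _; exact: E'.
rewrite RintegralZl //; last exact: integrable_gau.
by rewrite integral_gau // -expr2 sqr_sqrtr // divr_ge0 ?pi_ge0 // ltW.
Qed.

(* The Gaussian integrals do not depend on the centre, so the linear term of the Taylor
   expansion vanishes. *)
Lemma pairing_dcst i lam t r : 0 < lam -> pairing (fun=> 1) (dtst i lam (pt i t r)) = 0.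
Proof.
move=> l0; pose D := 1 + `|t| + `|r|.
have D1 : 1 <= D by rewrite /D -addrA lerDl addr_ge0.
have D0 : 0 <= D by lra.
have ht : `|t| <= D by rewrite /D; have := normr_ge0 r; lra.
have hr : `|r| <= D by rewrite /D; have := normr_ge0 t; lra.
have [C hC] := pairing_taylor i l0 D0 (pairable_cst 1) hr.
set J := Rintegral _ _ _.
have C0 : 0 <= C by have := hC 0 1; rewrite normr0 normr1 expr1n mulr1 => /(_ D0 D1); apply: le_trans.
apply/eqP; rewrite -normr_le0; apply/ler_addgt0Pl => e e0; rewrite addr0.
pose d := Num.min 1 (e / (C + 1)).
have d0 : 0 < d by rewrite lt_min ltr01 divr_gt0 // ltr_wpDl.
have d1 : d <= 1 by rewrite ge_min lexx.
have d2 : d <= e / (C + 1) by rewrite ge_min lexx orbT.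
have := hC t d ht; rewrite (gtr0_norm d0) => /(_ (le_trans d1 D1)).
rewrite !pairing_cst // subrr sub0r normrN normrM (gtr0_norm d0) -/J expr2 mulrCA ler_pM2l // => h.
apply: le_trans h _; rewrite ler_pdivlMr ?ltr_wpDl // in d2; nra.
Qed.

(** Without its linear term the Taylor estimate is purely quadratic in the displacement, so
    [quadratic_const] applies. *)
Lemma pairing_const h lam i t t' r : 0 < lam -> pairable h ->
  (forall t, pairing h (dtst i lam (pt i t r)) = 0) ->
  pairing h (tst lam 1 1 (pt i t r)) = pairing h (tst lam 1 1 (pt i t' r)).
Proof.
move=> l0 ph h0.
wlog tt' : t t' / t <= t' by move=> H; have [?|/ltW ?] := lerP t t'; [exact: H|exact/esym/H].
pose D := 2 * (`|t| + `|t'|) + `|r|.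
have n1 := normr_ge0 t; have n2 := normr_ge0 t'; have n3 := normr_ge0 r.
have D0 : 0 <= D by rewrite /D; lra.
have hr : `|r| <= D by rewrite /D; lra.
have [C hC] := pairing_taylor i l0 D0 ph hr.
apply: (@quadratic_const R (fun t => pairing h (tst lam 1 1 (pt i t r))) C) => // x y /andP[x1 x2] /andP[y1 y2].
have hy : `|y| <= `|t| + `|t'|.
  by rewrite ler_norml; have := ler_norm (- t); have := ler_norm t'; rewrite normrN => *; apply/andP; split; lra.
have hx : `|x| <= `|t| + `|t'|.
  by rewrite ler_norml; have := ler_norm (- t); have := ler_norm t'; rewrite normrN => *; apply/andP; split; lra.
have := hC y (x - y); rewrite h0 mulr0 subr0 [y + _]addrC subrK; apply; first by rewrite /D; lra.
by rewrite (le_trans (ler_normB _ _)) // /D; lra.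
Qed.

(* Otherwise [h] minus a constant is bounded below near the first point and negative
   near the second, and the pairings with narrow Gaussians would differ. *)
Lemma concentration h i t t' r : continuous h -> pairable h ->
  (forall lam, 0 < lam -> pairing h (tst lam 1 1 (pt i t r)) = pairing h (tst lam 1 1 (pt i t' r))) ->
  h (pt i t r) <= h (pt i t' r).
Proof.
move=> ch ph hh; rewrite leNgt; apply/negP => lt.
pose z := pt i t r; pose z' := pt i t' r.
pose c := (h z - h z') / 2; have c0 : 0 < c by rewrite divr_gt0 // subr_gt0.
pose k y := h y - (h z + h z') / 2.
have pk : pairable k by apply: pairableB => //; exact: pairable_cst.
have ck : continuous k by move=> y; apply: cvgB; [exact: ch|exact: cvg_cst].
have kz : k z = c by rewrite /k /c; field.
have kz' : k z' = - c by rewrite /k /c; field.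
clearbody c.
have c2 : 0 < c / 2 by lra.
have loc (x : R * R) : exists2 d, 0 < d & forall y, (x.1 - y.1) ^+ 2 + (x.2 - y.2) ^+ 2 <= d ^+ 2 -> `|k x - k y| <= c / 2.
  have := ck x => /cvgrPdist_le /(_ _ c2) /nbhs_ballP [d /= d0 hd].
  exists (d / 2); first by rewrite divr_gt0.
  move=> y hy; apply: hd.
  have s1 := sqr_ge0 (x.1 - y.1); have s2 := sqr_ge0 (x.2 - y.2).
  have B (a : R) : a ^+ 2 <= (d / 2) ^+ 2 -> `|a| < d.
    move=> ha; apply: (@le_lt_trans _ _ (d / 2)); last lra.
    by rewrite -(@ler_pXn2r _ 2) ?nnegrE ?(real_normK (num_real _)) //; lra.
  by split; apply: B; lra.
have [d1 d10 hd1] := loc z; have [d2 d20 hd2] := loc z'.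
pose d := Num.min d1 d2; have d0 : 0 < d by rewrite lt_min d10.
have dd1 : d ^+ 2 <= d1 ^+ 2 by rewrite lerXn2r ?nnegrE ?(ltW d0) ?(ltW d10) // ge_min lexx.
have dd2 : d ^+ 2 <= d2 ^+ 2 by rewrite lerXn2r ?nnegrE ?(ltW d0) ?(ltW d20) // ge_min lexx orbT.
have tE lam (x y : R * R) : tst lam 1 1 x y = expR (- (lam * ((x.1 - y.1) ^+ 2 + (x.2 - y.2) ^+ 2))).
  by rewrite /tst !hermite1 /gau -expRD; congr expR; ring.
have k1 := pk 1 1 1 z ltr01; have k1' := pk 1 1 1 z' ltr01.
have u1 := pairable_cst (c / 2) 1 1 z ltr01.
have n1 := integrable_norm k1; have n1' := integrable_norm k1'.
pose q y := `|k y * tst 1 1 1 z y| + `|k y * tst 1 1 1 z' y| + c / 2 * tst 1 1 1 z y.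
have iq : (mu \x mu)%E.-integrable setT (EFin \o q).
  by apply: integrableRD; [exact: integrableRD|exact: u1].
pose Q := Rintegral (mu \x mu)%E setT q.
have Q0 : 0 <= Q.
  apply: Rintegral_ge0 => y _; rewrite /q !addr_ge0 // mulr_ge0 ?tst_ge0 // ltW //.
(* With parameter [1 + x], the part 1 keeps the integrals finite and the part [x] gains
   [expR (- (x * d ^+ 2))] off the two discs, against a total mass that decreases only like
   [pi / (1 + x)]. *)
have main x : 0 < x -> c / 2 * (pi / (1 + x)) <= expR (- (x * d ^+ 2)) * Q.
  move=> x0; have l0 : 0 < 1 + x by rewrite addr_gt0.
  have i1 := pk (1 + x) 1 1 z l0; have i1' := pk (1 + x) 1 1 z' l0.
  have iu := pairable_cst (c / 2) 1 1 z l0.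
  have I0 : Rintegral (mu \x mu)%E setT (fun y => k y * tst (1 + x) 1 1 z y - k y * tst (1 + x) 1 1 z' y) = 0.
    rewrite RintegralB //.
    have e (p : R * R) : Rintegral (mu \x mu)%E setT (fun y => k y * tst (1 + x) 1 1 p y) =
        pairing h (tst (1 + x) 1 1 p) - (h z + h z') / 2 * pairing (fun=> 1) (tst (1 + x) 1 1 p).
      have ih := ph (1 + x) 1 1 p l0; have ic := pairable_cst 1 1 1 p l0.
      rewrite -RintegralZl // -RintegralB //; last exact: integrableRZ.
      by apply: eq_Rintegral => y _; rewrite /k; ring.
    by rewrite !e hh // /z /z' !pairing_cst // subrr.
  have -> : c / 2 * (pi / (1 + x)) = Rintegral (mu \x mu)%E setT (fun y => c / 2 * tst (1 + x) 1 1 z y).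
    rewrite -(pairing_cst i t r l0) -RintegralZl //; last exact: pairable_cst.
    by apply: eq_Rintegral => y _; rewrite mul1r.
  rewrite -[leLHS]subr0 -I0 -RintegralB //; last exact: integrableRB.
  rewrite /Q -RintegralZl //; apply: le_Rintegral => //.
  - by apply: integrableRB => //; exact: integrableRB.
  - exact: integrableRZ.
  move=> y _.
  have far (p : R * R) : d ^+ 2 <= (p.1 - y.1) ^+ 2 + (p.2 - y.2) ^+ 2 ->
      tst (1 + x) 1 1 p y <= expR (- (x * d ^+ 2)) * tst 1 1 1 p y.
    by move=> hp; rewrite !tE -expRD ler_expR mulrDl opprD addrC lerD2r lerN2 ler_wpM2l // ltW.
  have a0 : 0 <= expR (- (x * d ^+ 2)) by exact: expR_ge0.
  have t1 := tst_ge0 1 z y; have t2 := tst_ge0 1 z' y.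
  have t3 := tst_ge0 (1 + x) z y; have t4 := tst_ge0 (1 + x) z' y.
  have nt (p : R * R) : `|k y * tst 1 1 1 p y| = `|k y| * tst 1 1 1 p y.
    by rewrite normrM (ger0_norm (tst_ge0 _ _ _)).
  rewrite /q !nt.
  have nk := normr_ge0 (k y); have lk := ler_norm (k y); have lk' := ler_norm (- k y); rewrite normrN in lk'.
  have P1 : (c / 2 - k y) * tst (1 + x) 1 1 z y <= expR (- (x * d ^+ 2)) * ((`|k y| + c / 2) * tst 1 1 1 z y).
    have kc : 0 <= `|k y| + c / 2 by rewrite addr_ge0 // ltW.
    have [hz|/ltW hz] := lerP ((z.1 - y.1) ^+ 2 + (z.2 - y.2) ^+ 2) (d ^+ 2).
      have := hd1 y (le_trans hz dd1); rewrite kz ler_norml => /andP[_ hk].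
      apply: (@le_trans _ _ 0); last exact: mulr_ge0 (mulr_ge0 _ _).
      by rewrite mulr_le0_ge0 //; clear -hk; lra.
    apply: (@le_trans _ _ ((`|k y| + c / 2) * tst (1 + x) 1 1 z y)).
      by rewrite ler_wpM2r //; clear -lk'; lra.
    by rewrite [leRHS]mulrCA ler_wpM2l ?far.
  have P2 : k y * tst (1 + x) 1 1 z' y <= expR (- (x * d ^+ 2)) * (`|k y| * tst 1 1 1 z' y).
    have [hz|/ltW hz] := lerP ((z'.1 - y.1) ^+ 2 + (z'.2 - y.2) ^+ 2) (d ^+ 2).
      have := hd2 y (le_trans hz dd2); rewrite kz' ler_norml => /andP[hk _].
      apply: (@le_trans _ _ 0); last exact: mulr_ge0 (mulr_ge0 _ _).
      by rewrite mulr_le0_ge0 //; clear -hk c0; lra.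
    apply: (@le_trans _ _ (`|k y| * tst (1 + x) 1 1 z' y)); first by rewrite ler_wpM2r.
    by rewrite [leRHS]mulrCA ler_wpM2l ?far.
  clear -P1 P2; move: P1 P2.
  move: (tst _ _ _ _ _) (tst _ _ _ _ _) (tst _ _ _ _ _) (tst _ _ _ _ _) (expR _) `|k y| (k y) => *; lra.
pose a := c / 2 * pi; pose e := (d ^+ 2) ^+ 2 / 2.
have a0 : 0 < a by rewrite mulr_gt0 // pi_gt0.
have e0 : 0 < e by rewrite divr_gt0 // !exprn_gt0.
(* Bounding the exponential below by its quadratic Taylor term leaves quadratic growth in [x] on the
   left and linear growth on the right, which fails for large [x]. *)
have main' x : 0 < x -> a * e * x ^+ 2 <= Q * (1 + x).
  move=> x0; have := main x x0; rewrite mulrA ler_pdivrMr ?addr_gt0 // -/a expRN [_^-1 * Q]mulrC mulrAC ler_pdivlMr ?expR_gt0 //.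
  have := expR_ge1Dxn 1 (mulr_ge0 (ltW x0) (sqr_ge0 d)); rewrite (_ : (2`!)%:R = 2 :> R) // exprMn => h1 h2.
  apply: le_trans h2; rewrite /e -mulrA ler_pM2l //; clear -h1; move: h1; move: (expR _) (x ^+ 2) => *; lra.
pose x := (2 * Q + 1) / (a * e) + 1.
have x1 : 1 <= x by rewrite lerDr; apply: divr_ge0; [by clear -Q0; lra|by apply: mulr_ge0; exact: ltW].
have := main' x; rewrite leNgt => /(_ (lt_le_trans ltr01 x1)) /negP; apply.
have ae : 0 < a * e by rewrite mulr_gt0.
have hx : 2 * Q + 1 <= a * e * x.
  by rewrite /x mulrDr mulr1 mulrCA divff ?gt_eqF // mulr1 lerDl ltW.
clear -hx x1 Q0; rewrite expr2 mulrA; nra.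
Qed.

End GaussianPairing.

(** * Differences of [f] as sums of differences of its blocks *)

Section DifferenceFormula.
Context {R : realType}.
Implicit Types (lam x t r : R) (P Q : {poly R}) (i b : bool) (h : R * R -> R) (y z : R * R).
Let mu := @lebesgue_measure R.
Local Notation pairing h phi := (Rintegral (mu \x mu)%E setT (fun y => h y * phi y)).

Lemma mean_value_bound (u u' : R -> R) (a c B : R) : (forall t, is_derive t 1 u (u' t)) ->
  (forall t, `|t - a| <= `|c - a| -> `|u' t| <= B) -> `|u c - u a| <= B * `|c - a|.
Proof.
move=> du hB.
have cont s e : {within `[s, e], continuous u}.
  by apply: derivable_within_continuous => x _; apply: ex_derive; exact: du.
have [ac|ca|->] := ltgtP a c; last by rewrite !subrr normr0 mulr0.
  have [x /[!in_itv] /= /andP[x1 x2] ->] := @MVT R u u' a c ac (fun t _ => du t) (cont _ _).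
  by rewrite normrM ler_wpM2r // hB // !gtr0_norm; lra.
have [x /[!in_itv] /= /andP[x1 x2] e] := @MVT R u u' c a ca (fun t _ => du t) (cont _ _).
rewrite distrC e normrM distrC ler_wpM2r // hB //.
by rewrite !ltr0_norm; lra.
Qed.

(** [C1] speaks of partial derivatives only. On the vertical line through [p] continuity follows
    from derivability, and the remaining horizontal step is controlled by the bound on the partial
    derivative near [p]. *)
Lemma C1_continuous (f : R * R -> R[i]) b : C1 f -> continuous (fun p => cpart b (f p)).
Proof.
move=> hf p; pose F q := cpart b (f q).
have dF d q : derivable F q (dir d) by have [/(_ q) [h1 h2] _] := hf d; rewrite /F; case: (b).
have cD d : continuous (fun q => 'D_(dir d) F q) by have [_ [h1 h2]] := hf d; rewrite /F; case: (b).
have line d (q : R * R) t := is_derive_line (dF d (q + t *: dir d)).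
apply/cvgrPdist_le => e e0.
pose B := `|'D_(dir false) F p| + 1; have B0 : 0 < B by rewrite ltr_wpDl.
have /cvgrPdist_le /(_ 1 ltr01) /nbhs_ballP [r /= r0 hr] := cD false p.
have hB q : ball p r q -> `|'D_(dir false) F q| <= B.
  move=> /hr /= hq; rewrite -[X in `|X|](subrK ('D_(dir false) F p)) (le_trans (ler_normD _ _)) //.
  by rewrite /B addrC lerD2l distrC.
have c2 : (fun t : R => F (p + t *: dir true)) @ (0 : R) --> F p.
  have c : continuous_at (0 : R) (fun t : R => F (p + t *: dir true)).
    apply: differentiable_continuous; apply/derivable1_diffP.
    by apply: ex_derive; exact: line true p 0.
  by move: c; rewrite /continuous_at scale0r addr0.
have /cvgrPdist_le /(_ (e / 2)) := c2; rewrite divr_gt0 // => /(_ isT) /nbhs_ballP [r' /= r'0 hr'].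
pose d := Num.min r (Num.min r' (e / (2 * B))).
have d0 : 0 < d by rewrite !lt_min r0 r'0 divr_gt0 // mulr_gt0.
have dr : d <= r by rewrite ge_min lexx.
have dr' : d <= r' by rewrite !ge_min lexx orbT.
have de : d <= e / (2 * B) by rewrite !ge_min lexx !orbT.
exists (ball p.1 d, ball p.2 d) => /=; [by split; exact: nbhsx_ballx|move=> q [/= q1 q2]].
pose p' : R * R := p + (q.2 - p.2) *: dir true.
have p'E : p' = (p.1, q.2).
  by rewrite /p' /dir; congr (_, _) => /=; rewrite ?[_ *: 0]mulr0 ?[_ *: 1]mulr1 ?addr0 // addrC subrK.
have qE : q = p' + (q.1 - p.1) *: dir false.
  rewrite p'E [LHS]surjective_pairing; congr (_, _) => /=; rewrite ?[_ *: 0]mulr0 ?[_ *: 1]mulr1 ?addr0 //.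
  by rewrite addrC subrK.
have h1 : `|F p - F p'| <= e / 2.
  apply: hr'; rewrite /ball /= sub0r normrN.
  by apply: lt_le_trans dr'; rewrite distrC.
have h2 : `|F p' - F q| <= e / 2.
  rewrite distrC {1}qE.
  have := @mean_value_bound (fun t => F (p' + t *: dir false)) _ 0 (q.1 - p.1) B (line false p').
  rewrite scale0r addr0 subr0 => H; apply: le_trans (H _) _.
    move=> t; rewrite subr0 => ht; apply: hB; split; rewrite p'E /= ?[_ *: 0]mulr0 ?[_ *: 1]mulr1 ?addr0.
      rewrite /ball /= opprD addNKr normrN; apply: le_lt_trans ht _.
      by apply: lt_le_trans dr; rewrite distrC.
    exact: lt_le_trans q2 dr.
  apply: (@le_trans _ _ (B * d)); first by rewrite ler_wpM2l ?(ltW B0) // distrC ltW.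
  rewrite mulrC; move: de; rewrite ler_pdivlMr ?mulr_gt0 //; lra.
have -> : cpart b (f p) - cpart b (f q) = (F p - F p') + (F p' - F q) by rewrite /F; ring.
by rewrite (le_trans (ler_normD _ _)) // (splitr e) lerD.
Qed.

Lemma schwartz_pderiv i (F : R * R -> R[i]) : schwartz F -> schwartz (pderiv i F).
Proof.
have e s : pderivs s (pderiv i F) = pderivs (rcons s i) F by rewrite /pderivs foldr_rcons.
by move=> [h1 h2]; split=> [s|a s]; rewrite e.
Qed.

Lemma pderiv_gauss i lam z : 0 < lam ->
  pderiv i (fun y => gprod lam 1 1 (z - y)) = (fun y => (- dtst i lam z y)%:C).
Proof.
move=> l0; apply/funext => y; apply: cpart_eq => b.
have := pderivs_refl z [:: i] (schwartz_gprod 1 1 l0) b y.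
rewrite /= expr1 mulN1r pderiv_gprod => ->.
by case: b => //=; rewrite oppr0.
Qed.

Lemma cpartMr b (z : R[i]) (x : R) : cpart b (z * x%:C) = cpart b z * x.
Proof. by case: z => u v; case: b => /=; rewrite mulr0 ?subr0 ?add0r. Qed.

Lemma cpartB b (u v : R[i]) : cpart b (u - v) = cpart b u - cpart b v.
Proof. by case: u => ? ?; case: v => ? ?; case: b. Qed.

Lemma cpartD b (u v : R[i]) : cpart b (u + v) = cpart b u + cpart b v.
Proof. by case: u => ? ?; case: v => ? ?; case: b. Qed.

Lemma cpartN b (u : R[i]) : cpart b (- u) = - cpart b u.
Proof. by case: u => ? ?; case: b. Qed.

Lemma cpart_sum b (I : Type) (s : seq I) (P : pred I) (u : I -> R[i]) :
  cpart b (\sum_(j <- s | P j) u j) = \sum_(j <- s | P j) cpart b (u j).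
Proof.
apply: (big_morph (cpart b)); last by case: b.
by move=> [? ?] [? ?]; case: b.
Qed.

Lemma cpart_dist_of b (f : R * R -> R[i]) (phi : R * R -> R) :
  cpart b (dist_of f (fun y => (phi y)%:C)) = pairing (fun y => cpart b (f y)) phi.
Proof.
rewrite /dist_of /Cintegral; case: b => /=; rewrite /lebesgue2; apply: eq_Rintegral => y _.
  exact: (cpartMr true).
exact: (cpartMr false).
Qed.

Lemma sums_zsum (u : int -> R[i]) b (l : R) : sums (fun n => cpart b (u n)) l ->
  forall e, 0 < e -> \forall MN \near filter_prod \oo \oo, `|cpart b (zsum u MN) - l| <= e.
Proof.
move=> h e /h[A hA].
pose n := \max_(j <- A) absz j.
have hn j : j \in A -> (absz j <= n)%N by move=> jA; rewrite /n (big_rem j) //= leq_maxl.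
exists ([set k | (n < k)%N], [set k | (n < k)%N]); first by split; exists n.+1.
move=> [a c] [/= na nc].
pose s := map Negz (iota 0 a) ++ map Posz (iota 0 c).
have us : uniq s.
  rewrite cat_uniq !map_inj_uniq ?iota_uniq //; [|by move=> ? ? []|by move=> ? ? []].
  by rewrite andbT /=; apply/hasPn => j /mapP[k _ ->]; apply/mapP => -[].
have memS j : (j \in [fset j | j in s]%fset) = (j \in s).
  by apply/imfsetP/idP => [[q qs ->] //|ps]; exists j.
have -> : cpart b (zsum u (a, c)) = \sum_(j <- [fset j | j in s]%fset) cpart b (u j).
  rewrite (perm_big s); last by apply: uniq_perm; [exact: fset_uniq|exact: us|exact: memS].
  rewrite /zsum /= big_cat !big_map /=.
  rewrite cpartD !cpart_sum; congr (_ + _).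
    by rewrite -(big_mkord xpredT (fun k => cpart b (u (Negz k)))) /index_iota subn0.
  by rewrite -(big_mkord xpredT (fun k => cpart b (u (Posz k)))) /index_iota subn0.
apply: hA; apply/fsubsetP => j jA; rewrite memS mem_cat; have := hn j jA.
case: j {jA} => k hk; apply/orP; [right|left]; apply/mapP; exists k => //; rewrite mem_iota /=; lia.
Qed.

Section Series.
Variables (w : R -> R) (W : int -> R * R -> R[i]) (T : (R * R -> R[i]) -> R[i]) (N : nat) (MT : R).
Hypotheses (hw : lp_profile w) (hW : lp_kernels w W) (tT : tempered_order T N MT).
Let g n := dist_conv T (W n).
Variables (s : int -> R) (M : R).
Hypotheses (hs : forall n (x : R * R), Cabs (g n x) <= s n) (hM : abs_bounded (fun n : int => 2 ^ n * s n) M).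

Lemma s_ge0 n : 0 <= s n. Proof. exact: le_trans (Cabs_ge0 _) (hs n 0). Qed.

(** Bernstein's inequality, read off from the absolute bound on the double series:
    [200 = 25 * 4 * 2], with 4 from the matrix entries and 2 from [1 / d = 2 * 2 ^ n]. The constant
    depends on [N], so it serves convergence and not the final estimate. *)
Lemma band_lipschitz : exists2 K, 0 <= K & forall n b i x1 x2 (y : R),
  `|cpart b (g n (pt i x1 y)) - cpart b (g n (pt i x2 y))| <= K * (2 ^ n * s n) * `|x1 - x2|.
Proof.
have [C C0 hC] := @kernel_decay2 R N.+2 isT.
exists (200 * C ^+ 2) => [|n b i x1 x2 y]; first by rewrite mulr_ge0 // sqr_ge0.
have [->|x12] := eqVneq x1 x2; first by rewrite !subrr normr0 mulr0.
have p2 : 0 < 2 ^ n :> R by exact: exprz_gt0.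
pose d : R := (2 * 2 ^ n)^-1.
have d0 : 0 < d by rewrite invr_gt0 mulr_gt0.
have dn : d * (2 * 2 ^ n) <= 1 by rewrite mulVf // gt_eqF // mulr_gt0.
have S := @twofold_sampling R w W n T N MT hw hW tT i b y d (s n) x1 x2 d0 dn (hs n) x12.
have D := double_series_bounded (x1 / d) (x2 / d - 2^-1) C0 hC (@sampling_matrix_le R W n T i b y d (s n) d0 (hs n)).
have := sums_abs_le D S; rewrite normrM normfV ler_pdivrMr ?normr_gt0 ?subr_eq0 // /d invrK.
by congr (_ <= _); ring.
Qed.

Lemma band_lipschitz2 : exists2 K, 0 <= K & forall n b z z',
  `|cpart b (g n z) - cpart b (g n z')| <= K * (`|z.1 - z'.1| + `|z.2 - z'.2|) * (2 ^ n * s n).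
Proof.
have [K K0 hK] := band_lipschitz; exists K => // n b [x1 x2] [y1 y2] /=.
have := hK n b false x1 y1 x2; have := hK n b true x2 y2 y1; rewrite /pt /= => h1 h2.
rewrite (_ : _ - _ = (cpart b (g n (x1, x2)) - cpart b (g n (y1, x2))) + (cpart b (g n (y1, x2)) - cpart b (g n (y1, y2)))); last by ring.
by rewrite (le_trans (ler_normD _ _)) //; lra.
Qed.

Lemma band_continuous n b : continuous (fun z => cpart b (g n z)).
Proof. by move=> z; exact: (@conv_continuous R w W n T N MT hW tT b z). Qed.

Lemma band_pairable n b : pairable (fun z => cpart b (g n z)).
Proof.
apply: (@pairable_growth R _ (s n)); first exact: band_continuous.
move=> z; apply: le_trans (cpart_le _ _) _; apply: le_trans (hs n z) _.
by rewrite ler_peMr ?s_ge0 // lerDl norm2_ge0.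
Qed.

Lemma pairing_sum (u : int -> R * R -> R) (B : seq int) lam P Q z : 0 < lam ->
  (forall n, pairable (u n)) -> pairable (fun y => \sum_(n <- B) u n y) /\
  pairing (fun y => \sum_(n <- B) u n y) (tst lam P Q z) = \sum_(n <- B) pairing (u n) (tst lam P Q z).
Proof.
move=> l0 hu; elim: B => [|n B [IH1 IH2]].
  split.
    by rewrite (_ : (fun y => _) = fun=> 0); [exact: pairable_cst|apply/funext => y; rewrite big_nil].
  rewrite big_nil; transitivity (Rintegral (mu \x mu)%E setT (fun=> 0)).
    by apply: eq_Rintegral => y _; rewrite big_nil mul0r.
  by rewrite /Rintegral integral0.
have E y : \sum_(k <- n :: B) u k y = u n y + \sum_(k <- B) u k y by rewrite big_cons.
split.
  move=> lam' P' Q' z' l0'; have := integrableRD (hu n lam' P' Q' z' l0') (IH1 lam' P' Q' z' l0').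
  by congr (_.-integrable _ _); apply/funext => y /=; rewrite E mulrDl.
rewrite big_cons -IH2 -RintegralD //; [|exact: hu|exact: IH1].
by apply: eq_Rintegral => y _; rewrite E mulrDl.
Qed.

Section Limit.
Variable b : bool.

Lemma band_series z : exists l, sums (fun n => cpart b (g n z) - cpart b (g n 0)) l.
Proof.
have [K K0 hK] := band_lipschitz2.
have := abs_boundedZ (K * (`|z.1| + `|z.2|)) hM => h.
apply: (@sums_exist R _ _ (`|K * (`|z.1| + `|z.2|)| * M)); apply: abs_bounded_le h => n.
apply: le_trans (hK n b z 0) _; rewrite /= !subr0.
by rewrite [leRHS]ger0_norm // !mulr_ge0 ?s_ge0 ?addr_ge0 // exprz_ge0.
Qed.

(** Values at 0 are subtracted because summability of [2 ^ n * s n] does not make the blocks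
    themselves summable as [n] tends to minus infinity; it does so for their differences. *)
Definition band_limit z : R := sval (cid (band_series z)).

Lemma band_limitP z : sums (fun n => cpart b (g n z) - cpart b (g n 0)) (band_limit z).
Proof. exact: svalP (cid (band_series z)). Qed.

(** Convergence is uniform relative to [|z.1| + |z.2|], which suffices for integration against
    Gaussians. *)
Lemma band_limit_tail e : 0 < e -> exists A : {fset int}, forall B : {fset int}, (A `<=` B)%fset ->
  forall z, `|\sum_(n <- B) (cpart b (g n z) - cpart b (g n 0)) - band_limit z| <= e * (`|z.1| + `|z.2|).
Proof.
move=> e0; have [K K0 hK] := band_lipschitz2.
have K1 : 0 < K + 1 by rewrite ltr_wpDl.
have [A hA] := abs_bounded_tail hM (divr_gt0 e0 K1); exists A => B AB z.
have z0 : 0 <= `|z.1| + `|z.2| by rewrite addr_ge0.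
apply: (sums_tail (band_limitP z)) AB => D /hA hD.
apply: (@le_trans _ _ (\sum_(n <- D) K * (`|z.1| + `|z.2|) * `|2 ^ n * s n|)).
  apply: ler_sum => n _; apply: le_trans (hK n b z 0) _.
  by rewrite /= !subr0 ler_wpM2l ?mulr_ge0 // ler_norm.
rewrite -mulr_sumr mulrAC ler_wpM2r //.
apply: le_trans (ler_wpM2l K0 hD) _.
by rewrite mulrA ler_pdivrMr // mulrC ler_wpM2l ?(ltW e0) // lerDl.
Qed.

Lemma band_limit_lipschitz : exists2 K, 0 <= K & forall z z',
  `|band_limit z - band_limit z'| <= K * (`|z.1 - z'.1| + `|z.2 - z'.2|).
Proof.
have [K K0 hK] := band_lipschitz2.
exists (K * M) => [|z z']; first by rewrite mulr_ge0 //; exact: abs_bounded_ge0 hM.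
have S := sumsB (band_limitP z) (band_limitP z').
have D := abs_boundedZ (K * (`|z.1 - z'.1| + `|z.2 - z'.2|)) hM.
have c0 : 0 <= K * (`|z.1 - z'.1| + `|z.2 - z'.2|) by rewrite mulr_ge0 // addr_ge0.
rewrite (_ : K * M * _ = `|K * (`|z.1 - z'.1| + `|z.2 - z'.2|)| * M); last by rewrite (ger0_norm c0); ring.
apply: sums_abs_le S; apply: abs_bounded_le D => n.
rewrite (_ : _ - _ = cpart b (g n z) - cpart b (g n z')); last by ring.
by apply: le_trans (hK n b z z') _; exact: ler_norm.
Qed.

Lemma band_limit_continuous : continuous band_limit.
Proof.
have [K K0 hK] := band_limit_lipschitz; move=> z; apply/cvgrPdist_le => e e0.
have d0 : 0 < e / (2 * (K + 1)) by rewrite divr_gt0 // mulr_gt0 // ltr_wpDl.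
pose d := e / (2 * (K + 1)); exists (ball z.1 d, ball z.2 d) => /=; [by split; exact: nbhsx_ballx|move=> y [/= /ltW y1 /ltW y2]].
apply: le_trans (hK z y) _; apply: (@le_trans _ _ (K * (e / (2 * (K + 1)) + e / (2 * (K + 1))))).
  by rewrite ler_wpM2l // lerD.
have K1 : 0 < K + 1 by rewrite ltr_wpDl.
have -> : K * (e / (2 * (K + 1)) + e / (2 * (K + 1))) = e * (K / (K + 1)) by field; rewrite gt_eqF.
by rewrite ler_piMr ?(ltW e0) // ler_pdivrMr // mul1r lerDl.
Qed.

Lemma band_limit_pairable : pairable band_limit.
Proof.
have [K K0 hK] := band_limit_lipschitz.
apply: (@pairable_growth R _ (2 * K)); first exact: band_limit_continuous.
move=> z; have h0 : band_limit 0 = 0.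
  apply: sums_unique (band_limitP 0) _; apply: eq_sums (@sums0 R int) => n; by rewrite subrr.
have := hK z 0; rewrite h0 /= !subr0 => h; apply: le_trans h _.
have [h1 h2] := norm2_ge z; rewrite mulrAC mulrC ler_wpM2r //.
by rewrite mulrC; lra.
Qed.

(** The subtracted constants [g n 0] disappear because [dtst] has integral 0; the rest is the
    uniform convergence of [band_limit_tail]. *)
Lemma pairing_band_limit i lam t r : 0 < lam ->
  sums (fun n => pairing (fun y => cpart b (g n y)) (dtst i lam (pt i t r)))
    (pairing band_limit (dtst i lam (pt i t r))).
Proof.
move=> l0; set z := pt i t r; set P : {poly R} := if i then 1 else dpoly lam 1; set Q : {poly R} := if i then dpoly lam 1 else 1.
have dE : dtst i lam z = tst lam P Q z by [].
pose u n y := cpart b (g n y) - cpart b (g n 0).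
have pu n : pairable (u n) by apply: pairableB; [exact: band_pairable|exact: pairable_cst].
have uE n : pairing (u n) (dtst i lam z) = pairing (fun y => cpart b (g n y)) (dtst i lam z).
  have i1 := band_pairable n b P Q z l0; have i2 := pairable_cst (cpart b (g n 0)) P Q z l0.
  rewrite -[RHS]subr0 -(mulr0 (cpart b (g n 0))) -(pairing_dcst i t r l0) -/z dE.
  rewrite -RintegralZl //; last exact: pairable_cst.
  rewrite -RintegralB //.
    by apply: eq_Rintegral => y _; rewrite /u; ring.
  by have := i2; congr (_.-integrable _ _); apply/funext => y /=; rewrite mul1r.
pose v (y : R * R) := `|y.1| + `|y.2|.
have cv : continuous v.
  by move=> y; apply: cvgD; apply: cvg_norm; [exact: cvg_fst|exact: cvg_snd].
have pv : pairable v.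
  apply: (@pairable_growth R _ 2) => // y; have [h1 h2] := norm2_ge y.
  by rewrite ger0_norm ?addr_ge0 // /v; lra.
have iv := integrable_norm (pv lam P Q z l0).
pose I0 := Rintegral (mu \x mu)%E setT (fun y => `|v y * tst lam P Q z y|).
have I00 : 0 <= I0 by apply: Rintegral_ge0.
move=> e e0; have I1 : 0 < I0 + 1 by rewrite ltr_wpDl.
have [A hA] := band_limit_tail (divr_gt0 e0 I1); exists A => B /hA hB.
under eq_bigr do rewrite -uE dE.
rewrite dE; have [pS <-] := pairing_sum B P Q z l0 pu.
have pD := pairableB pS band_limit_pairable.
have j1 := pS lam P Q z l0; have j2 := band_limit_pairable P Q z l0.
rewrite -RintegralB //.
apply: le_trans (le_normr_Rintegral _ _) _ => //; first exact: integrableRB.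
apply: (@le_trans _ _ (e / (I0 + 1) * I0)); last first.
  by rewrite mulrAC ler_pdivrMr // ler_wpM2l ?(ltW e0) // lerDl.
rewrite -RintegralZl //; apply: le_Rintegral => //.
- by apply: integrable_norm; exact: integrableRB.
- exact: integrableRZ.
move=> y _ /=; rewrite -mulrBl normrM (_ : `|v y * _| = v y * `|tst lam P Q z y|).
  by rewrite mulrA ler_wpM2r //; exact: hB.
by rewrite normrM ger0_norm // addr_ge0.
Qed.

Lemma difference_formula (f : R * R -> R[i]) i x1 x2 r : C1 f -> represents f T ->
  (forall d phi, schwartz phi ->
     Ccvg (filter_prod \oo \oo) (zsum (fun n => dist_deriv d (dist_of (g n)) phi)) (dist_deriv d T phi)) ->
  sums (fun n => cpart b (g n (pt i x1 r)) - cpart b (g n (pt i x2 r)))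
    (cpart b (f (pt i x1 r)) - cpart b (f (pt i x2 r))).
Proof.
move=> fC fT hT; pose F y := cpart b (f y).
have pF : pairable F.
  move=> lam P Q z l0; have [[h1 h2] _] := fT _ (schwartz_refl z (schwartz_gprod P Q l0)).
  have E y : F y * tst lam P Q z y = cpart b (f y * gprod lam P Q (z - y)) by rewrite /gprod cpartMr.
  have -> : (fun y => F y * tst lam P Q z y) = (fun y => cpart b (f y * gprod lam P Q (z - y))).
    by apply/funext.
  by case: (b).
pose h y := F y - band_limit y.
have ph : pairable h by exact: pairableB band_limit_pairable.
have ch : continuous h.
  by move=> y; apply: cvgB; [exact: C1_continuous|exact: band_limit_continuous].
have h0 lam t : 0 < lam -> pairing h (dtst i lam (pt i t r)) = 0.
  move=> l0; set z := pt i t r; pose phi y := gprod lam 1 1 (z - y).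
  have sphi : schwartz phi by apply: schwartz_refl; exact: schwartz_gprod.
  have S := pairing_band_limit i t r l0; rewrite -/z in S.
  have dd (F' : R * R -> R[i]) : pairable (fun y => cpart b (F' y)) -> cpart b (- dist_of F' (pderiv i phi)) = pairing (fun y => cpart b (F' y)) (dtst i lam z).
    move=> pF'; rewrite pderiv_gauss // cpartN cpart_dist_of.
    have i1 : (mu \x mu)%E.-integrable setT (EFin \o (fun y => cpart b (F' y) * dtst i lam z y)) by exact: pF'.
    have -> : pairing (fun y => cpart b (F' y)) (fun y => - dtst i lam z y) = -1 * pairing (fun y => cpart b (F' y)) (dtst i lam z).
      by rewrite -RintegralZl //; apply: eq_Rintegral => y _; ring.
    by ring.
  have e1 : cpart b (dist_deriv i T phi) = pairing F (dtst i lam z).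
    by rewrite /dist_deriv; have [_ ->] := fT _ (schwartz_pderiv i sphi); by apply: dd.
  have e2 n : cpart b (dist_deriv i (dist_of (g n)) phi) = pairing (fun y => cpart b (g n y)) (dtst i lam z) by apply: dd; exact: band_pairable.
  have {}S : sums (fun n => cpart b (dist_deriv i (dist_of (g n)) phi)) (pairing band_limit (dtst i lam z)).
    by apply: eq_sums S => n; rewrite e2.
  rewrite (_ : pairing h _ = pairing F (dtst i lam z) - pairing band_limit (dtst i lam z)); last first.
    rewrite -RintegralB //; [|exact: pF|exact: band_limit_pairable].
    by apply: eq_Rintegral => y _; rewrite /h; ring.
  apply/eqP; rewrite -normr_le0; apply/ler_addgt0Pl => e e0'; rewrite addr0.
  have e20 : 0 < e / 2 by lra.
  (* Both pairings are limits of the same two-sided partial sums, one by unconditional summation and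
     the other by the assumed convergence of the derivatives. *)
  have n1 := sums_zsum S e20.
  have /cvgrPdist_le /(_ _ e20) n2 := hT i phi sphi.
  have [MN [m1 m2]] := @filter_ex _ _ _ _ (filterI n1 n2).
  move: m2; rewrite sub0r normrN ger0_norm ?Cabs_ge0 // => m2.
  have := le_trans (cpart_le b _) m2; rewrite cpartB e1 distrC => m3.
  rewrite (_ : pairing F _ - _ = (pairing F (dtst i lam z) - cpart b (zsum (fun n => dist_deriv i (dist_of (g n)) phi) MN)) +
     (cpart b (zsum (fun n => dist_deriv i (dist_of (g n)) phi) MN) - pairing band_limit (dtst i lam z))); last by ring.
  by rewrite (le_trans (ler_normD _ _)) //; lra.
have hc lam : 0 < lam -> pairing h (tst lam 1 1 (pt i x1 r)) = pairing h (tst lam 1 1 (pt i x2 r)).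
  by move=> l0; apply: pairing_const => // t; exact: h0.
have he : h (pt i x1 r) = h (pt i x2 r).
  have a1 := concentration ch ph hc.
  have a2 := concentration ch ph (fun lam l0 => esym (hc lam l0)).
  by apply/eqP; rewrite eq_le a1 a2.
have -> : cpart b (f (pt i x1 r)) - cpart b (f (pt i x2 r)) = band_limit (pt i x1 r) - band_limit (pt i x2 r).
  by move: he; rewrite /h /F; lra.
by apply: eq_sums (sumsB (band_limitP _) (band_limitP _)) => n; ring.
Qed.

End Limit.
End Series.
End DifferenceFormula.

(** * Haagerup tensor representations *)

Section HaagerupNorms.
Context {R : realType}.
Implicit Types (a : nat -> R[i]) (b : bool).

Lemma l2norm_le a (r : R) : 0 <= r -> (forall n, \sum_(0 <= j < n) Cabs (a j) ^+ 2 <= r ^+ 2) ->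
  (l2norm a <= r%:E)%E.
Proof.
move=> r0 h; rewrite /l2norm; set X := (\sum_(0 <= j <oo) _)%E.
have nn j : (0 <= (Cabs (a j) ^+ 2)%:E)%E by rewrite lee_fin sqr_ge0.
have X0 : (0 <= X)%E by apply: nneseries_ge0 => j _ _.
have Xr : (X <= (r ^+ 2)%:E)%E.
  apply: lime_le; first by apply: is_cvg_nneseries => j _ _.
  by apply: nearW => n; rewrite sumEFin lee_fin.
case: X X0 Xr => [x| |] //; rewrite !lee_fin => x0 xr.
by rewrite powR12_sqrt // -[leRHS](ger0_norm r0) -sqrtr_sqr ler_sqrt // sqr_ge0.
Qed.

Lemma l2norm_fin a : (l2norm a < +oo)%E -> exists S : R, [/\ 0 <= S, l2norm a = S%:E &
  forall n, \sum_(0 <= j < n) Cabs (a j) ^+ 2 <= S ^+ 2].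
Proof.
rewrite /l2norm; set X := (\sum_(0 <= j <oo) _)%E => hX.
have nn j : (0 <= (Cabs (a j) ^+ 2)%:E)%E by rewrite lee_fin sqr_ge0.
have X0 : (0 <= X)%E by apply: nneseries_ge0 => j _ _.
have part n : ((\sum_(0 <= j < n) Cabs (a j) ^+ 2)%:E <= X)%E.
  by rewrite -sumEFin; apply: nneseries_lim_ge => j _ _.
have : (X < +oo)%E by apply: lty_poweRy hX; rewrite invr_eq0.
case: X X0 {hX} part => [x| |] //; rewrite lee_fin => x0 part _.
exists (Num.sqrt x); split; first exact: sqrtr_ge0.
  by rewrite poweR_EFin powR12_sqrt.
by move=> n; rewrite sqr_sqrtr // -lee_fin.
Qed.

Lemma Cabs_sqr (z : R[i]) : Cabs z ^+ 2 = cpart false z ^+ 2 + cpart true z ^+ 2.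
Proof. by case: z => x y; rewrite /Cabs /= sqr_sqrtr // addr_ge0 // sqr_ge0. Qed.

Lemma abs_bounded_nat (u : nat -> R) M : (forall n, \sum_(0 <= k < n) `|u k| <= M) -> abs_bounded u M.
Proof.
move=> h A; apply: le_trans (h (\max_(k <- A) k).+1).
apply: ler_sum_uniq => // k kA; rewrite mem_index_iota /= ltnS.
by rewrite (big_rem k) //= leq_maxl.
Qed.

Lemma sums_nat (u : nat -> R) l : sums u l -> (fun n => \sum_(0 <= k < n) u k) @ \oo --> l.
Proof.
move=> hu; apply/cvgrPdist_le => e /hu[A hA].
near=> n; rewrite distrC.
have memS k : (k \in [fset k | k in index_iota 0 n]%fset) = (k < n)%N.
  apply/imfsetP/idP => [[q /= qs ->]|ps]; first by move: qs; rewrite mem_index_iota.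
  by exists k; rewrite //= mem_index_iota.
rewrite (_ : \sum_(0 <= k < n) u k = \sum_(k <- [fset k | k in index_iota 0 n]%fset) u k).
  apply: hA; apply/fsubsetP => k kA; rewrite memS.
  apply: (@leq_ltn_trans (\max_(k <- A) k)); first by rewrite (big_rem k) //= leq_maxl.
  by near: n; exists (\max_(k <- A) k).+1.
apply: perm_big; apply: uniq_perm; [exact: iota_uniq|exact: fset_uniq|].
by move=> k; rewrite memS mem_index_iota.
Unshelve. all: by end_near. Qed.

(** Testing the bound on the row itself gives [S ^ 2 <= C * S] for its squared norm [S]. *)
Lemma l2bounded_row (g : nat -> nat -> R) C j : l2bounded g C -> 0 <= C ->
  abs_bounded (fun k => g j k ^+ 2) C.
Proof.
move=> hg C0 B; have := hg [fset j]%fset B (g j).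
rewrite big_seq_fset1 (eq_bigr (fun k => `|g j k ^+ 2|)); last first.
  by move=> k _; rewrite ger0_norm ?sqr_ge0 // expr2.
rewrite [in X in _ -> X](eq_bigr (fun k => `|g j k ^+ 2|)) //.
rewrite (eq_bigr (fun k => `|g j k ^+ 2|)) => [|k _]; last by rewrite ger0_norm ?sqr_ge0.
set S := \sum_(k <- B) _ => h.
have S0 : 0 <= S by rewrite sumr_ge0.
have [//|CS] := lerP S C; have Sp : 0 < S by exact: le_lt_trans C0 CS.
by move: h; rewrite expr2 ler_pM2r // leNgt CS.
Qed.

(** Rows converge absolutely since [|g u| <= g ^ 2 + u ^ 2], and the bound for finite sections
    survives the limit. *)
Lemma l2bounded_sums (g : nat -> nat -> R) C (u : nat -> R) S : l2bounded g C -> 0 <= C ->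
  sums (fun k => u k ^+ 2) S -> exists v, (forall j, sums (fun k => g j k * u k) (v j)) /\
    forall n, \sum_(0 <= j < n) v j ^+ 2 <= C * S.
Proof.
move=> hg C0 hu.
have uS (B : {fset nat}) : \sum_(k <- B) u k ^+ 2 <= S.
  by apply: sums_ge_partial hu => k; exact: sqr_ge0.
have ex j : exists v, sums (fun k => g j k * u k) v.
  apply: (@sums_exist R _ _ (C + S)) => B.
  have h := l2bounded_row j hg C0 B; apply: le_trans (lerD h (uS B)); rewrite -big_split /=.
  apply: ler_sum => k _; rewrite (ger0_norm (sqr_ge0 (g j k))).
  rewrite normrM -[g j k ^+ 2](real_normK (num_real _)) -[u k ^+ 2](real_normK (num_real _)).
  have := sqr_ge0 (`|g j k| - `|u k|); have := normr_ge0 (g j k); have := normr_ge0 (u k); nra.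
pose v j := sval (cid (ex j)); have hv j : sums (fun k => g j k * u k) (v j) := svalP (cid (ex j)).
exists v; split => // n.
have cv : (fun m => \sum_(0 <= j < n) (\sum_(0 <= k < m) g j k * u k) ^+ 2) @ \oo --> \sum_(0 <= j < n) v j ^+ 2.
  apply: cvg_big => [|j _]; first exact: add_continuous.
  by apply: cvgM; exact: sums_nat.
rewrite -(cvg_lim _ cv) //; apply: limr_le; first by apply/cvg_ex; eexists; exact: cv.
apply: nearW => m.
have toF (F : nat -> R) p : \sum_(0 <= k < p) F k = \sum_(k <- [fset k | k in index_iota 0 p]%fset) F k.
  apply: perm_big; apply: uniq_perm; [exact: iota_uniq|exact: fset_uniq|].
  by move=> k; apply/idP/imfsetP => [kp|[q qp ->] //]; exists k.
rewrite toF; under eq_bigr do rewrite toF.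
by apply: le_trans (hg _ _ u) _; rewrite ler_wpM2l.
Qed.

Lemma Ccvg_cpart (I : Type) (F : set_system I) (FF : Filter F) (u : I -> R[i]) (l : R[i]) :
  (forall b, (fun k => cpart b (u k)) @ F --> cpart b l) -> Ccvg F u l.
Proof.
move=> h; apply/cvgrPdist_le => e e0; have e2 : 0 < e / 2 by lra.
have /cvgrPdist_le /(_ _ e2) h1 := h false; have /cvgrPdist_le /(_ _ e2) h2 := h true.
near=> k; rewrite sub0r normrN ger0_norm ?Cabs_ge0 //.
apply: le_trans (Cabs_le _) _; rewrite !cpartB (splitr e) lerD // distrC.
  by near: k; exact: h1.
by near: k; exact: h2.
Unshelve. all: by end_near. Qed.

(** Real and imaginary parts of matrix and vector give four real products. With
    [(x + y) ^ 2 <= 2 x ^ 2 + 2 y ^ 2] in each part of the image, their squared norms add up to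
    [4 * C] times that of the vector. *)
Lemma opnorm_le (g : nat -> nat -> R[i]) C D : 0 <= C -> 0 <= D -> 4 * C <= D ^+ 2 ->
  (forall b, l2bounded (fun j k => cpart b (g j k)) C) -> (opnorm g <= D%:E)%E.
Proof.
move=> C0 D0 CD hg; apply: ereal_inf_lbound; exists D => //; split => // a /l2norm_fin [S [S0 aS hS]].
have habs b : abs_bounded (fun k => cpart b (a k) ^+ 2) (S ^+ 2).
  apply: abs_bounded_nat => n; apply: le_trans (hS n); apply: ler_sum => k _.
  rewrite Cabs_sqr ger0_norm ?sqr_ge0 //; case: b; rewrite ?lerDl ?lerDr sqr_ge0 //.
have [S1 h1] := sums_exist (habs false); have [S2 h2] := sums_exist (habs true).
have S12 : S1 + S2 <= S ^+ 2.
  have hs := sumsD h1 h2; have hb : abs_bounded (fun k => cpart false (a k) ^+ 2 + cpart true (a k) ^+ 2) (S ^+ 2).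
    apply: abs_bounded_nat => n; apply: le_trans (hS n); apply: ler_sum => k _.
    by rewrite Cabs_sqr ger0_norm // addr_ge0 // sqr_ge0.
  exact: le_trans (ler_norm _) (sums_abs_le hb hs).
have [v11 [c11 B11]] := l2bounded_sums (hg false) C0 h1.
have [v12 [c12 B12]] := l2bounded_sums (hg false) C0 h2.
have [v21 [c21 B21]] := l2bounded_sums (hg true) C0 h1.
have [v22 [c22 B22]] := l2bounded_sums (hg true) C0 h2.
exists (fun j => (v11 j - v22 j) +i* (v12 j + v21 j)).
  move=> j; apply: Ccvg_cpart => -[] /=.
    apply: cvg_trans (sums_nat (sumsD (c12 j) (c21 j))); apply: near_eq_cvg; apply: nearW => n.
    rewrite -[RHS]/(cpart true _) cpart_sum; apply: eq_bigr => k _; by case: (g j k) => ? ?; case: (a k) => ? ?.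
  apply: cvg_trans (sums_nat (sumsB (c11 j) (c22 j))); apply: near_eq_cvg; apply: nearW => n.
  rewrite -[RHS]/(cpart false _) cpart_sum; apply: eq_bigr => k _; by case: (g j k) => ? ?; case: (a k) => ? ?.
rewrite aS -EFinM; apply: l2norm_le => [|n]; first exact: mulr_ge0.
apply: (@le_trans _ _ (\sum_(0 <= j < n) (2 * (v11 j ^+ 2 + v22 j ^+ 2) + 2 * (v12 j ^+ 2 + v21 j ^+ 2)))).
  apply: ler_sum => j _; rewrite Cabs_sqr /=.
  have := sqr_ge0 (v11 j + v22 j); have := sqr_ge0 (v12 j - v21 j); lra.
rewrite big_split /= -!mulr_sumr !big_split /= exprMn.
apply: (@le_trans _ _ (4 * C * S ^+ 2)); last by rewrite ler_wpM2r // sqr_ge0.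
apply: (@le_trans _ _ (4 * C * (S1 + S2))); last by rewrite ler_wpM2l // mulr_ge0.
have := B11 n; have := B12 n; have := B21 n; have := B22 n; lra.
Qed.

Section SpectralBounds.
Variables (H : hilbertType R) (E : spectral_measure H).

(** For the constant sequence of empty sets countable additivity yields a convergent series with
    constant terms, which must be 0. *)
Lemma spm_set0 u : E set0 u = 0.
Proof.
have := @spm_sigma_additive _ _ E (fun=> set0) (fun=> measurable0) _ u.
rewrite bigcup0 // => /(_ (@trivIset_set0 _ _ _)) h.
have h1 : (fun n => \sum_(0 <= k < n.+1) E set0 u) @ \oo --> E set0 u by rewrite (cvg_shiftS (fun n => \sum_(0 <= k < n) E set0 u)).
have h2 := cvgB h1 h.
rewrite subrr in h2.
have h3 : (fun n : nat => \sum_(0 <= k < n.+1) E set0 u - \sum_(0 <= k < n) E set0 u) = (fun=> E set0 u).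
  by apply/funext => n; rewrite big_nat_recr //= addrAC subrr add0r.
have h4 : (fun _ : nat => E set0 u) @ \oo --> (0 : H) by rewrite -h3; exact: h2.
apply: (cvg_unique _ _ h4) => //; exact: cvg_cst.
Qed.

Lemma spm_ess_sup_le (g : R -> \bar R) (r : R) : 0 <= r -> (forall x, (g x <= r%:E)%E) ->
  (spm_ess_sup E g <= r%:E)%E.
Proof.
move=> r0 h; apply: ereal_inf_lbound; split; first by rewrite lee_fin.
exists set0; split; [exact: measurable0|exact: spm_set0|by move=> x /=].
Qed.

Lemma spm_ess_sup_ge0 (g : R -> \bar R) : (0 <= spm_ess_sup E g)%E.
Proof. by apply: le_ereal_inf_tmp => y []. Qed.

End SpectralBounds.

(** A single block of infinite sup norm would make the Besov norm infinite, so all these norms are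
    real numbers [s n]. *)
Lemma besov_bounds (W : int -> R * R -> R[i]) (T : (R * R -> R[i]) -> R[i]) :
  (forall n x, ((Cabs (dist_conv T (W n) x))%:E <= Linfty_norm (dist_conv T (W n)))%E) ->
  (besov_norm W T < +oo)%E -> exists B (s : int -> R), [/\ besov_norm W T = B%:E,
    forall n x, Cabs (dist_conv T (W n) x) <= s n & abs_bounded (fun n : int => 2 ^ n * s n) B].
Proof.
move=> hle hB; set L := fun n => Linfty_norm (dist_conv T (W n)).
have L0 n : (0 <= L n)%E by apply: le_trans (hle n 0); rewrite lee_fin Cabs_ge0.
have p2 (n : int) : 0 < 2 ^ n :> R by exact: exprz_gt0.
have t0 n : (0 <= ((2 : R) ^ n)%R%:E * L n)%E by rewrite mule_ge0 // lee_fin ltW.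
have b0 : (0 <= besov_norm W T)%E by apply: esum_ge0.
have bE : besov_norm W T = (fine (besov_norm W T))%:E by rewrite fineK // ge0_fin_numE.
have part (A : {fset int}) : ((\sum_(n <- A) ((2 : R) ^ n)%R%:E * L n)%E <= besov_norm W T)%E.
  apply: esum_ge; exists [set` A]; first by split => //; exact: finite_fset.
  by rewrite -fsbig_seq ?fset_uniq.
have Lfin n : L n = (fine (L n))%:E.
  rewrite fineK // ge0_fin_numE // ltey; apply/eqP => Ly.
  have := part [fset n]%fset; rewrite big_seq_fset1 Ly gt0_muley ?lte_fin // => h.
  by move: hB; rewrite ltNge h.
exists (fine (besov_norm W T)), (fun n => fine (L n)); split => //.
  by move=> n x; rewrite -lee_fin -Lfin.
move=> A; rewrite -lee_fin -bE; apply: le_trans (part A).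
rewrite -sumEFin; apply: lee_sum => n _; rewrite ger0_norm ?EFinM -?Lfin //.
by rewrite mulr_ge0 ?(ltW (p2 n)) // -lee_fin -Lfin.
Qed.

End HaagerupNorms.

(** * The factors of the tensor representation *)

Section Representation.
Context {R : realType}.
Implicit Types (b : bool) (x y t : R) (n : int).
Variables (w : R -> R) (W : int -> R * R -> R[i]) (T : (R * R -> R[i]) -> R[i]) (N : nat) (MT : R).
Hypotheses (hw : lp_profile w) (hW : lp_kernels w W) (tT : tempered_order T N MT).
Let g n := dist_conv T (W n).
Variables (s : int -> R) (B : R) (f : R * R -> R[i]) (i : bool).
Hypotheses (hs : forall n (z : R * R), Cabs (g n z) <= s n) (hB : abs_bounded (fun n : int => 2 ^ n * s n) B).
Hypotheses (fC : C1 f) (fT : represents f T)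
  (hT : forall d phi, schwartz phi ->
     Ccvg (filter_prod \oo \oo) (zsum (fun n => dist_deriv d (dist_of (g n)) phi)) (dist_deriv d T phi)).

Let k := @skernel R N.+2.
Let lam n : R := 2 ^ n * s n.
Let d n : R := (2 * 2 ^ n)^-1.

(** Treats both kinds at once: [i = false] is [divdiff1], and [i = true] is [divdiff2] with its
    undivided variable moved to the last place. *)
Definition divdiff (x1 x2 y : R) : R[i] :=
  if x1 == x2 then pderiv i f (pt i x1 y) else (f (pt i x1 y) - f (pt i x2 y)) / (x1 - x2)%:C.

Let d_gt0 n : 0 < d n. Proof. by rewrite invr_gt0 mulr_gt0 // exprz_gt0. Qed.
Let d_le n : d n * (2 * 2 ^ n) <= 1.
Proof. by rewrite mulVf // gt_eqF // mulr_gt0 // exprz_gt0. Qed.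
Let s0 n : 0 <= s n. Proof. exact: le_trans (Cabs_ge0 _) (hs n 0). Qed.
Let lam_ge0 n : 0 <= lam n. Proof. by rewrite mulr_ge0 // exprz_ge0. Qed.
Let B_ge0 : 0 <= B. Proof. exact: abs_bounded_ge0 hB. Qed.

Definition summand x1 x2 y b (q : int * (int * int)) : R :=
  k (x1 / d q.1 - q.2.1%:~R) * k (x2 / d q.1 - 2^-1 - q.2.2%:~R) *
  @sampling_matrix R W q.1 T i b y (d q.1) q.2.

Lemma summand_bounded : exists2 K, 0 <= K & forall x1 x2 y b n,
  abs_bounded (fun p => summand x1 x2 y b (n, p)) (K * lam n).
Proof.
have [C C0 hC] := @kernel_decay2 R N.+2 isT.
exists (200 * C ^+ 2) => [|x1 x2 y b n]; first by rewrite mulr_ge0 // sqr_ge0.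
have := double_series_bounded (x1 / d n) (x2 / d n - 2^-1) C0 hC (@sampling_matrix_le R W n T i b y (d n) (s n) (d_gt0 n) (hs n)).
by rewrite (_ : 25 * _ * _ = 200 * C ^+ 2 * lam n) // /lam /d invrK; ring.
Qed.

Lemma summand_abs_bounded : exists M, forall x1 x2 y b, abs_bounded (summand x1 x2 y b) M.
Proof.
have [K K0 hK] := summand_bounded; exists (`|K| * B) => x1 x2 y b.
exact: (abs_bounded_pair (hK x1 x2 y b) (abs_boundedZ K hB)).
Qed.

Lemma cpart_divr b (z : R[i]) x : cpart b (z / x%:C) = cpart b z / x.
Proof. by rewrite -(fmorphV (real_complex R)) cpartMr. Qed.

Let rowS x1 x2 y b n : x1 != x2 ->
  sums (fun p => summand x1 x2 y b (n, p)) ((cpart b (g n (pt i x1 y)) - cpart b (g n (pt i x2 y))) / (x1 - x2)).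
Proof. by move=> x12; exact: (@twofold_sampling R w W n T N MT hw hW tT i b y (d n) (s n) x1 x2 (d_gt0 n) (d_le n) (hs n) x12). Qed.

(** Off the diagonal the blocks are summed by [twofold_sampling] and then over [n] by
    [difference_formula]. On the diagonal everything is a limit as the first argument tends to the
    second: each block by continuity of the kernel, and the sum over [n] by Tannery's theorem with
    the Lipschitz majorant [K' * lam n]. *)
Lemma sums_divdiff x1 x2 y b : sums (summand x1 x2 y b) (cpart b (divdiff x1 x2 y)).
Proof.
have [M hM] := summand_abs_bounded.
rewrite /divdiff; case: eqP => [<-|/eqP x12]; last first.
  apply: (sums_pair (hM x1 x2 y b) (fun n => @rowS x1 x2 y b n x12)).
  rewrite cpart_divr cpartB mulrC; apply: eq_sums (sumsZ (x1 - x2)^-1 (@difference_formula R w W T N MT hw hW tT s B hs hB b f i x1 x2 y fC fT hT)) => n.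
  by rewrite mulrC.
clear x2; set x := x1.
have [K K0 hK] := summand_bounded.
pose l n := sval (cid (sums_exist (hK x x y b n))).
have hl n : sums (fun p => summand x x y b (n, p)) (l n) := svalP (cid (sums_exist (hK x x y b n))).
have lb : abs_bounded l (`|K| * B).
  apply: abs_bounded_le (abs_boundedZ K hB) => n.
  exact: le_trans (sums_abs_le (hK x x y b n) (hl n)) (ler_norm _).
have [L hL] := sums_exist lb.
have S := sums_pair (hM x x y b) hl hL.
suff <- : L = cpart b (pderiv i f (pt i x y)) by [].
pose F z := cpart b (f z).
have dF : (fun h => (F (pt i (x + h) y) - F (pt i x y)) / h) @ (0 : R)^' --> cpart b (pderiv i f (pt i x y)).
  have [/(_ (pt i x y)) [h1 h2] _] := fC i.
  have dd : derivable F (pt i x y) (dir i) by rewrite /F; case: (b).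
  rewrite pderiv_cpart -/F; apply: cvg_trans dd; apply: near_eq_cvg; apply: nearW => h /=.
  rewrite mulrC /GRing.scale /=; congr (_ * (F _ - _)).
  by rewrite /pt /dir; case: (i); congr (_, _) => /=; rewrite /GRing.scale /= ?mulr0 ?add0r ?mulr1 1?addrC.
have [K' K'0 hK'] := @band_lipschitz R w W T N MT hw hW tT s hs.
have tn : (fun h => (F (pt i (x + h) y) - F (pt i x y)) / h) @ (0 : R)^' --> L.
  have D := abs_boundedZ K' hB.
  apply: (@tannery R _ _ ((0 : R)^') _ (fun h n => (cpart b (g n (pt i (x + h) y)) - cpart b (g n (pt i x y))) / h) l
    (fun n => K' * lam n) _ L _ _ _ D _ hL).
  - move=> n.
    have [C C0 hC] := @kernel_decay2 R N.+2 isT.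
    apply: (@double_series_continuous R k C (@sampling_matrix R W n T i b y (d n)) (4 * s n / d n) _ ((0 : R)^') _
       (fun h => (x + h) / d n) (fun=> x / d n - 2^-1) _ (x / d n) (x / d n - 2^-1) (l n) C0 (@continuous_skernel R N.+2) hC
       (@sampling_matrix_le R W n T i b y (d n) (s n) (d_gt0 n) (hs n)) _ _ _ (hl n)).
    + apply: cvgM; last exact: cvg_cst.
      rewrite -[X in _ --> X]addr0; apply: cvgD; first exact: cvg_cst.
      exact: cvg_within_filter cvg_id.
    + exact: cvg_cst.
    near=> h; have h0 : h != 0 by near: h; exact: nbhs_dnbhs_neq.
    have xh : x + h != x by rewrite -subr_eq0 addrAC subrr add0r.
    by have := @rowS (x + h) x y b n xh; rewrite [X in _ / X](_ : _ = h); [|rewrite addrAC subrr add0r].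
  - near=> h => n; have h0 : h != 0 by near: h; exact: nbhs_dnbhs_neq.
    rewrite normrM normfV ler_pdivrMr ?normr_gt0 //.
    by have := hK' n b i (x + h) x y; rewrite addrAC subrr add0r.
  near=> h.
  have := sumsZ h^-1 (@difference_formula R w W T N MT hw hW tT s B hs hB b f i (x + h) x y fC fT hT).
  by rewrite mulrC; apply: eq_sums => n; rewrite mulrC.
exact: (cvg_unique _ tn dF).
Unshelve. all: by end_near. Qed.

(* The vectors are indexed by the codes of the pairs [(n, j)] (block, sample point);
   only the slots whose two blocks coincide carry a nonzero entry. *)
Definition slot (jl : nat * nat) : option (int * (int * int)) :=
  if pickle_inv jl.1 is Some (n, j) then
    if pickle_inv jl.2 is Some (m, l) then if n == m :> int then Some (n, (j, l)) else None
    else None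
  else None.

Definition unslot (q : int * (int * int)) : nat * nat := (choice.pickle (q.1, q.2.1), choice.pickle (q.1, q.2.2)).

Lemma unslotK : pcancel unslot slot.
Proof. by move=> [n [j l]]; rewrite /slot /unslot /= !pickleK_inv eqxx. Qed.

Lemma slotK : ocancel slot unslot.
Proof.
move=> [a c]; rewrite /slot /=.
have := @pickle_invK (int * int)%type a; have := @pickle_invK (int * int)%type c.
case: (pickle_inv a) => [[n j]|] //; case: (pickle_inv c) => [[m l]|] // /= hc ha.
by case: eqP => // nm; rewrite /= /unslot /= {2}nm; congr (_, _).
Qed.

(* When [lam n = 0] the block [g n] vanishes, which is consistent with [0^-1 = 0] in
   [mid_factor]. *)
Definition row_factor (th x : R) (m : nat) : R :=
  oapp (fun p : int * int => Num.sqrt (lam p.1) * k (x / d p.1 - th - p.2%:~R)) 0 (pickle_inv m).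

Definition mid_factor b y (j l : nat) : R :=
  oapp (fun p : int * int => oapp (fun q : int * int =>
      if p.1 == q.1 then (lam p.1)^-1 * @sampling_matrix R W p.1 T i b y (d p.1) (p.2, q.2) else 0)
    0 (pickle_inv l)) 0 (pickle_inv j).

Lemma factor_term x1 x2 y b j l :
  row_factor 0 x1 j * row_factor 2^-1 x2 l * mid_factor b y j l = oapp (summand x1 x2 y b) 0 (slot (j, l)).
Proof.
rewrite /row_factor /mid_factor /slot /=.
case: (pickle_inv j) => [[n a]|] /=; last by rewrite !mul0r.
case: (pickle_inv l) => [[m c]|] /=; last by rewrite mulr0.
case: eqP => [<-|] /=; last by rewrite mulr0.
rewrite /summand /= subr0; set S := sampling_matrix W n T i b y (d n) (a, c).
have [l0|l0] := eqVneq (lam n) 0.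
  have sn : s n = 0.
    by move/eqP : l0; rewrite mulf_eq0 gt_eqF ?exprz_gt0 //= => /eqP.
  have : `|S| <= 0.
    by have := @sampling_matrix_le R W n T i b y (d n) (s n) (d_gt0 n) (hs n) (a, c); rewrite sn mulr0 mul0r.
  by rewrite normr_le0 => /eqP ->; rewrite !mulr0.
have := sqr_sqrtr (lam_ge0 n); set r := Num.sqrt _ => hr.
rewrite (_ : _ * _ * _ = r ^+ 2 * (lam n)^-1 * (k (x1 / d n - a%:~R) * k (x2 / d n - 2^-1 - c%:~R) * S)); last by ring.
by rewrite hr divff // mul1r.
Qed.

Lemma abs_bounded_range (u : nat -> R) M (n : nat) : abs_bounded u M -> \sum_(0 <= m < n) `|u m| <= M.
Proof.
move=> h; rewrite (_ : \sum_(0 <= m < n) _ = \sum_(m <- [fset m | m in index_iota 0 n]%fset) `|u m|); first exact: h.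
apply: perm_big; apply: uniq_perm; [exact: iota_uniq|exact: fset_uniq|].
by move=> m; apply/idP/imfsetP => [mn|[q qn ->] //]; exists m.
Qed.

(** [20 = 4 * 5]: the square of the bound [2 / (1 + |t|)] from [kernel_sinc], summed over the
    samples by [decay_abs_bounded]; the weights [lam n] add up to at most [B]. Nothing here depends
    on [N]. *)
Lemma row_factor_l2 th x : (l2norm (fun m => (row_factor th x m)%:C) <= (Num.sqrt (20 * B))%:E)%E.
Proof.
apply: l2norm_le => [|n]; first exact: sqrtr_ge0.
rewrite sqr_sqrtr ?mulr_ge0 //.
pose v (p : int * int) := (Num.sqrt (lam p.1) * k (x / d p.1 - th - p.2%:~R)) ^+ 2.
have hv : abs_bounded v (20 * B).
  apply: (@abs_bounded_pair _ _ _ _ (fun n => 20 * lam n)); last first.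
    by have := abs_boundedZ 20 hB; rewrite ger0_norm.
  move=> m; have D := abs_boundedZ (4 * lam m) (decay_abs_bounded (x / d m - th)).
  have l4 : 0 <= 4 * lam m by rewrite mulr_ge0.
  rewrite (ger0_norm l4) (_ : 4 * lam m * 5 = 20 * lam m) in D; last by set r := lam m; ring.
  apply: abs_bounded_le D => j; rewrite /v /=.
  set t := x / d m - th - j%:~R; have h := kernel_sinc N.+2 t; rewrite -/k in h.
  have t0 : 0 < 1 + `|t| by rewrite ltr_wpDr.
  rewrite [leLHS]ger0_norm ?sqr_ge0 // exprMn sqr_sqrtr //.
  rewrite [leRHS]ger0_norm; last by rewrite mulr_ge0 // invr_ge0 exprn_ge0 // ltW.
  rewrite [4 * _]mulrC -[leRHS]mulrA ler_wpM2l //.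
  have -> : 4 / (1 + `|t|) ^+ 2 = (2 / (1 + `|t|)) ^+ 2.
    by rewrite expr_div_n; congr (_ / _); ring.
  by rewrite -(real_normK (num_real (k t))) lerXn2r ?nnegrE // divr_ge0 // ltW.
have := abs_bounded_range n (abs_bounded_embed (@pickle_invK _) hv); apply: le_trans.
apply: ler_sum => m _; rewrite Cabs_sqr /= expr0n addr0 /row_factor.
case: (pickle_inv m) => [p|] /=; last by rewrite expr0n normr0.
by rewrite ger0_norm // sqr_ge0.
Qed.

(** After division by [lam n] the samples of every block are bounded by
    [2 = (lam n)^-1 * (d n)^-1 * s n], so one bound serves all blocks and hence the block diagonal
    matrix. *)
Lemma mid_factor_l2 b y : l2bounded (mid_factor b y) (180 * 2 ^+ 2).
Proof.
have C0 : 0 <= 180 * 2 ^+ 2 :> R by rewrite mulr_ge0 ?exprn_ge0 ?ler0n.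
rewrite /mid_factor.
apply: (@l2bounded_embed R (int * int)%type (int * int)%type nat nat (@pickle_inv (int * int)%type) (@pickle_inv (int * int)%type)
  (@choice.pickle (int * int)%type) (@choice.pickle (int * int)%type)
  (fun p q : int * int => if p.1 == q.1 then (lam p.1)^-1 * @sampling_matrix R W p.1 T i b y (d p.1) (p.2, q.2) else 0)
  _ (@pickle_invK (int * int)%type) (@pickle_invK (int * int)%type) C0).
apply: (@l2bounded_diag R int int int (fun n j l => (lam n)^-1 * @sampling_matrix R W n T i b y (d n) (j, l))); last exact: C0.
move=> n.
pose G x := cpart b (g n (pt i x y)).
have h2 x : `|(lam n)^-1 * (d n)^-1 * G x| <= 2.
  have [l0|l0] := eqVneq (lam n) 0; first by rewrite l0 invr0 !mul0r normr0.
  have p2 : 0 < 2 ^ n :> R by exact: exprz_gt0.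
  have sn : 0 < s n by rewrite lt_neqAle s0 andbT eq_sym; apply: contra l0 => /eqP sn; rewrite /lam sn mulr0.
  rewrite /d invrK /lam !normrM normfV normrM !(gtr0_norm p2) (gtr0_norm sn) (ger0_norm (_ : 0 <= 2)) //.
  apply: (@le_trans _ _ ((2 ^ n * s n)^-1 * (2 * 2 ^ n) * s n)).
    rewrite ler_wpM2l //; last exact: le_trans (cpart_le _ _) (hs n _).
    by rewrite mulr_ge0 ?invr_ge0 ?mulr_ge0 // ltW.
  by rewrite le_eqVlt; apply/orP; left; apply/eqP; field; rewrite !gt_eqF.
have := @divdiff_l2bounded R (fun j => (lam n)^-1 * (d n)^-1 * G (d n * j%:~R)) (fun l => (lam n)^-1 * (d n)^-1 * G (d n * (l%:~R + 2^-1))) 2 (fun j => h2 _) (fun j => h2 _).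
congr l2bounded; apply/funext => j; apply/funext => l; rewrite /sampling_matrix /= -/(G _) -/(G _); ring.
Qed.

Definition mid_cfactor y j l : R[i] := mid_factor false y j l +i* mid_factor true y j l.

(** [54 ^ 2 = 2916] exceeds [4 * 180 * 2 ^ 2 = 2880]. *)
Lemma mid_cfactor_opnorm y : (opnorm (mid_cfactor y) <= 54%:E)%E.
Proof.
apply: (@opnorm_le R _ (180 * 2 ^+ 2)).
- by rewrite mulr_ge0 ?exprn_ge0 ?ler0n.
- exact: ler0n.
- by rewrite !expr2; lra.
- by case; exact: mid_factor_l2.
Qed.

Lemma row_factor_measurable th m : Cmeasurable (fun x => (row_factor th x m)%:C).
Proof.
split; last exact: measurable_cst.
rewrite /row_factor; case: (pickle_inv m) => [p|] /=; last exact: measurable_cst.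
apply: continuous_measurable_fun => x; apply: cvgM; first exact: cvg_cst.
apply: (continuous_cvg _ (@continuous_skernel R N.+2 _)).
by apply: cvgB; [apply: cvgB; [apply: cvgM; [exact: cvg_id|exact: cvg_cst]|exact: cvg_cst]|exact: cvg_cst].
Qed.

Lemma mid_factor_measurable b j l : measurable_fun setT (fun y => mid_factor b y j l).
Proof.
rewrite /mid_factor; case: (pickle_inv j) => [p|] /=; last exact: measurable_cst.
case: (pickle_inv l) => [q|] /=; last exact: measurable_cst.
case: eqP => _; last exact: measurable_cst.
have cG x : continuous (fun y => cpart b (g p.1 (pt i x y))).
  move=> y; exact: (@continuous_comp _ _ _ (fun y => pt i x y) (fun z => cpart b (g p.1 z)) y (@continuous_ptr R i x y) (@conv_continuous R w W p.1 T N MT hW tT b _)).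
apply: continuous_measurable_fun => y; apply: cvgM; first exact: cvg_cst.
apply: cvgM; last exact: cvg_cst.
apply: cvgM; last exact: cvg_cst.
by apply: cvgB; exact: cG.
Qed.

Lemma factor_cvg x1 x2 y : Ccvg (filter_prod \oo \oo)
  (fun MN : nat * nat => \sum_(j < MN.2.+1) \sum_(l < MN.1.+1)
     (row_factor 0 x1 j)%:C * (row_factor 2^-1 x2 l)%:C * mid_cfactor y j l) (divdiff x1 x2 y).
Proof.
apply: Ccvg_cpart => b.
apply: cvg_trans (sums_nat2 (sums_embed unslotK slotK (sums_divdiff x1 x2 y b))).
apply: near_eq_cvg; apply: nearW => MN; rewrite cpart_sum; apply: eq_bigr => j _.
rewrite cpart_sum; apply: eq_bigr => l _; rewrite -factor_term.
by rewrite -(rmorphM (real_complex R)) [X in cpart b X]mulrC cpartMr mulrC; case: (b).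
Qed.

End Representation.

Lemma tempered_has_order (R : realType) (T : (R * R -> R[i]) -> R[i]) :
  tempered T -> exists N MT, tempered_order T N MT.
Proof.
move=> [lin [N [M hM]]]; exists N, M; split; last exact: hM.
by move=> *; exact: lin.
Qed.

(** * Essential supremum norms and the final estimate *)

Section Assembly.
Context {R : realType}.

Lemma Linfty_l2_bounded (H : hilbertType R) (E : spectral_measure H) (a : R -> nat -> R[i]) (r : R) :
  0 <= r -> (forall j, Cmeasurable (fun x => a x j)) -> (forall x, (l2norm (a x) <= r%:E)%E) ->
  Linfty_l2 E a /\ (Linfty_l2_norm E a <= r%:E)%E.
Proof.
move=> r0 ma ha; have h := spm_ess_sup_le E r0 ha; split => //; split => //.
  by move=> x; exact: le_lt_trans (ha x) (ltry _).
exact: le_lt_trans h (ltry _).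
Qed.

Lemma Linfty_B_bounded (H : hilbertType R) (E : spectral_measure H) (c : R -> nat -> nat -> R[i]) (r : R) :
  0 <= r -> (forall j l, Cmeasurable (fun x => c x j l)) -> (forall x, (opnorm (c x) <= r%:E)%E) ->
  Linfty_B E c /\ (Linfty_B_norm E c <= r%:E)%E.
Proof.
move=> r0 mc hc; have h := spm_ess_sup_le E r0 hc; split => //; split => //.
  by move=> x; exact: le_lt_trans (hc x) (ltry _).
exact: le_lt_trans h (ltry _).
Qed.

Lemma mule3_le (x y z : \bar R) (p q r : R) : (0 <= x)%E -> (0 <= y)%E -> (0 <= z)%E ->
  (x <= p%:E)%E -> (y <= q%:E)%E -> (z <= r%:E)%E -> (x * y * z <= (p * q * r)%:E)%E.
Proof.
move=> x0 y0 z0 xp yq zr; rewrite !EFinM; apply: lee_pmul => //; first exact: mule_ge0.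
exact: lee_pmul.
Qed.

End Assembly.

Theorem theorem6p3 (R : realType) :
  exists C : R, 0 < C /\
  forall (w : R -> R) (W : int -> R * R -> R[i]),
    lp_profile w -> lp_kernels w W ->
  forall (T : (R * R -> R[i]) -> R[i]) (f : R * R -> R[i]),
    besov W T -> C1 f -> represents f T ->
  forall (H1 H2 H3 : hilbertType R) (E1 : spectral_measure H1)
    (E2 : spectral_measure H2) (E3 : spectral_measure H3),
    [/\ tensor1 E1 E2 E3 (divdiff1 f),
        tensor2 E1 E2 E3 (divdiff2 f),
        (tensor1_norm E1 E2 E3 (divdiff1 f) <= C%:E * besov_norm W T)%E &
        (tensor2_norm E1 E2 E3 (divdiff2 f) <= C%:E * besov_norm W T)%E].
Proof.
(* [1080 = 20 * 54]: two vectors of norm at most [Num.sqrt (20 * B)] and a matrix of norm at most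
   54. *)
exists 1080; split; first by rewrite ltr0n.
move=> w W hw hW T f [tT fin hT] fC fT H1 H2 H3 E1 E2 E3.
have [N [MT oT]] := tempered_has_order tT.
have [B [s [BE hs hB]]] := besov_bounds (fun n x => @conv_le_Linfty R w W n T N MT hW oT x) fin.
have B0 : 0 <= B := abs_bounded_ge0 hB.
have r0 : 0 <= Num.sqrt (20 * B) := sqrtr_ge0 _.
pose al x m : R[i] := (row_factor N s 0 x m)%:C.
pose be x m : R[i] := (row_factor N s 2^-1 x m)%:C.
have mga i j l : Cmeasurable (fun y => mid_cfactor W T s i y j l).
  by split; exact: (@mid_factor_measurable R w W T N MT hW oT s i _ j l).
have bal H (E : spectral_measure H) := @Linfty_l2_bounded R H E al _ r0
  (@row_factor_measurable R N s 0) (row_factor_l2 N hs hB 0).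
have bbe H (E : spectral_measure H) := @Linfty_l2_bounded R H E be _ r0
  (@row_factor_measurable R N s 2^-1) (row_factor_l2 N hs hB 2^-1).
have bga H (E : spectral_measure H) i := @Linfty_B_bounded R H E (mid_cfactor W T s i) _ (ler0n R 54)
  (mga i) (mid_cfactor_opnorm i hs).
have fac i := @factor_cvg R w W T N MT hw hW oT s B f i hs hB fC fT hT.
have rep1 : tensor1_rep E1 E2 E3 (divdiff1 f) al be (mid_cfactor W T s false).
  by split; [exact: (bal _ E1).1|exact: (bbe _ E2).1|exact: (bga _ E3 false).1|exact: fac].
have rep2 : tensor2_rep E1 E2 E3 (divdiff2 f) (mid_cfactor W T s true) al be.
  split; [exact: (bga _ E1 true).1|exact: (bal _ E2).1|exact: (bbe _ E3).1|move=> x1 x2 x3].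
  have := fac true x2 x3 x1; congr Ccvg; apply/funext => MN.
  by apply: eq_bigr => j _; apply: eq_bigr => l _; rewrite mulrC mulrA.
have const : (1080%:E * besov_norm W T = (Num.sqrt (20 * B) * Num.sqrt (20 * B) * 54)%:E)%E.
  rewrite BE -expr2 sqr_sqrtr ?mulr_ge0 ?ler0n // -EFinM; congr EFin.
  by ring.
split; [by exists al, be, (mid_cfactor W T s false)|by exists (mid_cfactor W T s true), al, be| |].
- apply: ge_ereal_inf; exists (Linfty_l2_norm E1 al * Linfty_l2_norm E2 be * Linfty_B_norm E3 (mid_cfactor W T s false))%E.
    by exists al, be, (mid_cfactor W T s false).
  rewrite const; apply: mule3_le; try exact: spm_ess_sup_ge0.
  + exact: (bal _ E1).2.
  + exact: (bbe _ E2).2.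
  + exact: (bga _ E3 false).2.
- apply: ge_ereal_inf; exists (Linfty_B_norm E1 (mid_cfactor W T s true) * Linfty_l2_norm E2 al * Linfty_l2_norm E3 be)%E.
    by exists (mid_cfactor W T s true), al, be.
  rewrite const (_ : _ * 54 = 54 * Num.sqrt (20 * B) * Num.sqrt (20 * B)); last by rewrite mulrC mulrA.
  apply: mule3_le; try exact: spm_ess_sup_ge0.
  + exact: (bga _ E1 true).2.
  + exact: (bal _ E2).2.
  + exact: (bbe _ E3).2.
Qed.
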